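(* There exists an infinite family of flat tori in $\mathbb{R}^4$ (that is, immersions $f:\mathbb{T}^2\to\mathbb{R}^4$ of a two-dimensional torus whose induced metric is flat) with flat normal bundle that are not products of curves and do not lie in any affine $3$-sphere of $\mathbb{R}^4$.
   Context: An immersion $f:\Sigma\to\mathbb{R}^4$ of a surface has flat normal bundle if its normal curvature tensor vanishes identically, $R^\perp\equiv 0$. A product of curves (product torus) is a surface $\gamma_1\times\gamma_2\subset\mathbb{R}^2\times\mathbb{R}^2\equiv\mathbb{R}^4$, where $\gamma_1,\gamma_2$ are regular closed plane curves lying in two orthogonal planes of $\mathbb{R}^4$. An affine $3$-sphere of $\mathbb{R}^4$ is a round sphere $\{x\in\mathbb{R}^4: |x-a|=\rho\}$ with arbitrary center $a\in\mathbb{R}^4$ and radius $\rho>0$. *)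

(* Defs.v *)
From Stdlib Require Export Reals.
From Coquelicot Require Export Coquelicot.
Open Scope R_scope.

(* Coquelicot's module structure on products supplies [plus], [minus],
   [scal] and [zero] on R^4.  The Euclidean structure is [dot] / [enorm]. *)
Definition R4 : Type := (R * R * R * R)%type.

Definition x1 (v : R4) : R := fst (fst (fst v)).
Definition x2 (v : R4) : R := snd (fst (fst v)).
Definition x3 (v : R4) : R := snd (fst v).
Definition x4 (v : R4) : R := snd v.

Definition add4 (u v : R4) : R4 := plus u v.
Definition sub4 (u v : R4) : R4 := minus u v.
Definition scal4 (a : R) (v : R4) : R4 := scal a v.
Definition zero4 : R4 := zero.

Definition dot (u v : R4) : R :=
  x1 u * x1 v + x2 u * x2 v + x3 u * x3 v + x4 u * x4 v.
Definition enorm (v : R4) : R := sqrt (dot v v).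

Inductive idx : Set := i1 | i2.

Definition isum (F : idx -> R) : R := F i1 + F i2.
Definition isum4 (F : idx -> R4) : R4 := add4 (F i1) (F i2).

Definition pd (i : idx) : (R -> R -> R) -> R -> R -> R :=
  match i with
  | i1 => partial_derive 1 0
  | i2 => partial_derive 0 1
  end.

Definition pd4 (i : idx) (X : R -> R -> R4) (s t : R) : R4 :=
  (pd i (fun a b => x1 (X a b)) s t, pd i (fun a b => x2 (X a b)) s t,
   pd i (fun a b => x3 (X a b)) s t, pd i (fun a b => x4 (X a b)) s t).

(* [ex_diff_n h n s t]: all iterated partial derivatives of h of order at most n
   exist at (s, t) and are jointly continuous there. *)
Definition smooth2 (h : R -> R -> R) : Prop :=
  forall (n : nat) (s t : R), ex_diff_n h n s t.

Definition smooth_R2_R4 (X : R -> R -> R4) : Prop :=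
  smooth2 (fun s t => x1 (X s t)) /\ smooth2 (fun s t => x2 (X s t)) /\
  smooth2 (fun s t => x3 (X s t)) /\ smooth2 (fun s t => x4 (X s t)).

(* A smooth map from the torus R^2/Z^2 to R^4 is represented by its lift to the
   universal cover R^2.  Every lattice torus is diffeomorphic to R^2/Z^2, and the
   metric considered below is always the induced one, so nothing is lost by fixing
   the lattice Z^2. *)
Definition torus_map (f : R -> R -> R4) : Prop :=
  smooth_R2_R4 f /\
  forall s t, f (s + 1) t = f s t /\ f s (t + 1) = f s t.

Definition immersion (f : R -> R -> R4) : Prop :=
  forall s t a b,
    add4 (scal4 a (pd4 i1 f s t)) (scal4 b (pd4 i2 f s t)) = zero4 ->
    a = 0 /\ b = 0.

Definition metric (f : R -> R -> R4) (i j : idx) (s t : R) : R :=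
  dot (pd4 i f s t) (pd4 j f s t).

Definition metric_det (f : R -> R -> R4) (s t : R) : R :=
  metric f i1 i1 s t * metric f i2 i2 s t - metric f i1 i2 s t ^ 2.

Definition metric_inv (f : R -> R -> R4) (i j : idx) (s t : R) : R :=
  match i, j with
  | i1, i1 => metric f i2 i2 s t / metric_det f s t
  | i2, i2 => metric f i1 i1 s t / metric_det f s t
  | _, _ => - metric f i1 i2 s t / metric_det f s t
  end.

(* [christoffel f k i j] is Gamma^k_{ij}. *)
Definition christoffel (f : R -> R -> R4) (k i j : idx) (s t : R) : R :=
  / 2 * isum (fun l =>
    metric_inv f k l s t *
    (pd i (metric f j l) s t + pd j (metric f i l) s t - pd l (metric f i j) s t)).

(* [riemann f l i j k] is the l-th component of R(d_i, d_j) d_k. *)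
Definition riemann (f : R -> R -> R4) (l i j k : idx) (s t : R) : R :=
  pd i (christoffel f l j k) s t - pd j (christoffel f l i k) s t +
  isum (fun m => christoffel f l i m s t * christoffel f m j k s t
                 - christoffel f l j m s t * christoffel f m i k s t).

Definition flat_induced_metric (f : R -> R -> R4) : Prop :=
  forall (l i j k : idx) (s t : R), riemann f l i j k s t = 0.

Definition tangent_part (f : R -> R -> R4) (s t : R) (v : R4) : R4 :=
  isum4 (fun i => scal4 (isum (fun j => metric_inv f i j s t * dot v (pd4 j f s t)))
                        (pd4 i f s t)).

Definition normal_part (f : R -> R -> R4) (s t : R) (v : R4) : R4 :=
  sub4 v (tangent_part f s t v).

Definition normal_field (f : R -> R -> R4) (xi : R -> R -> R4) : Prop :=
  smooth_R2_R4 xi /\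
  forall (i : idx) (s t : R), dot (xi s t) (pd4 i f s t) = 0.

Definition normal_connection (f : R -> R -> R4) (i : idx) (xi : R -> R -> R4)
  (s t : R) : R4 := normal_part f s t (pd4 i xi s t).

(* The term in the Lie bracket [d_i, d_j] is absent because it vanishes. *)
Definition normal_curvature (f : R -> R -> R4) (i j : idx) (xi : R -> R -> R4)
  (s t : R) : R4 :=
  sub4 (normal_connection f i (normal_connection f j xi) s t)
       (normal_connection f j (normal_connection f i xi) s t).

(* Normal fields live on the universal cover and need not be periodic: the normal
   curvature is a tensor, and every normal vector of f extends to such a field. *)
Definition flat_normal_bundle (f : R -> R -> R4) : Prop :=
  forall xi, normal_field f xi ->
  forall (i j : idx) (s t : R), normal_curvature f i j xi s t = zero4.

Definition image (f : R -> R -> R4) (p : R4) : Prop :=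
  exists s t, p = f s t.

(* A regular closed plane curve t |-> (a t, b t), possibly self-intersecting. *)
Definition regular_closed_curve (a b : R -> R) : Prop :=
  (forall n t, ex_derive_n a n t /\ ex_derive_n b n t) /\
  (forall t, ~ (Derive a t = 0 /\ Derive b t = 0)) /\
  exists T, 0 < T /\ forall t, a (t + T) = a t /\ b (t + T) = b t.

Definition orthonormal (e1 e2 e3 e4 : R4) : Prop :=
  (dot e1 e1 = 1 /\ dot e2 e2 = 1 /\ dot e3 e3 = 1 /\ dot e4 e4 = 1) /\
  dot e1 e2 = 0 /\ dot e1 e3 = 0 /\ dot e1 e4 = 0 /\
  dot e2 e3 = 0 /\ dot e2 e4 = 0 /\ dot e3 e4 = 0.

(* The planes span(e1, e2) and span(e3, e4) are an arbitrary pair of orthogonal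
   planes; translations are absorbed by the curves.  Being a product is a property
   of the image, hence insensitive to the parametrization of the torus. *)
Definition product_of_curves (f : R -> R -> R4) : Prop :=
  exists (e1 e2 e3 e4 : R4) (a b c d : R -> R),
    orthonormal e1 e2 e3 e4 /\
    regular_closed_curve a b /\ regular_closed_curve c d /\
    forall p, image f p <->
      exists u v,
        p = add4 (add4 (scal4 (a u) e1) (scal4 (b u) e2))
                 (add4 (scal4 (c v) e3) (scal4 (d v) e4)).

Definition in_affine_3sphere (f : R -> R -> R4) : Prop :=
  exists (a : R4) (rho : R), 0 < rho /\
    forall p, image f p -> enorm (sub4 p a) = rho.

Definition similarity (phi : R4 -> R4) : Prop :=
  exists lambda, 0 < lambda /\
    forall p q, enorm (sub4 (phi p) (phi q)) = lambda * enorm (sub4 p q).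

(* The images of f and g agree up to rigid motion and homothety; reparametrizing
   f or g changes nothing. *)
Definition similar_surfaces (f g : R -> R -> R4) : Prop :=
  exists phi, similarity phi /\
    forall q, image g q <-> exists p, image f p /\ q = phi p.

(* Main.v *)
Require Import Defs.
From Stdlib Require Import ZArith Lra Lia FunctionalExtensionality Classical
  IndefiniteDescription.

(** The tori are Ribaucour transforms of products of two figure-eight curves.

Let [P] be a product of plane curves with unit tangents [T1], [T2], and let [G]
be a field along it, sum of a field in each plane, whose partial derivatives are
multiples [D1 T1], [D2 T2] of the tangents.  If [phi] is a function with
[d phi = <G, dP>], then the partial derivatives of [P - 2 phi G / |G|^2] are
multiples of the images of [T1], [T2] under the reflection in the hyperplane
orthogonal to [G] ([deflect_pd]).  Hence the new surface has orthogonal coordinate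
lines.  The reflected normals of the two curves form a normal frame with tangent
derivatives, so the normal bundle is flat ([ribaucour_flat_normal_bundle]).  By
the Lame equations the induced metric is flat when a certain relation between
[G], [D1], [D2] and the turning of the curves holds ([ribaucour_flat]).  This
relation has explicit solutions.  In the complex notation for each plane, with
[a] a parameter close to the tangent angle, they are [i exp (eta / 2 + i b)] with
[sinh eta = e cos (2 a)], [b' = 2 e cos^2 a / cosh eta] and tangent
[exp (i (a + b))], where the parameter [e] changes sign between the two planes
([figure_flatness]).  As only the dependence on the angle [a] is prescribed, it
may oscillate along a curve: everything built from it is then periodic, and what
remains is that the curve and [phi] close up.  Two of these conditions hold by
symmetry, the third one by a correction of the speed ([closing]).  For small [e]
the transform is close to the reflection of a product and is therefore an
immersion ([torus_lame]).

The transform is not in a sphere: where the tangent angle is extremal the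
coordinate curve has no normal curvature, while in a sphere it has at least the
inverse of the radius ([ribaucour_not_in_sphere]).  It is not a product: at every
point the orthogonal projection to either plane of a splitting has rank at most
one, since a map into a plane curve cannot have rank two ([map_into_curve_rank]);
these conditions at four points contradict each other ([ribaucour_not_product]).

For the infinite family, the second curve is scaled by [L] and [e] is of order
[1 / L].  The torus then has diameter of order [L] but stays within bounded
distance of a plane, without lying in a plane.  The volumes of tetrahedra,
normalized by the diameter, are positive for each torus and tend to zero with
[L], so among sufficiently sparse values of [L] no two tori are similar
([tori_not_similar]). *)

(** * Smooth functions of one and two variables *)

(** A class of smooth functions closed under derivation and, through
[smooth1_primitive], under integration; every smooth function whose derivative is
already known to be smooth enters it in this way. *)
Inductive smooth1 : (R -> R) -> Prop :=
| smooth1_const c : smooth1 (fun _ => c)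
| smooth1_id : smooth1 (fun x => x)
| smooth1_plus g h : smooth1 g -> smooth1 h -> smooth1 (fun x => g x + h x)
| smooth1_mult g h : smooth1 g -> smooth1 h -> smooth1 (fun x => g x * h x)
| smooth1_inv g :
    smooth1 g -> (forall x, g x <> 0) -> smooth1 (fun x => / g x)
| smooth1_sqrt g :
    smooth1 g -> (forall x, 0 < g x) -> smooth1 (fun x => sqrt (g x))
| smooth1_sin g : smooth1 g -> smooth1 (fun x => sin (g x))
| smooth1_cos g : smooth1 g -> smooth1 (fun x => cos (g x))
| smooth1_primitive g h :
    (forall x, is_derive g x (h x)) -> smooth1 h -> smooth1 g.

Lemma smooth1_derive g :
  smooth1 g -> exists g', (forall x, is_derive g x (g' x)) /\ smooth1 g'.
Proof.
induction 1 as [c | | g h Hg [g' [Dg Sg]] Hh [h' [Dh Sh]]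
  | g h Hg [g' [Dg Sg]] Hh [h' [Dh Sh]] | g Hg [g' [Dg Sg]] Hn
  | g Hg [g' [Dg Sg]] Hp | g Hg [g' [Dg Sg]] | g Hg [g' [Dg Sg]]
  | g h Dg Hh _].
- exists (fun _ => 0); split; [intros x; auto_derive; auto | constructor].
- exists (fun _ => 1); split; [intros x; auto_derive; auto | constructor].
- exists (fun x => g' x + h' x); split; [|now constructor].
  intros x; apply @is_derive_plus; auto.
- exists (fun x => g' x * h x + g x * h' x); split.
  + intros x; apply Derive.is_derive_mult; auto.
  + constructor; now constructor.
- exists (fun x => (-1 * g' x) * (/ g x * / g x)); split.
  + intros x; evar_last; [apply is_derive_inv; [apply Dg | apply Hn]|].
    field; apply Hn.
  + repeat constructor; auto.
- exists (fun x => g' x * / (2 * sqrt (g x))); split.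
  + intros x; apply (is_derive_sqrt g x (g' x)); auto.
  + constructor; [easy|].
    apply (smooth1_inv (fun x => 2 * sqrt (g x))).
    * repeat constructor; auto.
    * intros x; assert (H := sqrt_lt_R0 _ (Hp x)); lra.
- exists (fun x => g' x * cos (g x)); split; [|repeat constructor; auto].
  intros x; apply (is_derive_comp sin g); [apply is_derive_sin | apply Dg].
- exists (fun x => g' x * (-1 * sin (g x))); split; [|repeat constructor; auto].
  intros x; evar_last.
  + apply (is_derive_comp cos g); [apply is_derive_cos | apply Dg].
  + unfold scal; simpl; unfold mult; simpl; ring.
- now exists h.
Qed.

Lemma smooth1_continuous g x : smooth1 g -> continuous g x.
Proof.
intros Hg; destruct (smooth1_derive g Hg) as [g' [Dg _]].
apply @ex_derive_continuous; exists (g' x); apply Dg.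
Qed.

Lemma smooth1_atan g : smooth1 g -> smooth1 (fun x => atan (g x)).
Proof.
intros Hg; destruct (smooth1_derive g Hg) as [g' [Dg Sg]].
assert (Hpos : forall x, 1 + g x * g x <> 0) by (intros x; nra).
apply (smooth1_primitive _ (fun x => g' x * / (1 + g x * g x))).
- intros x; apply (is_derive_comp atan g); [apply is_derive_atan | apply Dg].
- constructor; [easy|].
  apply (smooth1_inv (fun x => 1 + g x * g x)); [|easy].
  repeat constructor; easy.
Qed.

Lemma smooth1_opp g : smooth1 g -> smooth1 (fun x => - g x).
Proof.
intros Hg.
replace (fun x => - g x) with (fun x => -1 * g x)
  by (apply functional_extensionality; intros x; ring).
now repeat constructor.
Qed.

(** The two-variable functions obtained from smooth ones by the field
operations form a class of continuous functions stable under partial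
derivation, so its members are smooth; this replaces one induction on the order
of differentiation for every operation by a single one. *)
Inductive smooth_generated : (R -> R -> R) -> Prop :=
| generated_base h : smooth2 h -> smooth_generated h
| generated_first g : smooth1 g -> smooth_generated (fun s _ => g s)
| generated_second g : smooth1 g -> smooth_generated (fun _ t => g t)
| generated_plus g h : smooth_generated g -> smooth_generated h ->
    smooth_generated (fun s t => g s t + h s t)
| generated_mult g h : smooth_generated g -> smooth_generated h ->
    smooth_generated (fun s t => g s t * h s t)
| generated_inv g : smooth_generated g -> (forall s t, g s t <> 0) ->
    smooth_generated (fun s t => / g s t).

Definition has_partials (h : R -> R -> R) (hs ht : R -> R -> R) : Prop :=
  forall s t, is_derive (fun z => h z t) s (hs s t) /\
              is_derive (fun z => h s z) t (ht s t).

Lemma smooth2_partials h : smooth2 h -> has_partials h (pd i1 h) (pd i2 h).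
Proof.
intros Hh s t; destruct (Hh 1%nat s t) as [_ [H1 [H2 _]]].
split; apply Derive_correct; assumption.
Qed.

Lemma has_partials_pd h hs ht :
  has_partials h hs ht -> pd i1 h = hs /\ pd i2 h = ht.
Proof.
intros H; split; apply functional_extensionality; intros s;
  apply functional_extensionality; intros t; destruct (H s t);
  now apply is_derive_unique.
Qed.

Lemma smooth2_pd i h : smooth2 h -> smooth2 (pd i h).
Proof.
intros Hh n s t; destruct (Hh (S n) s t) as [_ [_ [_ [H1 H2]]]].
now destruct i.
Qed.

Lemma smooth_generated_continuous h s t :
  smooth_generated h -> continuity_2d_pt h s t.
Proof.
induction 1 as [h Hh | g Hg | g Hg | g h _ IHg _ IHh | g h _ IHg _ IHh
  | g _ IHg Hn].
- apply (Hh 0%nat s t).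
- apply (continuity_1d_2d_pt_comp g (fun s _ => s));
    [|apply continuity_2d_pt_id1].
  now apply continuity_pt_filterlim, smooth1_continuous.
- apply (continuity_1d_2d_pt_comp g (fun _ t => t));
    [|apply continuity_2d_pt_id2].
  now apply continuity_pt_filterlim, smooth1_continuous.
- now apply continuity_2d_pt_plus.
- now apply continuity_2d_pt_mult.
- now apply continuity_2d_pt_inv.
Qed.

Lemma smooth_generated_partials h : smooth_generated h ->
  exists hs ht, has_partials h hs ht /\
    smooth_generated hs /\ smooth_generated ht.
Proof.
induction 1 as [h Hh | g Hg | g Hg
  | g h Hg [gs [gt [Dg [Gs Gt]]]] Hh [hs [ht [Dh [Hs Ht]]]]
  | g h Hg [gs [gt [Dg [Gs Gt]]]] Hh [hs [ht [Dh [Hs Ht]]]]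
  | g Hg [gs [gt [Dg [Gs Gt]]]] Hn].
- exists (pd i1 h), (pd i2 h); split; [now apply smooth2_partials|].
  split; apply generated_base; now apply smooth2_pd.
- destruct (smooth1_derive g Hg) as [g' [Dg Sg]].
  exists (fun s _ => g' s), (fun _ _ => 0); split; [|split].
  + intros s t; split; [apply Dg | apply @is_derive_const].
  + now constructor.
  + apply (generated_first (fun _ => 0)); constructor.
- destruct (smooth1_derive g Hg) as [g' [Dg Sg]].
  exists (fun _ _ => 0), (fun _ t => g' t); split; [|split].
  + intros s t; split; [apply @is_derive_const | apply Dg].
  + apply (generated_first (fun _ => 0)); constructor.
  + now constructor.
- exists (fun s t => gs s t + hs s t), (fun s t => gt s t + ht s t).
  split; [|split; now constructor].
  intros s t; destruct (Dg s t), (Dh s t); split.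
  + now apply (is_derive_plus (fun z => g z t) (fun z => h z t)).
  + now apply (is_derive_plus (fun z => g s z) (fun z => h s z)).
- exists (fun s t => gs s t * h s t + g s t * hs s t),
         (fun s t => gt s t * h s t + g s t * ht s t).
  split; [|split; constructor; now constructor].
  intros s t; destruct (Dg s t), (Dh s t); split.
  + now apply (Derive.is_derive_mult (fun z => g z t) (fun z => h z t)).
  + now apply (Derive.is_derive_mult (fun z => g s z) (fun z => h s z)).
- exists (fun s t => (-1 * gs s t) * (/ g s t * / g s t)),
         (fun s t => (-1 * gt s t) * (/ g s t * / g s t)).
  assert (Hm1 : smooth_generated (fun _ _ => -1))
    by (apply (generated_first (fun _ => -1)); constructor).
  split; [|split; constructor; constructor; auto; now constructor].
  intros s t; destruct (Dg s t) as [D1 D2].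
  split; evar_last.
  + apply (is_derive_inv (fun z => g z t)); [exact D1 | apply Hn].
  + simpl; field; apply Hn.
  + apply (is_derive_inv (fun z => g s z)); [exact D2 | apply Hn].
  + simpl; field; apply Hn.
Qed.

Lemma smooth_generated_smooth2 h : smooth_generated h -> smooth2 h.
Proof.
intros Hh n; revert h Hh; induction n as [|n IHn]; intros h Hh s t.
- split; [now apply smooth_generated_continuous | easy].
- destruct (smooth_generated_partials h Hh) as [hs [ht [D [Hs Ht]]]].
  destruct (has_partials_pd _ _ _ D) as [E1 E2].
  destruct (D s t) as [Ds Dt].
  split; [now apply smooth_generated_continuous|].
  split; [now exists (hs s t)|]; split; [now exists (ht s t)|].
  split; [change (ex_diff_n (pd i1 h) n s t); rewrite E1
         |change (ex_diff_n (pd i2 h) n s t); rewrite E2]; now apply IHn.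
Qed.

Lemma smooth2_first g : smooth1 g -> smooth2 (fun s _ => g s).
Proof. intros; apply smooth_generated_smooth2; now constructor. Qed.

Lemma smooth2_second g : smooth1 g -> smooth2 (fun _ t => g t).
Proof. intros; apply smooth_generated_smooth2; now constructor. Qed.

Lemma smooth2_const c : smooth2 (fun _ _ => c).
Proof. apply (smooth2_first (fun _ => c)); constructor. Qed.

Lemma smooth2_plus g h :
  smooth2 g -> smooth2 h -> smooth2 (fun s t => g s t + h s t).
Proof.
intros; apply smooth_generated_smooth2, generated_plus; now apply generated_base.
Qed.

Lemma smooth2_mult g h :
  smooth2 g -> smooth2 h -> smooth2 (fun s t => g s t * h s t).
Proof.
intros; apply smooth_generated_smooth2, generated_mult; now apply generated_base.
Qed.

Lemma smooth2_inv g :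
  smooth2 g -> (forall s t, g s t <> 0) -> smooth2 (fun s t => / g s t).
Proof.
intros Hg Hn; apply smooth_generated_smooth2, generated_inv; [|easy].
now apply generated_base.
Qed.

Lemma smooth2_opp g : smooth2 g -> smooth2 (fun s t => - g s t).
Proof.
intros Hg.
replace (fun s t => - g s t) with (fun s t => -1 * g s t).
- apply smooth2_mult; [apply smooth2_const | easy].
- do 2 (apply functional_extensionality; intros ?); ring.
Qed.

Lemma pd_commute h s t :
  smooth2 h -> pd i1 (pd i2 h) s t = pd i2 (pd i1 h) s t.
Proof.
intros Hh.
assert (H1 := smooth2_pd i1 _ Hh); assert (H2 := smooth2_pd i2 _ Hh).
apply (Schwarz h s t).
- exists (mkposreal 1 Rlt_0_1); intros u v _ _; split; [|split; [|split]].
  + eexists; apply (smooth2_partials _ Hh u v).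
  + eexists; apply (smooth2_partials _ Hh u v).
  + eexists; apply (smooth2_partials _ H2 u v).
  + eexists; apply (smooth2_partials _ H1 u v).
- apply (smooth2_pd i1 _ H2 0%nat).
- apply (smooth2_pd i2 _ H1 0%nat).
Qed.

(** * Frames of R^4 *)

Lemma R4_ext u v :
  x1 u = x1 v -> x2 u = x2 v -> x3 u = x3 v -> x4 u = x4 v -> u = v.
Proof.
destruct u as [[[a b] c] d], v as [[[a' b'] c'] d']; cbv -[Rplus].
now intros -> -> -> ->.
Qed.

Lemma x1_add u v : x1 (add4 u v) = x1 u + x1 v. Proof. easy. Qed.
Lemma x2_add u v : x2 (add4 u v) = x2 u + x2 v. Proof. easy. Qed.
Lemma x3_add u v : x3 (add4 u v) = x3 u + x3 v. Proof. easy. Qed.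
Lemma x4_add u v : x4 (add4 u v) = x4 u + x4 v. Proof. easy. Qed.
Lemma x1_sub u v : x1 (sub4 u v) = x1 u - x1 v. Proof. easy. Qed.
Lemma x2_sub u v : x2 (sub4 u v) = x2 u - x2 v. Proof. easy. Qed.
Lemma x3_sub u v : x3 (sub4 u v) = x3 u - x3 v. Proof. easy. Qed.
Lemma x4_sub u v : x4 (sub4 u v) = x4 u - x4 v. Proof. easy. Qed.
Lemma x1_scal a v : x1 (scal4 a v) = a * x1 v. Proof. easy. Qed.
Lemma x2_scal a v : x2 (scal4 a v) = a * x2 v. Proof. easy. Qed.
Lemma x3_scal a v : x3 (scal4 a v) = a * x3 v. Proof. easy. Qed.
Lemma x4_scal a v : x4 (scal4 a v) = a * x4 v. Proof. easy. Qed.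
Lemma x1_zero : x1 zero4 = 0. Proof. easy. Qed.
Lemma x2_zero : x2 zero4 = 0. Proof. easy. Qed.
Lemma x3_zero : x3 zero4 = 0. Proof. easy. Qed.
Lemma x4_zero : x4 zero4 = 0. Proof. easy. Qed.

Ltac coords :=
  rewrite ?x1_add, ?x2_add, ?x3_add, ?x4_add, ?x1_sub, ?x2_sub, ?x3_sub,
    ?x4_sub, ?x1_scal, ?x2_scal, ?x3_scal, ?x4_scal,
    ?x1_zero, ?x2_zero, ?x3_zero, ?x4_zero.
Ltac by_coords := apply R4_ext; repeat (progress coords); try ring.

Lemma dot_sym u v : dot u v = dot v u.
Proof. unfold dot; ring. Qed.

Lemma dot_add_l u v w : dot (add4 u v) w = dot u w + dot v w.
Proof. unfold dot; coords; ring. Qed.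

Lemma dot_sub_l u v w : dot (sub4 u v) w = dot u w - dot v w.
Proof. unfold dot; coords; ring. Qed.

Lemma dot_scal_l a u w : dot (scal4 a u) w = a * dot u w.
Proof. unfold dot; coords; ring. Qed.

Lemma dot_add_r u v w : dot w (add4 u v) = dot w u + dot w v.
Proof. unfold dot; coords; ring. Qed.

Lemma dot_scal_r a u w : dot w (scal4 a u) = a * dot w u.
Proof. unfold dot; coords; ring. Qed.

(** The orthogonal projection [P] onto the complement of four orthonormal
vectors has trace zero, and the squared entries of a projection add up to its
trace; hence [P = 0]. *)
Lemma orthonormal_expansion e1 e2 e3 e4 v : orthonormal e1 e2 e3 e4 ->
  v = add4 (add4 (scal4 (dot v e1) e1) (scal4 (dot v e2) e2))
           (add4 (scal4 (dot v e3) e3) (scal4 (dot v e4) e4)).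
Proof.
intros [[H11 [H22 [H33 H44]]] [H12 [H13 [H14 [H23 [H24 H34]]]]]].
set (P := fun (d : R) (p q : R4 -> R) =>
  d - p e1 * q e1 - p e2 * q e2 - p e3 * q e3 - p e4 * q e4).
assert (HP : (P 1 x1 x1)^2 + (P 1 x2 x2)^2 + (P 1 x3 x3)^2 + (P 1 x4 x4)^2
  + 2 * ((P 0 x1 x2)^2 + (P 0 x1 x3)^2 + (P 0 x1 x4)^2 + (P 0 x2 x3)^2
         + (P 0 x2 x4)^2 + (P 0 x3 x4)^2) = 0).
{ transitivity (4 - 2 * (dot e1 e1 + dot e2 e2 + dot e3 e3 + dot e4 e4)
    + (dot e1 e1)^2 + (dot e2 e2)^2 + (dot e3 e3)^2 + (dot e4 e4)^2
    + 2 * ((dot e1 e2)^2 + (dot e1 e3)^2 + (dot e1 e4)^2 + (dot e2 e3)^2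
           + (dot e2 e4)^2 + (dot e3 e4)^2)).
  - unfold P, dot; ring.
  - rewrite H11, H22, H33, H44, H12, H13, H14, H23, H24, H34; ring. }
assert (Z11 : P 1 x1 x1 = 0) by nra. assert (Z22 : P 1 x2 x2 = 0) by nra.
assert (Z33 : P 1 x3 x3 = 0) by nra. assert (Z44 : P 1 x4 x4 = 0) by nra.
assert (Z12 : P 0 x1 x2 = 0) by nra. assert (Z13 : P 0 x1 x3 = 0) by nra.
assert (Z14 : P 0 x1 x4 = 0) by nra. assert (Z23 : P 0 x2 x3 = 0) by nra.
assert (Z24 : P 0 x2 x4 = 0) by nra. assert (Z34 : P 0 x3 x4 = 0) by nra.
apply R4_ext; repeat (progress coords); apply Rminus_diag_uniq.
- transitivity (P 1 x1 x1 * x1 v + P 0 x1 x2 * x2 v + P 0 x1 x3 * x3 v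
    + P 0 x1 x4 * x4 v); [unfold P, dot; ring | rewrite Z11, Z12, Z13, Z14; ring].
- transitivity (P 0 x1 x2 * x1 v + P 1 x2 x2 * x2 v + P 0 x2 x3 * x3 v
    + P 0 x2 x4 * x4 v); [unfold P, dot; ring | rewrite Z12, Z22, Z23, Z24; ring].
- transitivity (P 0 x1 x3 * x1 v + P 0 x2 x3 * x2 v + P 1 x3 x3 * x3 v
    + P 0 x3 x4 * x4 v); [unfold P, dot; ring | rewrite Z13, Z23, Z33, Z34; ring].
- transitivity (P 0 x1 x4 * x1 v + P 0 x2 x4 * x2 v + P 0 x3 x4 * x3 v
    + P 1 x4 x4 * x4 v); [unfold P, dot; ring | rewrite Z14, Z24, Z34, Z44; ring].
Qed.

(** * Partial derivatives of vector-valued maps *)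

Lemma pd_plus i g h : smooth2 g -> smooth2 h ->
  pd i (fun s t => g s t + h s t) = fun s t => pd i g s t + pd i h s t.
Proof.
intros Hg Hh.
destruct (has_partials_pd (fun s t => g s t + h s t)
  (fun s t => pd i1 g s t + pd i1 h s t) (fun s t => pd i2 g s t + pd i2 h s t))
  as [E1 E2]; [|now destruct i].
intros s t; destruct (smooth2_partials g Hg s t), (smooth2_partials h Hh s t).
split.
- now apply (is_derive_plus (fun z => g z t) (fun z => h z t)).
- now apply (is_derive_plus (fun z => g s z) (fun z => h s z)).
Qed.

Lemma pd_mult i g h : smooth2 g -> smooth2 h ->
  pd i (fun s t => g s t * h s t) =
  fun s t => pd i g s t * h s t + g s t * pd i h s t.
Proof.
intros Hg Hh.
destruct (has_partials_pd (fun s t => g s t * h s t)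
  (fun s t => pd i1 g s t * h s t + g s t * pd i1 h s t)
  (fun s t => pd i2 g s t * h s t + g s t * pd i2 h s t))
  as [E1 E2]; [|now destruct i].
intros s t; destruct (smooth2_partials g Hg s t), (smooth2_partials h Hh s t).
split.
- now apply (Derive.is_derive_mult (fun z => g z t) (fun z => h z t)).
- now apply (Derive.is_derive_mult (fun z => g s z) (fun z => h s z)).
Qed.

Lemma pd_opp i h : smooth2 h ->
  pd i (fun s t => - h s t) = fun s t => - pd i h s t.
Proof.
intros Sh.
destruct (has_partials_pd (fun s t => - h s t)
  (fun s t => - pd i1 h s t) (fun s t => - pd i2 h s t)) as [Q1 Q2];
  [|now destruct i].
intros s t; destruct (smooth2_partials h Sh s t) as [D1 D2]; split.
- now apply (is_derive_opp (fun z => h z t)).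
- now apply (is_derive_opp (fun z => h s z)).
Qed.

Lemma pd_inv i v : smooth2 v -> (forall s t, v s t <> 0) ->
  pd i (fun s t => / v s t) = fun s t => - pd i v s t * / v s t * / v s t.
Proof.
intros Sv Nv.
destruct (has_partials_pd (fun s t => / v s t)
  (fun s t => - pd i1 v s t * / v s t * / v s t)
  (fun s t => - pd i2 v s t * / v s t * / v s t)) as [Q1 Q2];
  [|now destruct i].
intros s t; destruct (smooth2_partials v Sv s t) as [D1 D2]; split; evar_last.
- apply (is_derive_inv (fun z => v z t)); [exact D1 | apply Nv].
- simpl; field; apply Nv.
- apply (is_derive_inv (fun z => v s z)); [exact D2 | apply Nv].
- simpl; field; apply Nv.
Qed.

Lemma pd4_add i X Y s t : smooth_R2_R4 X -> smooth_R2_R4 Y ->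
  pd4 i (fun a b => add4 (X a b) (Y a b)) s t = add4 (pd4 i X s t) (pd4 i Y s t).
Proof.
intros [? [? [? ?]]] [? [? [? ?]]].
apply R4_ext; coords; unfold pd4.
- exact (f_equal (fun F => F s t) (pd_plus i (fun a b => x1 (X a b))
    (fun a b => x1 (Y a b)) ltac:(assumption) ltac:(assumption))).
- exact (f_equal (fun F => F s t) (pd_plus i (fun a b => x2 (X a b))
    (fun a b => x2 (Y a b)) ltac:(assumption) ltac:(assumption))).
- exact (f_equal (fun F => F s t) (pd_plus i (fun a b => x3 (X a b))
    (fun a b => x3 (Y a b)) ltac:(assumption) ltac:(assumption))).
- exact (f_equal (fun F => F s t) (pd_plus i (fun a b => x4 (X a b))
    (fun a b => x4 (Y a b)) ltac:(assumption) ltac:(assumption))).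
Qed.

Lemma pd4_scal i m X s t : smooth2 m -> smooth_R2_R4 X ->
  pd4 i (fun a b => scal4 (m a b) (X a b)) s t =
  add4 (scal4 (pd i m s t) (X s t)) (scal4 (m s t) (pd4 i X s t)).
Proof.
intros Hm [? [? [? ?]]].
apply R4_ext; coords; unfold pd4.
- exact (f_equal (fun F => F s t) (pd_mult i m (fun a b => x1 (X a b))
    Hm ltac:(assumption))).
- exact (f_equal (fun F => F s t) (pd_mult i m (fun a b => x2 (X a b))
    Hm ltac:(assumption))).
- exact (f_equal (fun F => F s t) (pd_mult i m (fun a b => x3 (X a b))
    Hm ltac:(assumption))).
- exact (f_equal (fun F => F s t) (pd_mult i m (fun a b => x4 (X a b))
    Hm ltac:(assumption))).
Qed.

Lemma smooth_scal m X : smooth2 m -> smooth_R2_R4 X ->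
  smooth_R2_R4 (fun s t => scal4 (m s t) (X s t)).
Proof.
intros Hm [? [? [? ?]]]; repeat split;
  apply smooth2_mult; assumption.
Qed.

Lemma smooth_dot X Y : smooth_R2_R4 X -> smooth_R2_R4 Y ->
  smooth2 (fun s t => dot (X s t) (Y s t)).
Proof.
intros [? [? [? ?]]] [? [? [? ?]]]; unfold dot.
repeat apply smooth2_plus; apply smooth2_mult; assumption.
Qed.

(** * Surfaces with an orthogonal parametrization *)

Definition adapted_frame (f : R -> R -> R4) (v1 v2 : R -> R -> R)
    (E1 E2 N1 N2 : R -> R -> R4) : Prop :=
  forall s t,
    pd4 i1 f s t = scal4 (v1 s t) (E1 s t) /\
    pd4 i2 f s t = scal4 (v2 s t) (E2 s t) /\
    v1 s t <> 0 /\ v2 s t <> 0 /\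
    orthonormal (E1 s t) (E2 s t) (N1 s t) (N2 s t).

Lemma adapted_immersion f v1 v2 E1 E2 N1 N2 :
  adapted_frame f v1 v2 E1 E2 N1 N2 -> immersion f.
Proof.
intros H s t a b Hab.
destruct (H s t) as [D1 [D2 [n1 [n2 [[H11 [H22 _]] [H12 _]]]]]].
rewrite D1, D2 in Hab.
assert (Ha := f_equal (fun w => dot w (E1 s t)) Hab).
assert (Hb := f_equal (fun w => dot w (E2 s t)) Hab).
cbv beta in Ha, Hb.
rewrite dot_add_l, !dot_scal_l, H11, (dot_sym (E2 s t)), H12 in Ha.
rewrite dot_add_l, !dot_scal_l, H22, H12 in Hb.
replace (dot zero4 (E1 s t)) with 0 in Ha by (unfold dot; coords; ring).
replace (dot zero4 (E2 s t)) with 0 in Hb by (unfold dot; coords; ring).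
split; [apply (Rmult_eq_reg_r (v1 s t)) | apply (Rmult_eq_reg_r (v2 s t))];
  auto; lra.
Qed.

Lemma adapted_metric f v1 v2 E1 E2 N1 N2 :
  adapted_frame f v1 v2 E1 E2 N1 N2 ->
  metric f i1 i1 = (fun s t => v1 s t * v1 s t) /\
  metric f i1 i2 = (fun _ _ => 0) /\
  metric f i2 i1 = (fun _ _ => 0) /\
  metric f i2 i2 = (fun s t => v2 s t * v2 s t).
Proof.
intros H; repeat split; do 2 (apply functional_extensionality; intros ?);
  unfold metric;
  match goal with |- context [pd4 _ _ ?s ?t] =>
    destruct (H s t) as [D1 [D2 [_ [_ [[H11 [H22 _]] [H12 _]]]]]] end;
  rewrite ?D1, ?D2, dot_scal_l, dot_scal_r, ?H11, ?H22, ?(dot_sym (E2 _ _)), ?H12, ?H22;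
  ring.
Qed.

Lemma adapted_normal_part f v1 v2 E1 E2 N1 N2 s t w :
  adapted_frame f v1 v2 E1 E2 N1 N2 ->
  normal_part f s t w =
  add4 (scal4 (dot w (N1 s t)) (N1 s t)) (scal4 (dot w (N2 s t)) (N2 s t)).
Proof.
intros H; destruct (adapted_metric _ _ _ _ _ _ _ H) as [M11 [M12 [M21 M22]]].
destruct (H s t) as [D1 [D2 [n1 [n2 Ho]]]].
assert (Ht : tangent_part f s t w =
  add4 (scal4 (dot w (E1 s t)) (E1 s t)) (scal4 (dot w (E2 s t)) (E2 s t))).
{ unfold tangent_part, isum4, isum, metric_inv, metric_det.
  rewrite M11, M12, M22, D1, D2, !dot_scal_r.
  by_coords; field; auto. }
unfold normal_part; rewrite Ht.
rewrite (orthonormal_expansion _ _ _ _ w Ho) at 1.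
by_coords.
Qed.

(** A normal frame whose derivatives are tangent makes the normal connection act
by differentiating coefficients, so its curvature is the commutator of two
partial derivatives. *)
Lemma parallel_frame_connection f v1 v2 E1 E2 N1 N2 i m1 m2 :
  adapted_frame f v1 v2 E1 E2 N1 N2 ->
  smooth_R2_R4 N1 -> smooth_R2_R4 N2 ->
  (forall s t, dot (pd4 i N1 s t) (N1 s t) = 0 /\
     dot (pd4 i N1 s t) (N2 s t) = 0 /\ dot (pd4 i N2 s t) (N1 s t) = 0 /\
     dot (pd4 i N2 s t) (N2 s t) = 0) ->
  smooth2 m1 -> smooth2 m2 ->
  normal_connection f i (fun s t =>
    add4 (scal4 (m1 s t) (N1 s t)) (scal4 (m2 s t) (N2 s t))) =
  (fun s t => add4 (scal4 (pd i m1 s t) (N1 s t))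
                   (scal4 (pd i m2 s t) (N2 s t))).
Proof.
intros H HN1 HN2 HD Hm1 Hm2.
do 2 (apply functional_extensionality; intros ?).
match goal with |- _ = add4 (scal4 (pd _ _ ?s ?t) _) _ =>
  destruct (HD s t) as [D11 [D12 [D21 D22]]];
  destruct (H s t) as [_ [_ [_ [_ [[_ [_ [H33 H44]]] [_ [_ [_ [_ [_ H34]]]]]]]]]]
end.
unfold normal_connection.
rewrite (adapted_normal_part _ _ _ _ _ _ _ _ _ _ H).
rewrite (pd4_add i (fun s t => scal4 (m1 s t) (N1 s t))
  (fun s t => scal4 (m2 s t) (N2 s t))); try now apply smooth_scal.
rewrite !pd4_scal, !dot_add_l, !dot_scal_l, D11, D12, D21, D22; auto.
rewrite (dot_sym (N2 _ _) (N1 _ _)), H33, H44, H34; by_coords.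
Qed.

Lemma parallel_frame_flat_normal_bundle f v1 v2 E1 E2 N1 N2 :
  adapted_frame f v1 v2 E1 E2 N1 N2 ->
  smooth_R2_R4 N1 -> smooth_R2_R4 N2 ->
  (forall i s t, dot (pd4 i N1 s t) (N1 s t) = 0 /\
     dot (pd4 i N1 s t) (N2 s t) = 0 /\ dot (pd4 i N2 s t) (N1 s t) = 0 /\
     dot (pd4 i N2 s t) (N2 s t) = 0) ->
  flat_normal_bundle f.
Proof.
intros H HN1 HN2 HD xi [Hxi Hperp] i j s t.
set (n1 := fun s t => dot (xi s t) (N1 s t)).
set (n2 := fun s t => dot (xi s t) (N2 s t)).
assert (S1 : smooth2 n1) by now apply smooth_dot.
assert (S2 : smooth2 n2) by now apply smooth_dot.
assert (Exi : xi = fun s t =>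
  add4 (scal4 (n1 s t) (N1 s t)) (scal4 (n2 s t) (N2 s t))).
{ apply functional_extensionality; intros a.
  apply functional_extensionality; intros b.
  destruct (H a b) as [D1 [D2 [v1n [v2n Ho]]]].
  assert (P1 := Hperp i1 a b); assert (P2 := Hperp i2 a b).
  rewrite D1, dot_scal_r in P1; rewrite D2, dot_scal_r in P2.
  apply Rmult_integral in P1; destruct P1 as [P1|P1]; [easy|].
  apply Rmult_integral in P2; destruct P2 as [P2|P2]; [easy|].
  rewrite (orthonormal_expansion _ _ _ _ (xi a b) Ho), P1, P2 at 1.
  unfold n1, n2; by_coords. }
assert (C : forall k, normal_connection f k xi = fun s t =>
  add4 (scal4 (pd k n1 s t) (N1 s t)) (scal4 (pd k n2 s t) (N2 s t))).
{ intros k; rewrite Exi.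
  now apply (parallel_frame_connection f v1 v2 E1 E2). }
assert (CC : forall k l, normal_connection f k (normal_connection f l xi) s t =
  add4 (scal4 (pd k (pd l n1) s t) (N1 s t))
       (scal4 (pd k (pd l n2) s t) (N2 s t))).
{ intros k l; rewrite C.
  now rewrite (parallel_frame_connection f v1 v2 E1 E2 N1 N2 k _ _ H HN1 HN2
    (HD k) (smooth2_pd l _ S1) (smooth2_pd l _ S2)). }
unfold normal_curvature; rewrite !CC.
destruct i, j; rewrite ?(pd_commute n1 s t S1), ?(pd_commute n2 s t S2);
  by_coords.
Qed.

(** The Lame equations: for the metric [v1^2 ds^2 + v2^2 dt^2] with rotation
coefficients [h12], [h21], the only independent curvature component is a
multiple of [(h12)_t + (h21)_s]. *)
Lemma adapted_flat f v1 v2 E1 E2 N1 N2 h12 h21 :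
  adapted_frame f v1 v2 E1 E2 N1 N2 ->
  smooth2 v1 -> smooth2 v2 -> smooth2 h12 -> smooth2 h21 ->
  pd i2 v1 = (fun s t => h12 s t * v2 s t) ->
  pd i1 v2 = (fun s t => h21 s t * v1 s t) ->
  (forall s t, pd i2 h12 s t + pd i1 h21 s t = 0) ->
  flat_induced_metric f.
Proof.
intros H S1 S2 S12 S21 L1 L2 Hflat.
destruct (adapted_metric _ _ _ _ _ _ _ H) as [M11 [M12 [M21 M22]]].
assert (N1z : forall s t, v1 s t <> 0) by (intros s t; apply (H s t)).
assert (N2z : forall s t, v2 s t <> 0) by (intros s t; apply (H s t)).
assert (Z : forall i, pd i (fun _ _ => 0) = fun _ _ => 0).
{ intros i; apply functional_extensionality; intros x; apply functional_extensionality; intros x0.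
  destruct i; [exact (Derive_const 0 x) | exact (Derive_const 0 x0)]. }
assert (I1 := smooth2_inv v1 S1 N1z); assert (I2 := smooth2_inv v2 S2 N2z).
assert (G : forall k i j, christoffel f k i j = match k, i, j with
  | i1, i1, i1 => fun s t => pd i1 v1 s t * / v1 s t
  | i1, i2, i2 => fun s t => - (h21 s t * v2 s t * / v1 s t)
  | i1, _, _ => fun s t => h12 s t * v2 s t * / v1 s t
  | i2, i2, i2 => fun s t => pd i2 v2 s t * / v2 s t
  | i2, i1, i1 => fun s t => - (h12 s t * v1 s t * / v2 s t)
  | i2, _, _ => fun s t => h21 s t * v1 s t * / v2 s t
  end).
{ intros k i j.
  apply functional_extensionality; intros s.
  apply functional_extensionality; intros t.
  specialize (N1z s t); specialize (N2z s t).
  unfold christoffel, isum, metric_inv, metric_det.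
  destruct k, i, j; rewrite ?M11, ?M12, ?M21, ?M22, ?Z, ?pd_mult, ?L1, ?L2;
    auto; field; auto. }
assert (Sd : forall i v, smooth2 v -> smooth2 (pd i v))
  by (intros; now apply smooth2_pd).
assert (C1 : forall s t, pd i2 (pd i1 v1) s t =
  pd i1 h12 s t * v2 s t + h12 s t * (h21 s t * v1 s t)).
{ intros s t; rewrite <- (pd_commute v1 s t S1), L1, pd_mult, L2; auto. }
assert (C2 : forall s t, pd i1 (pd i2 v2) s t =
  pd i2 h21 s t * v1 s t + h21 s t * (h12 s t * v2 s t)).
{ intros s t; rewrite (pd_commute v2 s t S2), L2, pd_mult, L1; auto. }
intros l i j k s t.
specialize (Hflat s t); specialize (C1 s t); specialize (C2 s t).
assert (n1 := N1z s t); assert (n2 := N2z s t).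
assert (Hflat' : pd i1 h21 s t = - pd i2 h12 s t) by lra.
unfold riemann, isum; rewrite !G.
destruct i, j; try (destruct l, k; ring);
  destruct l, k; rewrite ?pd_opp, ?pd_mult, ?pd_inv by (auto using smooth2_mult);
  rewrite ?pd_mult, ?L1, ?L2, ?C1, ?C2 by (auto using smooth2_mult);
  rewrite ?Hflat'; field; auto.
Qed.

(** * Ribaucour transforms of products of plane curves *)

Lemma pd_dot i X Y s t : smooth_R2_R4 X -> smooth_R2_R4 Y ->
  pd i (fun a b => dot (X a b) (Y a b)) s t =
  dot (pd4 i X s t) (Y s t) + dot (X s t) (pd4 i Y s t).
Proof.
intros [? [? [? ?]]] [? [? [? ?]]]; unfold dot.
rewrite !pd_plus, !pd_mult; auto using smooth2_mult, smooth2_plus.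
unfold pd4, x1, x2, x3, x4; cbn [fst snd]; ring.
Qed.

Definition reflect (G v : R4) : R4 :=
  sub4 v (scal4 (2 * dot v G / dot G G) G).

Lemma reflect_dot G u v :
  dot G G <> 0 -> dot (reflect G u) (reflect G v) = dot u v.
Proof.
intros HG; unfold reflect.
assert (E : forall a b, dot (sub4 u (scal4 a G)) (sub4 v (scal4 b G)) =
  dot u v - b * dot u G - a * dot v G + a * b * dot G G)
  by (intros; unfold dot; coords; ring).
rewrite E; field; exact HG.
Qed.

(** When [phi = dot X G], this is [reflect G X] pointwise; the general form only
requires the differential of [phi] to be that of a height. *)
Definition deflect (X : R -> R -> R4) (phi : R -> R -> R) (G : R -> R -> R4)
    (s t : R) : R4 :=
  sub4 (X s t) (scal4 (2 * phi s t / dot (G s t) (G s t)) (G s t)).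

Lemma deflect_smooth X phi G :
  smooth_R2_R4 X -> smooth2 phi -> smooth_R2_R4 G ->
  (forall s t, dot (G s t) (G s t) <> 0) -> smooth_R2_R4 (deflect X phi G).
Proof.
intros [? [? [? ?]]] Hp HG HN.
assert (Hm : smooth2 (fun s t => 2 * phi s t / dot (G s t) (G s t))).
{ apply smooth2_mult; [apply smooth2_mult; [apply smooth2_const | easy]|].
  apply (smooth2_inv (fun s t => dot (G s t) (G s t))); [|easy].
  now apply smooth_dot. }
destruct (smooth_scal _ _ Hm HG) as [? [? [? ?]]].
repeat split; (apply smooth2_plus; [easy | now apply smooth2_opp]).
Qed.

(** A Ribaucour pair: [X] and [G] move in the same direction [T], and [phi]
changes like the height of [X] over the direction [G].  Then [deflect X phi G]
moves in the direction obtained from [T] by reflection in the hyperplane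
orthogonal to [G]. *)
Lemma deflect_pd i X phi G s t r d T :
  smooth_R2_R4 X -> smooth2 phi -> smooth_R2_R4 G ->
  (forall s t, dot (G s t) (G s t) <> 0) ->
  pd4 i X s t = scal4 r T -> pd4 i G s t = scal4 d T ->
  pd i phi s t = r * dot T (G s t) ->
  pd4 i (deflect X phi G) s t =
  scal4 (r - 2 * phi s t * d / dot (G s t) (G s t)) (reflect (G s t) T).
Proof.
intros HX Hp HG HN DX DG Dp.
set (m := fun s t => -2 * phi s t * / dot (G s t) (G s t)).
assert (SN : smooth2 (fun s t => dot (G s t) (G s t))) by now apply smooth_dot.
assert (SI := smooth2_inv _ SN HN).
assert (Sp : smooth2 (fun s t => -2 * phi s t))
  by (apply smooth2_mult; [apply smooth2_const | easy]).
assert (Sm : smooth2 m) by now apply smooth2_mult.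
replace (deflect X phi G) with
  (fun s t => add4 (X s t) (scal4 (m s t) (G s t))).
2:{ do 2 (apply functional_extensionality; intros ?).
    unfold deflect, m; by_coords; field; apply HN. }
rewrite (pd4_add i X (fun s t => scal4 (m s t) (G s t)));
  [|easy | now apply smooth_scal].
rewrite pd4_scal, DX, DG; auto.
assert (Dm : pd i m s t = -2 * (r * dot T (G s t)) * / dot (G s t) (G s t)
  + 2 * phi s t * (2 * d * dot T (G s t))
    * / dot (G s t) (G s t) * / dot (G s t) (G s t)).
{ unfold m; rewrite pd_mult, pd_inv, pd_mult; auto using smooth2_const.
  rewrite pd_dot, DG, Dp, (dot_sym (G s t) (scal4 d T)), dot_scal_l; auto.
  replace (pd i (fun _ _ => -2) s t) with 0
    by (destruct i; symmetry; exact (Derive_const _ _)).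
  ring. }
rewrite Dm; unfold m, reflect; by_coords; field; apply HN.
Qed.

(** One planar factor of a Ribaucour pair: a curve with its unit tangent, and a
field that varies in the tangent direction.  Speeds and rates are stored next to
the functions themselves, so that all derivatives below are explicit. *)
Record profile := Profile {
  cx : R -> R; cy : R -> R; height : R -> R;
  gx : R -> R; gy : R -> R; tx : R -> R; ty : R -> R;
  speed : R -> R; rate : R -> R; turn : R -> R }.

Definition tangential (p : profile) (s : R) : R :=
  gx p s * tx p s + gy p s * ty p s.
Definition normal (p : profile) (s : R) : R :=
  gy p s * tx p s - gx p s * ty p s.

Record profile_axioms (p : profile) : Prop := {
  cx_derive : forall s, is_derive (cx p) s (speed p s * tx p s);
  cy_derive : forall s, is_derive (cy p) s (speed p s * ty p s);
  height_derive : forall s,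
    is_derive (height p) s (speed p s * tangential p s);
  gx_derive : forall s, is_derive (gx p) s (rate p s * tx p s);
  gy_derive : forall s, is_derive (gy p) s (rate p s * ty p s);
  tx_derive : forall s, is_derive (tx p) s (- turn p s * ty p s);
  ty_derive : forall s, is_derive (ty p) s (turn p s * tx p s);
  unit_tangent : forall s, tx p s * tx p s + ty p s * ty p s = 1;
  field_nonzero : forall s, 0 < gx p s * gx p s + gy p s * gy p s;
  tx_smooth : smooth1 (tx p); ty_smooth : smooth1 (ty p);
  speed_smooth : smooth1 (speed p); rate_smooth : smooth1 (rate p) }.

Definition in_first (u v : R -> R) (s t : R) : R4 := (u s, v s, 0, 0).
Definition in_second (u v : R -> R) (s t : R) : R4 := (0, 0, u t, v t).

Definition product_map (p q : profile) (s t : R) : R4 :=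
  (cx p s, cy p s, cx q t, cy q t).
Definition field (p q : profile) (s t : R) : R4 :=
  (gx p s, gy p s, gx q t, gy q t).
Definition total_height (p q : profile) (s t : R) : R := height p s + height q t.

Definition ribaucour (p q : profile) : R -> R -> R4 :=
  deflect (product_map p q) (total_height p q) (field p q).

Definition frame1 (p q : profile) (s t : R) : R4 :=
  reflect (field p q s t) (in_first (tx p) (ty p) s t).
Definition frame2 (p q : profile) (s t : R) : R4 :=
  reflect (field p q s t) (in_second (tx q) (ty q) s t).
(** The reflected normals are written as deflections, so that [deflect_pd]
differentiates them as well. *)
Definition frame3 (p q : profile) : R -> R -> R4 :=
  deflect (in_first (fun s => - ty p s) (tx p)) (fun s _ => normal p s)
    (field p q).
Definition frame4 (p q : profile) : R -> R -> R4 :=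
  deflect (in_second (fun t => - ty q t) (tx q)) (fun _ t => normal q t)
    (field p q).

Definition norm2 (p q : profile) (s t : R) : R :=
  dot (field p q s t) (field p q s t).
Definition lame1 (p q : profile) (s t : R) : R :=
  speed p s - 2 * total_height p q s t * rate p s / norm2 p q s t.
Definition lame2 (p q : profile) (s t : R) : R :=
  speed q t - 2 * total_height p q s t * rate q t / norm2 p q s t.

Lemma pd_first i g g' : (forall s, is_derive g s (g' s)) ->
  pd i (fun s _ => g s) = match i with i1 => fun s _ => g' s
                                    | i2 => fun _ _ => 0 end.
Proof.
intros D; destruct i; apply functional_extensionality; intros s;
  apply functional_extensionality; intros t.
- now apply is_derive_unique.
- exact (Derive_const (g s) t).
Qed.

Lemma pd_second i g g' : (forall s, is_derive g s (g' s)) ->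
  pd i (fun _ t => g t) = match i with i1 => fun _ _ => 0
                                    | i2 => fun _ t => g' t end.
Proof.
intros D; destruct i; apply functional_extensionality; intros s;
  apply functional_extensionality; intros t.
- exact (Derive_const (g t) s).
- now apply is_derive_unique.
Qed.

Lemma is_derive_tangential p s : profile_axioms p ->
  is_derive (tangential p) s (rate p s + turn p s * normal p s).
Proof.
intros H; evar_last.
- apply (is_derive_plus (fun s => gx p s * tx p s) (fun s => gy p s * ty p s));
    apply Derive.is_derive_mult;
    [apply gx_derive | apply tx_derive | apply gy_derive | apply ty_derive];
    easy.
- unfold plus, normal; simpl.
  transitivity (rate p s * (tx p s * tx p s + ty p s * ty p s)
    + turn p s * (gy p s * tx p s - gx p s * ty p s)); [ring|].
  now rewrite (unit_tangent p H), Rmult_1_r.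
Qed.

Lemma is_derive_normal p s : profile_axioms p ->
  is_derive (normal p) s (- turn p s * tangential p s).
Proof.
intros H; evar_last.
- apply (is_derive_minus (fun s => gy p s * tx p s) (fun s => gx p s * ty p s));
    apply Derive.is_derive_mult;
    [apply gy_derive | apply tx_derive | apply gx_derive | apply ty_derive];
    easy.
- unfold minus, plus, opp, tangential; simpl; ring.
Qed.

Lemma profile_smooth p : profile_axioms p ->
  smooth1 (cx p) /\ smooth1 (cy p) /\ smooth1 (height p) /\ smooth1 (gx p) /\
  smooth1 (gy p) /\ smooth1 (tangential p) /\ smooth1 (normal p).
Proof.
intros H.
assert (Sgx : smooth1 (gx p)).
{ apply (smooth1_primitive _ (fun s => rate p s * tx p s));
    [apply gx_derive, H|].
  apply smooth1_mult; [apply rate_smooth, H | apply tx_smooth, H]. }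
assert (Sgy : smooth1 (gy p)).
{ apply (smooth1_primitive _ (fun s => rate p s * ty p s));
    [apply gy_derive, H|].
  apply smooth1_mult; [apply rate_smooth, H | apply ty_smooth, H]. }
assert (SA : smooth1 (tangential p)).
{ apply (smooth1_plus (fun s => gx p s * tx p s) (fun s => gy p s * ty p s));
    apply smooth1_mult; auto; [apply tx_smooth | apply ty_smooth]; easy. }
repeat split; auto.
- apply (smooth1_primitive _ (fun s => speed p s * tx p s));
    [apply cx_derive, H|].
  apply smooth1_mult; [apply speed_smooth, H | apply tx_smooth, H].
- apply (smooth1_primitive _ (fun s => speed p s * ty p s));
    [apply cy_derive, H|].
  apply smooth1_mult; [apply speed_smooth, H | apply ty_smooth, H].
- apply (smooth1_primitive _ (fun s => speed p s * tangential p s));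
    [apply height_derive, H|].
  apply smooth1_mult; [apply speed_smooth, H | easy].
- apply (smooth1_plus (fun s => gy p s * tx p s) (fun s => - (gx p s * ty p s)));
    [|apply smooth1_opp];
    apply smooth1_mult; auto; [apply tx_smooth | apply ty_smooth]; easy.
Qed.

Lemma norm2_pos p q s t :
  profile_axioms p -> profile_axioms q -> 0 < norm2 p q s t.
Proof.
intros Hp Hq; assert (H1 := field_nonzero p Hp s).
assert (H2 := field_nonzero q Hq t).
unfold norm2, dot, field, x1, x2, x3, x4; simpl; lra.
Qed.

Lemma field_neq0 p q : profile_axioms p -> profile_axioms q ->
  forall s t, dot (field p q s t) (field p q s t) <> 0.
Proof. intros Hp Hq s t; assert (H := norm2_pos p q s t Hp Hq); unfold norm2 in H; lra. Qed.

Lemma field_smooth p q :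
  profile_axioms p -> profile_axioms q -> smooth_R2_R4 (field p q).
Proof.
intros Hp Hq.
destruct (profile_smooth p Hp) as [_ [_ [_ [? [? _]]]]].
destruct (profile_smooth q Hq) as [_ [_ [_ [? [? _]]]]].
split; [|split; [|split]];
  [now apply (smooth2_first (gx p)) | now apply (smooth2_first (gy p)) |
   now apply (smooth2_second (gx q)) | now apply (smooth2_second (gy q))].
Qed.

Lemma in_first_smooth u v : smooth1 u -> smooth1 v ->
  smooth_R2_R4 (in_first u v).
Proof.
intros; split; [|split; [|split]];
  [now apply (smooth2_first u) | now apply (smooth2_first v) |
   apply (smooth2_const 0) | apply (smooth2_const 0)].
Qed.

Lemma in_second_smooth u v : smooth1 u -> smooth1 v ->
  smooth_R2_R4 (in_second u v).
Proof.
intros; split; [|split; [|split]];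
  [apply (smooth2_const 0) | apply (smooth2_const 0) |
   now apply (smooth2_second u) | now apply (smooth2_second v)].
Qed.

Lemma product_map_smooth p q :
  profile_axioms p -> profile_axioms q -> smooth_R2_R4 (product_map p q).
Proof.
intros Hp Hq.
destruct (profile_smooth p Hp) as [? [? _]].
destruct (profile_smooth q Hq) as [? [? _]].
split; [|split; [|split]];
  [now apply (smooth2_first (cx p)) | now apply (smooth2_first (cy p)) |
   now apply (smooth2_second (cx q)) | now apply (smooth2_second (cy q))].
Qed.

Lemma total_height_smooth p q :
  profile_axioms p -> profile_axioms q -> smooth2 (total_height p q).
Proof.
intros Hp Hq.
apply (smooth2_plus (fun s _ => height p s) (fun _ t => height q t));
  [apply smooth2_first | apply smooth2_second]; now apply profile_smooth.
Qed.

Lemma ribaucour_smooth p q :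
  profile_axioms p -> profile_axioms q -> smooth_R2_R4 (ribaucour p q).
Proof.
intros Hp Hq; apply deflect_smooth; auto using product_map_smooth,
  total_height_smooth, field_smooth, field_neq0.
Qed.

Lemma pd4_pair i a b c d a' b' c' d' s t :
  (forall s, is_derive a s (a' s)) -> (forall s, is_derive b s (b' s)) ->
  (forall s, is_derive c s (c' s)) -> (forall s, is_derive d s (d' s)) ->
  pd4 i (fun s t => (a s, b s, c t, d t)) s t =
  match i with i1 => in_first a' b' s t | i2 => in_second c' d' s t end.
Proof.
intros Da Db Dc Dd; unfold pd4.
change (pd i (fun u v => x1 (a u, b u, c v, d v))) with (pd i (fun u (_ : R) => a u)).
change (pd i (fun u v => x2 (a u, b u, c v, d v))) with (pd i (fun u (_ : R) => b u)).
change (pd i (fun u v => x3 (a u, b u, c v, d v))) with (pd i (fun (_ : R) v => c v)).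
change (pd i (fun u v => x4 (a u, b u, c v, d v))) with (pd i (fun (_ : R) v => d v)).
rewrite (pd_first i a a'), (pd_first i b b'), (pd_second i c c'),
  (pd_second i d d'); auto; now destruct i.
Qed.

Lemma pd4_in_first i u v u' v' s t :
  (forall s, is_derive u s (u' s)) -> (forall s, is_derive v s (v' s)) ->
  pd4 i (in_first u v) s t =
  match i with i1 => in_first u' v' s t | i2 => zero4 end.
Proof.
intros Du Dv.
assert (D0 : forall s, is_derive (fun _ : R => 0) s 0)
  by (intros; exact (is_derive_const 0 _)).
assert (E := pd4_pair i u v _ _ _ _ _ _ s t Du Dv D0 D0).
now destruct i.
Qed.

Lemma pd4_in_second i u v u' v' s t :
  (forall s, is_derive u s (u' s)) -> (forall s, is_derive v s (v' s)) ->
  pd4 i (in_second u v) s t =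
  match i with i1 => zero4 | i2 => in_second u' v' s t end.
Proof.
intros Du Dv.
assert (D0 : forall s, is_derive (fun _ : R => 0) s 0)
  by (intros; exact (is_derive_const 0 _)).
assert (E := pd4_pair i _ _ u v _ _ _ _ s t D0 D0 Du Dv).
now destruct i.
Qed.

Lemma scal4_in_first a u v s t :
  scal4 a (in_first u v s t) = in_first (fun s => a * u s) (fun s => a * v s) s t.
Proof. by_coords; unfold in_first, x1, x2, x3, x4; simpl; ring. Qed.

Lemma scal4_in_second a u v s t :
  scal4 a (in_second u v s t) =
  in_second (fun s => a * u s) (fun s => a * v s) s t.
Proof. by_coords; unfold in_second, x1, x2, x3, x4; simpl; ring. Qed.

Ltac dot_simpl :=
  unfold dot, in_first, in_second, field, tangential, normal, x1, x2, x3, x4;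
  simpl; ring.

Lemma pd4_field p q i s t : profile_axioms p -> profile_axioms q ->
  pd4 i (field p q) s t = match i with
  | i1 => scal4 (rate p s) (in_first (tx p) (ty p) s t)
  | i2 => scal4 (rate q t) (in_second (tx q) (ty q) s t) end.
Proof.
intros Hp Hq.
transitivity (match i with
  | i1 => in_first (fun s => rate p s * tx p s) (fun s => rate p s * ty p s) s t
  | i2 => in_second (fun s => rate q s * tx q s) (fun s => rate q s * ty q s) s t
  end).
- exact (pd4_pair i _ _ _ _ _ _ _ _ s t (gx_derive p Hp) (gy_derive p Hp)
    (gx_derive q Hq) (gy_derive q Hq)).
- now destruct i; rewrite ?scal4_in_first, ?scal4_in_second.
Qed.

Lemma pd4_product_map p q i s t : profile_axioms p -> profile_axioms q ->
  pd4 i (product_map p q) s t = match i with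
  | i1 => scal4 (speed p s) (in_first (tx p) (ty p) s t)
  | i2 => scal4 (speed q t) (in_second (tx q) (ty q) s t) end.
Proof.
intros Hp Hq.
transitivity (match i with
  | i1 => in_first (fun s => speed p s * tx p s) (fun s => speed p s * ty p s) s t
  | i2 => in_second (fun s => speed q s * tx q s) (fun s => speed q s * ty q s) s t
  end).
- exact (pd4_pair i _ _ _ _ _ _ _ _ s t (cx_derive p Hp) (cy_derive p Hp)
    (cx_derive q Hq) (cy_derive q Hq)).
- now destruct i; rewrite ?scal4_in_first, ?scal4_in_second.
Qed.

Lemma pd_total_height p q i s t : profile_axioms p -> profile_axioms q ->
  pd i (total_height p q) s t = match i with
  | i1 => speed p s * tangential p s
  | i2 => speed q t * tangential q t end.
Proof.
intros Hp Hq; unfold total_height.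
rewrite (pd_plus i (fun s _ => height p s) (fun _ t => height q t)).
- rewrite (pd_first i _ _ (height_derive p Hp)),
    (pd_second i _ _ (height_derive q Hq)); destruct i; ring.
- now apply smooth2_first, profile_smooth.
- now apply smooth2_second, profile_smooth.
Qed.

Lemma ribaucour_derive p q s t : profile_axioms p -> profile_axioms q ->
  pd4 i1 (ribaucour p q) s t = scal4 (lame1 p q s t) (frame1 p q s t) /\
  pd4 i2 (ribaucour p q) s t = scal4 (lame2 p q s t) (frame2 p q s t).
Proof.
intros Hp Hq.
split; apply deflect_pd; auto using product_map_smooth, total_height_smooth,
  field_smooth, field_neq0; rewrite ?pd4_product_map, ?pd4_field,
  ?pd_total_height; auto; dot_simpl.
Qed.

Lemma frame3_reflect p q s t :
  frame3 p q s t =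
  reflect (field p q s t) (in_first (fun s => - ty p s) (tx p) s t).
Proof.
unfold frame3, deflect, reflect; do 3 f_equal; f_equal; dot_simpl.
Qed.

Lemma frame4_reflect p q s t :
  frame4 p q s t =
  reflect (field p q s t) (in_second (fun t => - ty q t) (tx q) s t).
Proof.
unfold frame4, deflect, reflect; do 3 f_equal; f_equal; dot_simpl.
Qed.

Lemma frame_orthonormal p q s t : profile_axioms p -> profile_axioms q ->
  orthonormal (frame1 p q s t) (frame2 p q s t)
              (frame3 p q s t) (frame4 p q s t).
Proof.
intros Hp Hq; assert (Hn := field_neq0 p q Hp Hq s t).
assert (U1 := unit_tangent p Hp s); assert (U2 := unit_tangent q Hq t).
unfold orthonormal; rewrite frame3_reflect, frame4_reflect.
unfold frame1, frame2; rewrite !reflect_dot by easy.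
unfold dot, in_first, in_second, x1, x2, x3, x4; simpl.
repeat split; lra.
Qed.

Lemma normal_derive p q s t : profile_axioms p -> profile_axioms q ->
  forall i, exists a b,
    pd4 i (frame3 p q) s t =
      scal4 a (match i with i1 => frame1 p q s t | i2 => frame2 p q s t end) /\
    pd4 i (frame4 p q) s t =
      scal4 b (match i with i1 => frame1 p q s t | i2 => frame2 p q s t end).
Proof.
intros Hp Hq i.
assert (Sn : forall r, profile_axioms r -> smooth1 (normal r))
  by (intros r Hr; now apply profile_smooth).
assert (DN : forall r, profile_axioms r ->
  forall z, is_derive (fun s => - ty r s) z (- turn r z * tx r z)).
{ intros r Hr z; evar_last.
  - apply (is_derive_opp (ty r)), (ty_derive r Hr).
  - unfold opp; simpl; ring. }
assert (DN' : forall r, profile_axioms r ->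
  forall z, is_derive (tx r) z (- turn r z * ty r z))
  by (intros r Hr; now apply tx_derive).
assert (DG := pd4_field p q i s t Hp Hq).
assert (S3 : smooth_R2_R4 (in_first (fun s => - ty p s) (tx p))).
{ apply in_first_smooth; [apply smooth1_opp, ty_smooth | apply tx_smooth]; easy. }
assert (S4 : smooth_R2_R4 (in_second (fun s => - ty q s) (tx q))).
{ apply in_second_smooth; [apply smooth1_opp, ty_smooth | apply tx_smooth]; easy. }
assert (Z : forall v, zero4 = scal4 0 v) by (intros v; by_coords).
destruct i; eexists; eexists; split; apply deflect_pd;
  auto using field_smooth, field_neq0, smooth2_first, smooth2_second.
- rewrite scal4_in_first; exact (pd4_in_first i1 _ _ _ _ s t (DN p Hp) (DN' p Hp)).
- exact DG.
- transitivity (- turn p s * tangential p s); [|dot_simpl].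
  exact (f_equal (fun F => F s t)
    (pd_first i1 _ _ (fun s => is_derive_normal p s Hp))).
- transitivity zero4; [exact (pd4_in_second i1 _ _ _ _ s t (DN q Hq) (DN' q Hq)) | apply Z].
- exact DG.
- rewrite Rmult_0_l.
  exact (f_equal (fun F => F s t)
    (pd_second i1 _ _ (fun s => is_derive_normal q s Hq))).
- transitivity zero4; [exact (pd4_in_first i2 _ _ _ _ s t (DN p Hp) (DN' p Hp)) | apply Z].
- exact DG.
- rewrite Rmult_0_l.
  exact (f_equal (fun F => F s t)
    (pd_first i2 _ _ (fun s => is_derive_normal p s Hp))).
- rewrite scal4_in_second; exact (pd4_in_second i2 _ _ _ _ s t (DN q Hq) (DN' q Hq)).
- exact DG.
- transitivity (- turn q t * tangential q t); [|dot_simpl].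
  exact (f_equal (fun F => F s t)
    (pd_second i2 _ _ (fun s => is_derive_normal q s Hq))).
Qed.

Lemma ribaucour_adapted p q : profile_axioms p -> profile_axioms q ->
  (forall s t, lame1 p q s t <> 0) -> (forall s t, lame2 p q s t <> 0) ->
  adapted_frame (ribaucour p q) (lame1 p q) (lame2 p q)
    (frame1 p q) (frame2 p q) (frame3 p q) (frame4 p q).
Proof.
intros Hp Hq H1 H2 s t.
destruct (ribaucour_derive p q s t Hp Hq).
assert (Ho := frame_orthonormal p q s t Hp Hq); auto.
Qed.

Lemma ribaucour_flat_normal_bundle p q : profile_axioms p -> profile_axioms q ->
  (forall s t, lame1 p q s t <> 0) -> (forall s t, lame2 p q s t <> 0) ->
  flat_normal_bundle (ribaucour p q).
Proof.
intros Hp Hq H1 H2.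
apply (parallel_frame_flat_normal_bundle _ _ _ _ _ _ _
  (ribaucour_adapted p q Hp Hq H1 H2)).
- apply deflect_smooth; auto using field_smooth, field_neq0.
  + apply in_first_smooth; [apply smooth1_opp, ty_smooth | apply tx_smooth]; easy.
  + now apply smooth2_first, profile_smooth.
- apply deflect_smooth; auto using field_smooth, field_neq0.
  + apply in_second_smooth; [apply smooth1_opp, ty_smooth | apply tx_smooth]; easy.
  + now apply smooth2_second, profile_smooth.
- intros i s t; destruct (normal_derive p q s t Hp Hq i) as [a [b [-> ->]]].
  destruct (frame_orthonormal p q s t Hp Hq)
    as [_ [_ [H13 [H14 [H23 [H24 _]]]]]].
  rewrite !dot_scal_l; destruct i; rewrite ?H13, ?H14, ?H23, ?H24;
    repeat split; ring.
Qed.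

Lemma pd_norm2 p q i s t : profile_axioms p -> profile_axioms q ->
  pd i (norm2 p q) s t = match i with
    | i1 => 2 * rate p s * tangential p s
    | i2 => 2 * rate q t * tangential q t end.
Proof.
intros Hp Hq; unfold norm2.
rewrite pd_dot by now apply field_smooth.
rewrite pd4_field by easy.
destruct i; rewrite dot_scal_l, dot_scal_r; dot_simpl.
Qed.

(** The flatness equation in terms of the two profiles; the rotation
coefficients of the transform are [-2 rate1 tangential2 / norm2] and
[-2 rate2 tangential1 / norm2]. *)
Lemma ribaucour_flat p q : profile_axioms p -> profile_axioms q ->
  (forall s t, lame1 p q s t <> 0) -> (forall s t, lame2 p q s t <> 0) ->
  (forall s t, norm2 p q s t *
     (rate p s * (rate q t + turn q t * normal q t) +
      rate q t * (rate p s + turn p s * normal p s)) =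
     2 * rate p s * rate q t * (tangential p s ^ 2 + tangential q t ^ 2)) ->
  flat_induced_metric (ribaucour p q).
Proof.
intros Hp Hq H1 H2 Heq.
set (h12 := fun s t => (-2 * rate p s) * tangential q t * / norm2 p q s t).
set (h21 := fun s t => (-2 * rate q t) * tangential p s * / norm2 p q s t).
assert (Nn : forall s t, norm2 p q s t <> 0)
  by (intros s t; assert (H := norm2_pos p q s t Hp Hq); lra).
assert (SN : smooth2 (norm2 p q)) by (apply smooth_dot; now apply field_smooth).
assert (SI := smooth2_inv _ SN Nn).
assert (SH := total_height_smooth p q Hp Hq).
assert (Sc := smooth2_const).
assert (S1 : smooth2 (fun s _ => speed p s))
  by now apply smooth2_first, speed_smooth.
assert (S2 : smooth2 (fun _ t => speed q t))
  by now apply smooth2_second, speed_smooth.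
assert (R1 : smooth2 (fun s _ => rate p s)) by now apply smooth2_first, rate_smooth.
assert (R2 : smooth2 (fun _ t => rate q t)) by now apply smooth2_second, rate_smooth.
assert (A1 : smooth2 (fun s _ => tangential p s))
  by now apply smooth2_first, profile_smooth.
assert (A2 : smooth2 (fun _ t => tangential q t))
  by now apply smooth2_second, profile_smooth.
assert (T1 : smooth2 (fun s t => 2 * total_height p q s t))
  by now apply smooth2_mult.
assert (T2 : smooth2 (fun s t => 2 * total_height p q s t * rate p s))
  by now apply smooth2_mult.
assert (T3 : smooth2 (fun s t => 2 * total_height p q s t * rate q t))
  by now apply smooth2_mult.
assert (T4 : smooth2 (fun s t => 2 * total_height p q s t * rate p s * / norm2 p q s t))
  by now apply smooth2_mult.
assert (T5 : smooth2 (fun s t => 2 * total_height p q s t * rate q t * / norm2 p q s t))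
  by now apply smooth2_mult.
assert (T6 : smooth2 (fun s _ => -2 * rate p s)) by now apply smooth2_mult.
assert (T7 : smooth2 (fun _ t => -2 * rate q t)) by now apply smooth2_mult.
assert (T8 : smooth2 (fun s t => -2 * rate p s * tangential q t))
  by now apply smooth2_mult.
assert (T9 : smooth2 (fun s t => -2 * rate q t * tangential p s))
  by now apply smooth2_mult.
assert (Z : forall i c s t, pd i (fun _ _ => c) s t = 0).
{ intros i c s t; destruct i; [exact (Derive_const c s) | exact (Derive_const c t)]. }
destruct (smooth1_derive _ (rate_smooth p Hp)) as [r1 [D1 _]].
destruct (smooth1_derive _ (rate_smooth q Hq)) as [r2 [D2 _]].
destruct (smooth1_derive _ (speed_smooth p Hp)) as [w1 [E1 _]].
destruct (smooth1_derive _ (speed_smooth q Hq)) as [w2 [E2 _]].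
apply (adapted_flat _ _ _ _ _ _ _ h12 h21 (ribaucour_adapted p q Hp Hq H1 H2)).
- apply (smooth2_plus (fun s _ => speed p s)); [easy | now apply smooth2_opp].
- apply (smooth2_plus (fun _ t => speed q t)); [easy | now apply smooth2_opp].
- now apply smooth2_mult.
- now apply smooth2_mult.
- apply functional_extensionality; intros s.
  apply functional_extensionality; intros t.
  unfold lame1, Rminus, Rdiv; rewrite pd_plus, pd_opp, !pd_mult, pd_inv;
    auto using smooth2_opp.
  rewrite Z, pd_total_height, pd_norm2, (pd_first i2 _ _ D1), (pd_first i2 _ _ E1); auto.
  unfold h12, lame2; field; apply Nn.
- apply functional_extensionality; intros s.
  apply functional_extensionality; intros t.
  unfold lame2, Rminus, Rdiv; rewrite pd_plus, pd_opp, !pd_mult, pd_inv;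
    auto using smooth2_opp.
  rewrite Z, pd_total_height, pd_norm2, (pd_second i1 _ _ D2), (pd_second i1 _ _ E2); auto.
  unfold h21, lame1; field; apply Nn.
- intros s t; unfold h12, h21; rewrite !pd_mult, !pd_inv; auto.
  rewrite !Z, !pd_norm2, (pd_first i2 _ _ D1), (pd_second i1 _ _ D2),
    (pd_second i2 _ _ (fun s => is_derive_tangential q s Hq)),
    (pd_first i1 _ _ (fun s => is_derive_tangential p s Hp)); auto.
  specialize (Heq s t); specialize (Nn s t).
  apply (Rmult_eq_reg_r (norm2 p q s t * norm2 p q s t));
    [|now apply Rmult_integral_contrapositive].
  rewrite Rmult_0_l.
  transitivity (-2 * (norm2 p q s t *
     (rate p s * (rate q t + turn q t * normal q t) +
      rate q t * (rate p s + turn p s * normal p s)) -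
     2 * rate p s * rate q t * (tangential p s ^ 2 + tangential q t ^ 2)));
    [field; easy | rewrite Heq; ring].
Qed.

(** * Surfaces in a sphere *)

Lemma frame1_deflect p q :
  frame1 p q = deflect (in_first (tx p) (ty p)) (fun s _ => tangential p s)
                 (field p q).
Proof.
do 2 (apply functional_extensionality; intros ?).
unfold frame1, deflect, reflect; do 3 f_equal; f_equal; dot_simpl.
Qed.

(** Where the first profile neither turns nor changes its field, the first
coordinate curve has no normal curvature, whereas in a sphere every curve has
normal curvature at least the inverse of the radius. *)
Lemma ribaucour_not_in_sphere p q s0 :
  profile_axioms p -> profile_axioms q ->
  (forall s t, lame1 p q s t <> 0) ->
  rate p s0 = 0 -> turn p s0 = 0 -> ~ in_affine_3sphere (ribaucour p q).
Proof.
intros Hp Hq H1 Hr Ht [a [rho [_ Hs]]].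
set (X := fun s t => add4 (ribaucour p q s t) (scal4 (-1) a)).
assert (SC : smooth_R2_R4 (fun _ _ => scal4 (-1) a)) by (repeat split; apply smooth2_const).
assert (SR := ribaucour_smooth p q Hp Hq).
assert (SX : smooth_R2_R4 X).
{ destruct SR as [? [? [? ?]]], SC as [? [? [? ?]]]; repeat split;
    apply smooth2_plus; assumption. }
assert (DX : forall s t, pd4 i1 X s t = scal4 (lame1 p q s t) (frame1 p q s t)).
{ intros s t; unfold X.
  rewrite (pd4_add i1 (ribaucour p q) (fun _ _ => scal4 (-1) a)) by easy.
  rewrite (proj1 (ribaucour_derive p q s t Hp Hq)).
  transitivity (add4 (scal4 (lame1 p q s t) (frame1 p q s t)) zero4); [|by_coords].
  f_equal; apply R4_ext; exact (Derive_const _ s). }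
assert (HX : (fun s t => dot (X s t) (X s t)) = fun _ _ => rho * rho).
{ apply functional_extensionality; intros s.
  apply functional_extensionality; intros t.
  rewrite <- (Hs (ribaucour p q s t)) by now exists s, t.
  unfold enorm; rewrite sqrt_sqrt; [unfold X, dot; coords; ring|].
  unfold dot; nra. }
assert (HE : (fun s t => dot (X s t) (frame1 p q s t)) = fun _ _ => 0).
{ apply functional_extensionality; intros s.
  apply functional_extensionality; intros t.
  assert (E := pd_dot i1 X X s t SX SX); rewrite HX, DX in E.
  rewrite dot_scal_r, dot_scal_l, (dot_sym (frame1 p q s t)) in E.
  assert (Z : pd i1 (fun _ _ => rho * rho) s t = 0) by exact (Derive_const _ s).
  rewrite Z in E; apply (Rmult_eq_reg_l (lame1 p q s t)); [lra | apply H1]. }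
assert (SF : smooth_R2_R4 (frame1 p q)).
{ rewrite frame1_deflect; apply deflect_smooth;
    auto using field_smooth, field_neq0.
  - apply in_first_smooth; [apply tx_smooth | apply ty_smooth]; easy.
  - now apply smooth2_first, profile_smooth. }
assert (DF : pd4 i1 (frame1 p q) s0 0 = zero4).
{ rewrite frame1_deflect.
  rewrite (deflect_pd i1 _ _ _ s0 0 0 0 (in_first (tx p) (ty p) s0 0));
    auto using field_smooth, field_neq0.
  - by_coords; unfold Rdiv; ring.
  - apply in_first_smooth; [apply tx_smooth | apply ty_smooth]; easy.
  - now apply smooth2_first, profile_smooth.
  - rewrite (pd4_in_first i1 _ _ _ _ s0 0 (tx_derive p Hp) (ty_derive p Hp)).
    rewrite scal4_in_first; unfold in_first; rewrite Ht.
    apply R4_ext; unfold x1, x2, x3, x4; simpl; ring.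
  - now rewrite pd4_field, Hr by easy.
  - rewrite (pd_first i1 _ _ (fun s => is_derive_tangential p s Hp)), Hr, Ht.
    ring. }
assert (E := pd_dot i1 X _ s0 0 SX SF); rewrite HE, DX, DF, dot_scal_l in E.
destruct (frame_orthonormal p q s0 0 Hp Hq) as [[E11 _] _]; rewrite E11 in E.
apply (H1 s0 0).
assert (Z : pd i1 (fun _ _ => 0) s0 0 = 0) by exact (Derive_const _ s0).
rewrite Z in E; rewrite <- (Rmult_1_r (lame1 p q s0 0)).
transitivity (lame1 p q s0 0 * 1 + dot (X s0 0) zero4);
  [unfold dot; coords; ring | easy].
Qed.

(** * Tangent planes of products of curves *)

Lemma smooth2_differentiable h s t : smooth2 h ->
  differentiable_pt_lim h s t (pd i1 h s t) (pd i2 h s t).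
Proof.
intros Hh; apply filterdiff_differentiable_pt_lim.
apply (is_derive_filterdiff h s t (pd i1 h)).
- apply filter_forall; intros [u v]; apply (smooth2_partials h Hh u v).
- apply (smooth2_partials h Hh s t).
- apply continuity_2d_pt_filterlim, (smooth2_pd i1 h Hh 0%nat s t).
Qed.

Lemma smooth2_line_derive h s t l : smooth2 h ->
  is_derive (fun z => h (s + z) (t + l * z)) 0
    (pd i1 h s t + l * pd i2 h s t).
Proof.
intros Hh; apply is_derive_Reals.
replace (pd i1 h s t + l * pd i2 h s t)
  with (pd i1 h s t * 1 + pd i2 h s t * l) by ring.
apply (derivable_pt_lim_comp_2d h (fun z => s + z) (fun z => t + l * z)).
- rewrite Rmult_0_r, !Rplus_0_r; now apply smooth2_differentiable.
- apply is_derive_Reals; auto_derive; auto; ring.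
- apply is_derive_Reals; auto_derive; auto; ring.
Qed.

Lemma derive_bound (f : R -> R) x l eps : is_derive f x l -> 0 < eps ->
  exists d, 0 < d /\ forall y, Rabs (y - x) < d ->
    Rabs (f y - f x - l * (y - x)) <= eps * Rabs (y - x).
Proof.
intros D He; apply is_derive_Reals in D.
destruct (D eps He) as [[d Hd] H]; exists d; split; [easy|]; intros y Hy.
destruct (Req_dec (y - x) 0) as [E|E].
- replace y with x by lra.
  replace (f x - f x - l * (x - x)) with 0 by ring.
  rewrite Rabs_R0; apply Rmult_le_pos; [lra | apply Rabs_pos].
- specialize (H (y - x) E Hy).
  replace (x + (y - x)) with y in H by ring.
  replace (f y - f x - l * (y - x)) with
    (((f y - f x) / (y - x) - l) * (y - x)) by (field; easy).
  rewrite Rabs_mult; apply Rmult_le_compat_r; [apply Rabs_pos | lra].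
Qed.

Lemma bounded_sequence_adherent (u : nat -> R) a b :
  (forall n, a <= u n <= b) ->
  exists l, forall d N, 0 < d -> exists n, (N <= n)%nat /\ Rabs (u n - l) < d.
Proof.
intros Hu.
destruct (Bolzano_Weierstrass u (fun c => a <= c <= b) (compact_P3 a b) Hu)
  as [l Hl].
exists l; intros d N Hd.
destruct (Hl (fun y => Rabs (y - l) < d) N) as [n [Hn Hn']].
- exists (mkposreal d Hd); intros y Hy; exact Hy.
- now exists n.
Qed.

Lemma periodic_representative (a b : R -> R) T u : 0 < T ->
  (forall t, a (t + T) = a t /\ b (t + T) = b t) ->
  exists v, 0 <= v <= T /\ a v = a u /\ b v = b u.
Proof.
intros HT Hp.
assert (Hn : forall n t, a (t + INR n * T) = a t /\ b (t + INR n * T) = b t).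
{ induction n as [|n IHn]; intros t.
  - now rewrite Rmult_0_l, Rplus_0_r.
  - rewrite S_INR; replace (t + (INR n + 1) * T) with (t + INR n * T + T) by ring.
    destruct (Hp (t + INR n * T)) as [-> ->]; apply IHn. }
destruct (base_Int_part (u / T)) as [H1 H2].
set (k := Int_part (u / T)) in *.
assert (Eu : u / T * T = u) by (field; lra).
exists (u - IZR k * T); split; [nra|].
destruct (Z.le_gt_cases 0 k) as [Hk|Hk].
- destruct (Hn (Z.to_nat k) (u - IZR k * T)) as [Ea Eb].
  rewrite INR_IZR_INZ, Z2Nat.id in Ea, Eb by easy.
  replace (u - IZR k * T + IZR k * T) with u in Ea, Eb by ring; now split.
- destruct (Hn (Z.to_nat (- k)) u) as [Ea Eb].
  rewrite INR_IZR_INZ, Z2Nat.id, opp_IZR in Ea, Eb by lia.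
  replace (u + - IZR k * T) with (u - IZR k * T) in Ea, Eb by ring; now split.
Qed.

(** Parameters of nearby points of the drawn curve accumulate at some [u].  As the
closed curve is regular there, the increments of these parameters are bounded by
the increments of the drawn curve, and so both curves have the same direction. *)
Lemma curve_on_curve_tangent (a b p q : R -> R) w1 w2 T :
  (forall t, ex_derive a t /\ ex_derive b t) ->
  (forall t, ~ (Derive a t = 0 /\ Derive b t = 0)) ->
  0 < T -> (forall t, a (t + T) = a t /\ b (t + T) = b t) ->
  is_derive p 0 w1 -> is_derive q 0 w2 ->
  (forall h, exists u, p h = a u /\ q h = b u) ->
  exists u, 0 <= u <= T /\ a u = p 0 /\ b u = q 0 /\
    Derive a u * w2 - Derive b u * w1 = 0.
Proof.
intros Dab Reg HT Per Dp Dq Hon.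
assert (Hu : forall n, exists u, 0 <= u <= T /\
  a u = p (/ INR (S n)) /\ b u = q (/ INR (S n))).
{ intros n; destruct (Hon (/ INR (S n))) as [u0 [E1 E2]].
  destruct (periodic_representative a b T u0 HT Per) as [u [Hu [E3 E4]]].
  exists u; rewrite E1, E2; auto. }
apply functional_choice in Hu; destruct Hu as [u Hu].
destruct (bounded_sequence_adherent u 0 T (fun n => proj1 (Hu n))) as [l Hl].
assert (Hh : forall d, 0 < d ->
  exists N, forall n, (N <= n)%nat -> 0 < / INR (S n) < d).
{ intros d Hd; destruct (archimed_cor1 d Hd) as [N [HN HN']].
  exists N; intros n Hn.
  assert (0 < INR N) by (apply lt_0_INR; lia).
  assert (INR N <= INR (S n)) by (apply le_INR; lia).
  split; [apply Rinv_0_lt_compat; lra|].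
  apply Rle_lt_trans with (/ INR N); [apply Rinv_le_contravar|]; lra. }
assert (Lip : forall (f : R -> R) (w d0 : R), is_derive f 0 w -> 0 < d0 ->
  exists N, forall n, (N <= n)%nat ->
    Rabs (f (/ INR (S n)) - f 0 - w * / INR (S n)) <= d0 * / INR (S n)).
{ intros f w d0 Df Hd0; destruct (derive_bound f 0 w d0 Df Hd0) as [d [Hd Hb]].
  destruct (Hh d Hd) as [N HN]; exists N; intros n Hn.
  specialize (HN n Hn); specialize (Hb (/ INR (S n))).
  rewrite Rminus_0_r, Rabs_pos_eq in Hb by lra; now apply Hb. }
assert (Lim : forall f g : R -> R, (forall t, ex_derive g t) ->
  (forall n, g (u n) = f (/ INR (S n))) -> ex_derive f 0 -> g l = f 0).
{ intros f g Dg Eg [w Df].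
  apply Rminus_diag_uniq; apply Rabs_eq_0.
  apply Rle_antisym; [|apply Rabs_pos].
  apply le_epsilon; intros eps He; rewrite Rplus_0_l.
  destruct (derive_bound g l _ 1 (Derive_correct g l (Dg l)) Rlt_0_1)
    as [d [Hd Hb]].
  set (K := Rabs (Derive g l) + 1) in *.
  assert (HK : 1 <= K) by (unfold K; assert (H := Rabs_pos (Derive g l)); lra).
  destruct (Lip f w 1 Df Rlt_0_1) as [N1 HN1].
  set (K' := Rabs w + 1) in *.
  assert (HK' : 1 <= K') by (unfold K'; assert (H := Rabs_pos w); lra).
  destruct (Hh (eps / 2 / K')) as [N2 HN2]; [apply Rdiv_lt_0_compat; lra|].
  destruct (Hl (Rmin d (eps / 2 / K)) (N1 + N2)%nat) as [n [Hn Hln]].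
  { apply Rmin_pos; [easy | apply Rdiv_lt_0_compat; lra]. }
  assert (Hd1 := Rmin_l d (eps / 2 / K)); assert (Hd2 := Rmin_r d (eps / 2 / K)).
  specialize (Hb (u n) ltac:(lra)); specialize (HN1 n ltac:(lia)).
  specialize (HN2 n ltac:(lia)).
  set (h := / INR (S n)) in *.
  assert (B1 : Rabs (g (u n) - g l) <= K * Rabs (u n - l)).
  { replace (g (u n) - g l) with
      ((g (u n) - g l - Derive g l * (u n - l)) + Derive g l * (u n - l)) by ring.
    eapply Rle_trans; [apply Rabs_triang|]; rewrite Rabs_mult; unfold K; lra. }
  assert (B2 : Rabs (f h - f 0) <= K' * h).
  { replace (f h - f 0) with ((f h - f 0 - w * h) + w * h) by ring.
    eapply Rle_trans; [apply Rabs_triang|].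
    rewrite Rabs_mult, (Rabs_pos_eq h) by lra; unfold K'; lra. }
  replace (g l - f 0) with (- (g (u n) - g l) + (f h - f 0))
    by (rewrite Eg; fold h; ring).
  eapply Rle_trans; [apply Rabs_triang|]; rewrite Rabs_Ropp.
  assert (K * Rabs (u n - l) <= eps / 2).
  { replace (eps / 2) with (K * (eps / 2 / K)) by (field; lra).
    apply Rmult_le_compat_l; lra. }
  assert (K' * h <= eps / 2).
  { replace (eps / 2) with (K' * (eps / 2 / K')) by (field; lra).
    apply Rmult_le_compat_l; lra. }
  lra. }
assert (Ea : a l = p 0).
{ apply Lim; [apply Dab | apply Hu | now exists w1]. }
assert (Eb : b l = q 0).
{ apply Lim; [apply Dab | apply Hu | now exists w2]. }
set (A := Derive a l); set (B := Derive b l).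
assert (Hc : A * w2 - B * w1 = 0).
{ destruct (Req_dec (A * w2 - B * w1) 0) as [E|E]; [easy|exfalso].
  set (c := A * w2 - B * w1) in *.
  assert (HM : 0 < A * A + B * B).
  { assert (H := Reg l); fold A B in H.
    destruct (Req_dec A 0) as [EA|EA]; [|nra].
    destruct (Req_dec B 0) as [EB|EB]; [|nra].
    exfalso; auto. }
  set (M := A * A + B * B) in *.
  assert (Hcp : 0 < Rabs c) by now apply Rabs_pos_lt.
  set (g := A * w1 + B * w2).
  set (K := Rabs g + 1).
  assert (HK : 1 <= K) by (unfold K; assert (H := Rabs_pos g); lra).
  set (eta := Rabs c * M / (8 * K)).
  assert (Heta : 0 < eta)
    by (apply Rdiv_lt_0_compat; [apply Rmult_lt_0_compat | lra]; lra).
  assert (DF : is_derive (fun u => A * b u - B * a u) l 0).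
  { evar_last.
    - apply (is_derive_minus (fun u => A * b u) (fun u => B * a u));
        apply is_derive_scal, Derive_correct, Dab.
    - unfold minus, plus, opp; simpl; unfold A, B; ring. }
  assert (DG : is_derive (fun u => A * a u + B * b u) l M).
  { apply (is_derive_plus (fun u => A * a u) (fun u => B * b u));
        apply is_derive_scal, Derive_correct, Dab. }
  assert (Df : is_derive (fun h => A * q h - B * p h) 0 c).
  { apply (is_derive_minus (fun u => A * q u) (fun u => B * p u));
        now apply is_derive_scal. }
  assert (Dg : is_derive (fun h => A * p h + B * q h) 0 g).
  { apply (is_derive_plus (fun u => A * p u) (fun u => B * q u));
        now apply is_derive_scal. }
  destruct (derive_bound _ _ _ eta DF Heta) as [d1 [Hd1 B1]].
  destruct (derive_bound _ _ _ (M / 2) DG ltac:(lra)) as [d2 [Hd2 B2]].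
  destruct (Lip _ _ (Rabs c / 2) Df ltac:(lra)) as [N1 B3].
  destruct (Lip _ _ 1 Dg Rlt_0_1) as [N2 B4].
  destruct (Hh 1 Rlt_0_1) as [N3 B5].
  destruct (Hl (Rmin d1 d2) (N1 + N2 + N3)%nat) as [n [Hn Hln]];
    [now apply Rmin_pos|].
  assert (Hm1 := Rmin_l d1 d2); assert (Hm2 := Rmin_r d1 d2).
  specialize (B1 (u n) ltac:(lra)); specialize (B2 (u n) ltac:(lra)).
  specialize (B3 n ltac:(lia)); specialize (B4 n ltac:(lia)).
  specialize (B5 n ltac:(lia)).
  destruct (Hu n) as [_ [Ean Ebn]]; cbv beta in B1, B2, B3, B4.
  rewrite Ean, Ebn, Ea, Eb in B1, B2.
  set (h := / INR (S n)) in *; set (x := Rabs (u n - l)) in *.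
  set (F := A * q h - B * p h - (A * q 0 - B * p 0)) in *.
  set (G := A * p h + B * q h - (A * p 0 + B * q 0)) in *.
  rewrite Rmult_0_l, Rminus_0_r in B1.
  (* [x] is at most of order [h], while [F] is of order [h] and at most [eta * x]. *)
  assert (X : M / 2 * x <= K * h).
  { assert (T1 : Rabs (M * (u n - l)) <= Rabs G + M / 2 * x).
    { replace (M * (u n - l)) with (G + - (G - M * (u n - l))) by ring.
      eapply Rle_trans; [apply Rabs_triang|]; rewrite Rabs_Ropp; lra. }
    rewrite Rabs_mult, (Rabs_pos_eq M) in T1 by lra; fold x in T1.
    assert (T2 : Rabs G <= K * h).
    { replace G with ((G - g * h) + g * h) by ring.
      eapply Rle_trans; [apply Rabs_triang|].
      rewrite Rabs_mult, (Rabs_pos_eq h) by lra; unfold K; lra. }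
    lra. }
  assert (Y : Rabs c / 2 * h <= Rabs F).
  { assert (T1 : Rabs (c * h) <= Rabs F + Rabs c / 2 * h).
    { replace (c * h) with (F + - (F - c * h)) by ring.
      eapply Rle_trans; [apply Rabs_triang|]; rewrite Rabs_Ropp; lra. }
    rewrite Rabs_mult, (Rabs_pos_eq h) in T1 by lra; lra. }
  assert (Z : eta * x <= Rabs c / 4 * h).
  { replace (eta * x) with (Rabs c / (4 * K) * (M / 2 * x))
      by (unfold eta; field; lra).
    replace (Rabs c / 4 * h) with (Rabs c / (4 * K) * (K * h)) by (field; lra).
    apply Rmult_le_compat_l; [|easy].
    apply Rlt_le, Rdiv_lt_0_compat; lra. }
  assert (0 < Rabs c * h) by (apply Rmult_lt_0_compat; lra).
  lra. }
exists l; repeat split; auto.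
- apply Rnot_lt_le; intros Hneg.
  destruct (Hl (- l) 0%nat ltac:(lra)) as [n [_ Hn]].
  apply Rabs_def2 in Hn; assert (H := proj1 (Hu n)); lra.
- apply Rnot_lt_le; intros Hneg.
  destruct (Hl (l - T) 0%nat ltac:(lra)) as [n [_ Hn]].
  apply Rabs_def2 in Hn; assert (H := proj1 (Hu n)); lra.
Qed.

(** A regular closed curve passes only finitely often through a given point, so
its image contains curves with finitely many tangent directions there; a map of
rank two would produce infinitely many. *)
Lemma map_into_curve_rank (a b : R -> R) (P Q : R -> R -> R) s t :
  regular_closed_curve a b -> smooth2 P -> smooth2 Q ->
  (forall x y, exists u, P x y = a u /\ Q x y = b u) ->
  pd i1 P s t * pd i2 Q s t - pd i2 P s t * pd i1 Q s t = 0.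
Proof.
intros [Sm [Reg [T [HT Per]]]] SP SQ Hon.
set (J := pd i1 P s t * pd i2 Q s t - pd i2 P s t * pd i1 Q s t).
destruct (Req_dec J 0) as [E|HJ]; [easy|exfalso].
assert (Dab : forall t, ex_derive a t /\ ex_derive b t)
  by (intros z; exact (Sm 1%nat z)).
assert (Hv : forall n, exists v, 0 <= v <= T /\ a v = P s t /\ b v = Q s t /\
  Derive a v * (pd i1 Q s t + INR n * pd i2 Q s t) -
  Derive b v * (pd i1 P s t + INR n * pd i2 P s t) = 0).
{ intros n.
  destruct (curve_on_curve_tangent a b (fun z => P (s + z) (t + INR n * z))
    (fun z => Q (s + z) (t + INR n * z)) _ _ T Dab Reg HT Per
    (smooth2_line_derive P s t (INR n) SP) (smooth2_line_derive Q s t (INR n) SQ))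
    as [v [H1 [H2 [H3 H4]]]]; [intros h; apply Hon|].
  rewrite Rmult_0_r, !Rplus_0_r in H2, H3; now exists v. }
apply functional_choice in Hv; destruct Hv as [v Hv].
destruct (bounded_sequence_adherent v 0 T (fun n => proj1 (Hv n))) as [l Hl].
assert (Inj : forall m n, m <> n -> v m <> v n).
{ intros m n Hmn Emn.
  destruct (Hv m) as [_ [_ [_ H1]]]; destruct (Hv n) as [_ [_ [_ H2]]].
  rewrite Emn in H1; apply (Reg (v n)).
  set (A := Derive a (v n)) in *; set (B := Derive b (v n)) in *.
  assert (Hne : INR m - INR n <> 0)
    by (intros E; apply Hmn, INR_eq; lra).
  assert (K1 : A * pd i2 Q s t - B * pd i2 P s t = 0).
  { apply (Rmult_eq_reg_l (INR m - INR n)); [lra | easy]. }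
  assert (K2 : A * pd i1 Q s t - B * pd i1 P s t = 0).
  { replace (A * pd i1 Q s t - B * pd i1 P s t) with
      ((A * (pd i1 Q s t + INR n * pd i2 Q s t) -
        B * (pd i1 P s t + INR n * pd i2 P s t)) -
       INR n * (A * pd i2 Q s t - B * pd i2 P s t)) by ring.
    rewrite H2, K1; ring. }
  split; apply (Rmult_eq_reg_r J); try easy; rewrite Rmult_0_l; unfold J.
  - transitivity (pd i1 P s t * (A * pd i2 Q s t - B * pd i2 P s t)
      - pd i2 P s t * (A * pd i1 Q s t - B * pd i1 P s t)); [ring|].
    rewrite K1, K2; ring.
  - transitivity (pd i1 Q s t * (A * pd i2 Q s t - B * pd i2 P s t)
      - pd i2 Q s t * (A * pd i1 Q s t - B * pd i1 P s t)); [ring|].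
    rewrite K1, K2; ring. }
assert (Loc : forall (g : R -> R) (c : R), (forall n z, ex_derive_n g n z) ->
  (forall n, g (v n) = c) -> Derive g l = 0).
{ intros g c Sg Hg; destruct (Req_dec (Derive g l) 0) as [E|E]; [easy|exfalso].
  assert (Cg : continuity_pt (Derive g) l).
  { apply continuity_pt_filterlim, (@ex_derive_continuous R_AbsRing).
    exact (Sg 2%nat l). }
  destruct (Cg (Rabs (Derive g l))) as [d [Hd Hg']]; [now apply Rabs_pos_lt|].
  assert (NZ : forall z, Rabs (z - l) < d -> Derive g z <> 0).
  { intros z Hz Ez; destruct (Req_dec l z) as [El|El]; [congruence|].
    assert (H := Hg' z (conj (conj I El) Hz)).
    unfold dist, R_met, R_dist in H; simpl in H; unfold Rdist in H.
    rewrite Ez, Rminus_0_l, Rabs_Ropp in H; lra. }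
  destruct (Hl d 0%nat Hd) as [m [_ Hm]].
  destruct (Hl d (S m) Hd) as [n [Hmn Hn]].
  destruct (MVT_gen g (v m) (v n) (Derive g)) as [z [Hz Ez]].
  - intros z _; apply Derive_correct; exact (Sg 1%nat z).
  - intros z _; apply continuity_pt_filterlim, (@ex_derive_continuous R_AbsRing).
    exact (Sg 1%nat z).
  - rewrite !Hg in Ez.
    assert (Hne := Inj n m ltac:(lia)).
    apply (NZ z).
    + apply Rabs_def2 in Hm; apply Rabs_def2 in Hn.
      assert (H1 := Rmin_glb_lt (v m) (v n) (l - d) ltac:(lra) ltac:(lra)).
      assert (H2 := Rmax_lub_lt (v m) (v n) (l + d) ltac:(lra) ltac:(lra)).
      apply Rabs_def1; lra.
    + apply (Rmult_eq_reg_r (v n - v m)); lra. }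
apply (Reg l); split.
- apply (Loc a (P s t)); [intros n z; apply Sm | intros n; apply Hv].
- apply (Loc b (Q s t)); [intros n z; apply Sm | intros n; apply Hv].
Qed.

(** The bivector of [e], [e'] evaluated on that of [u], [v]; it vanishes when the
projection of the plane of [u], [v] to the plane of [e], [e'] has rank at most
one. *)
Definition wedge (e e' u v : R4) : R := dot u e * dot v e' - dot u e' * dot v e.

Lemma pd_dot_const i f e s t : smooth_R2_R4 f ->
  pd i (fun a b => dot (f a b) e) s t = dot (pd4 i f s t) e.
Proof.
intros Sf.
assert (Se : smooth_R2_R4 (fun _ _ => e)) by (repeat split; apply smooth2_const).
rewrite (pd_dot i f (fun _ _ => e) s t Sf Se).
replace (pd4 i (fun _ _ => e) s t) with zero4.
- unfold dot at 2; coords; ring.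
- destruct i; apply R4_ext; symmetry;
    [exact (Derive_const _ s) | exact (Derive_const _ s) |
     exact (Derive_const _ s) | exact (Derive_const _ s) |
     exact (Derive_const _ t) | exact (Derive_const _ t) |
     exact (Derive_const _ t) | exact (Derive_const _ t)].
Qed.

Lemma product_wedge f v1 v2 E1 E2 N1 N2 : smooth_R2_R4 f ->
  adapted_frame f v1 v2 E1 E2 N1 N2 -> product_of_curves f ->
  exists e1 e2 e3 e4, orthonormal e1 e2 e3 e4 /\
    forall s t, wedge e1 e2 (E1 s t) (E2 s t) = 0 /\
                wedge e3 e4 (E1 s t) (E2 s t) = 0.
Proof.
intros Sf Hf [e1 [e2 [e3 [e4 [a [b [c [d [Ho [Rab [Rcd Him]]]]]]]]]]].
exists e1, e2, e3, e4; split; [easy|].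
assert (Se : forall e, smooth2 (fun s t => dot (f s t) e)).
{ intros e; apply (smooth_dot f (fun _ _ => e)); [easy|].
  repeat split; apply smooth2_const. }
assert (Hon : forall s t, exists u v,
  dot (f s t) e1 = a u /\ dot (f s t) e2 = b u /\
  dot (f s t) e3 = c v /\ dot (f s t) e4 = d v).
{ intros s t; destruct (proj1 (Him (f s t))) as [u [v E]]; [now exists s, t|].
  exists u, v; rewrite E.
  destruct Ho as [[H11 [H22 [H33 H44]]] [H12 [H13 [H14 [H23 [H24 H34]]]]]].
  rewrite !dot_add_l, !dot_scal_l, H11, H22, H33, H44, H12, H13, H14, H23, H24,
    H34, (dot_sym e2 e1), (dot_sym e3 e1), (dot_sym e4 e1), (dot_sym e3 e2),
    (dot_sym e4 e2), (dot_sym e4 e3), H12, H13, H14, H23, H24, H34.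
  repeat split; ring. }
intros s t; destruct (Hf s t) as [D1 [D2 [n1 [n2 _]]]].
assert (Nz : v1 s t * v2 s t <> 0) by now apply Rmult_integral_contrapositive.
split; apply (Rmult_eq_reg_l (v1 s t * v2 s t)); try easy; rewrite Rmult_0_r.
- rewrite <- (map_into_curve_rank a b _ _ s t Rab (Se e1) (Se e2)).
  + rewrite !(pd_dot_const _ f _ s t Sf), D1, D2, !dot_scal_l; unfold wedge; ring.
  + intros x y; destruct (Hon x y) as [u [_ [H1 [H2 _]]]]; now exists u.
- rewrite <- (map_into_curve_rank c d _ _ s t Rcd (Se e3) (Se e4)).
  + rewrite !(pd_dot_const _ f _ s t Sf), D1, D2, !dot_scal_l; unfold wedge; ring.
  + intros x y; destruct (Hon x y) as [_ [v [_ [_ H]]]]; now exists v.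
Qed.

(** Values of a pair of profiles at parameters where the field is orthogonal
([s0], [t0]) or parallel ([s1], [t1]) to the tangent; the reflection in the field
then permutes the vectors of the product frame up to sign, unless both are
parallel. *)
Record special_points (p q : profile) (s0 s1 t0 t1 r S C : R) : Prop := {
  special_r : 0 < r; special_S : S <> 0; special_C : C <> 0;
  special_unit : S * S + C * C = 1;
  tx_s0 : tx p s0 = 1; ty_s0 : ty p s0 = 0;
  gx_s0 : gx p s0 = 0; gy_s0 : gy p s0 = r;
  tx_s1 : tx p s1 = - S; ty_s1 : ty p s1 = C;
  gx_s1 : gx p s1 = / r * - S; gy_s1 : gy p s1 = / r * C;
  tx_t0 : tx q t0 = 1; ty_t0 : ty q t0 = 0;
  gx_t0 : gx q t0 = 0; gy_t0 : gy q t0 = / r;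
  tx_t1 : tx q t1 = S; ty_t1 : ty q t1 = C;
  gx_t1 : gx q t1 = r * S; gy_t1 : gy q t1 = r * C }.

Lemma reflect_eq G v k : dot G G <> 0 -> 2 * dot v G = k * dot G G ->
  reflect G v = sub4 v (scal4 k G).
Proof. intros HG Hk; unfold reflect; rewrite Hk; by_coords; field; easy. Qed.

Lemma special_frames p q s0 s1 t0 t1 r S C :
  profile_axioms p -> profile_axioms q ->
  special_points p q s0 s1 t0 t1 r S C ->
  frame1 p q s0 t0 = (1, 0, 0, 0) /\ frame2 p q s0 t0 = (0, 0, 1, 0) /\
  frame1 p q s1 t0 = (0, 0, 0, -1) /\ frame2 p q s1 t0 = (0, 0, 1, 0) /\
  frame1 p q s0 t1 = (1, 0, 0, 0) /\ frame2 p q s0 t1 = (0, -1, 0, 0).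
Proof.
intros Hp Hq [Hr HS HC HU E1 E2 E3 E4 F1 F2 F3 F4 G1 G2 G3 G4 K1 K2 K3 K4].
assert (Hi : r * / r = 1) by (field; lra).
assert (HU1 : S * S = 1 - C * C) by lra.
unfold frame1, frame2; repeat split.
- rewrite (reflect_eq _ _ 0); [|now apply field_neq0|];
    [apply R4_ext; coords|]; unfold dot, field, in_first, x1, x2, x3, x4;
    cbn [fst snd]; rewrite ?E1, ?E2, ?E3, ?E4, ?G3, ?G4; ring.
- rewrite (reflect_eq _ _ 0); [|now apply field_neq0|];
    [apply R4_ext; coords|]; unfold dot, field, in_second, x1, x2, x3, x4;
    cbn [fst snd]; rewrite ?G1, ?G2, ?E3, ?E4, ?G3, ?G4; ring.
- rewrite (reflect_eq _ _ r); [|now apply field_neq0|];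
    [apply R4_ext; coords|]; unfold dot, field, in_first, x1, x2, x3, x4;
    cbn [fst snd]; rewrite ?F1, ?F2, ?F3, ?F4, ?G3, ?G4; field [HU1]; lra.
- rewrite (reflect_eq _ _ 0); [|now apply field_neq0|];
    [apply R4_ext; coords|]; unfold dot, field, in_second, x1, x2, x3, x4;
    cbn [fst snd]; rewrite ?G1, ?G2, ?F3, ?F4, ?G3, ?G4; ring.
- rewrite (reflect_eq _ _ 0); [|now apply field_neq0|];
    [apply R4_ext; coords|]; unfold dot, field, in_first, x1, x2, x3, x4;
    cbn [fst snd]; rewrite ?E1, ?E2, ?E3, ?E4, ?K3, ?K4; ring.
- rewrite (reflect_eq _ _ (/ r)); [|now apply field_neq0|];
    [apply R4_ext; coords|]; unfold dot, field, in_second, x1, x2, x3, x4;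
    cbn [fst snd]; rewrite ?K1, ?K2, ?E3, ?E4, ?K3, ?K4; field [HU1]; lra.
Qed.

Lemma wedge_in_planes e e' a b c d :
  wedge e e' (a, b, 0, 0) (0, 0, c, d) =
  a * c * (x1 e * x3 e' - x1 e' * x3 e) + a * d * (x1 e * x4 e' - x1 e' * x4 e) +
  b * c * (x2 e * x3 e' - x2 e' * x3 e) + b * d * (x2 e * x4 e' - x2 e' * x4 e).
Proof.
unfold wedge, dot; cbn [x1 x2 x3 x4 fst snd].
unfold x1, x2, x3, x4; cbn [fst snd]; ring.
Qed.

Lemma special_wedge p q s0 s1 t0 t1 r S C e e' :
  profile_axioms p -> profile_axioms q ->
  special_points p q s0 s1 t0 t1 r S C ->
  (forall s t, wedge e e' (frame1 p q s t) (frame2 p q s t) = 0) ->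
  x1 e * x2 e' - x1 e' * x2 e = 0 /\ x1 e * x3 e' - x1 e' * x3 e = 0 /\
  x3 e * x4 e' - x3 e' * x4 e = 0 /\
  C * (x2 e * x4 e' - x2 e' * x4 e) =
  S * ((x1 e * x4 e' - x1 e' * x4 e) - (x2 e * x3 e' - x2 e' * x3 e)).
Proof.
intros Hp Hq Hs H.
destruct (special_frames p q s0 s1 t0 t1 r S C Hp Hq Hs)
  as [A1 [A2 [B1 [B2 [C1 C2]]]]].
assert (W1 := H s0 t0); rewrite A1, A2 in W1.
assert (W2 := H s1 t0); rewrite B1, B2 in W2.
assert (W3 := H s0 t1); rewrite C1, C2 in W3.
assert (W4 := H s1 t1); clear H A1 A2 B1 B2 C1 C2.
destruct Hs as [Hr HS HC HU E1 E2 E3 E4 F1 F2 F3 F4 G1 G2 G3 G4 K1 K2 K3 K4].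
unfold wedge, dot, x1, x2, x3, x4 in W1, W2, W3; cbn [fst snd] in W1, W2, W3.
split; [unfold x1, x2; lra|]; split; [unfold x1, x3; lra|];
  split; [unfold x3, x4; lra|].
set (T1 := in_first (tx p) (ty p) s1 t1); set (T2 := in_second (tx q) (ty q) s1 t1).
assert (EG : field p q s1 t1 = add4 (scal4 (/ r) T1) (scal4 r T2)).
{ apply R4_ext; coords; unfold T1, T2, field, in_first, in_second, x1, x2, x3, x4;
    cbn [fst snd]; rewrite ?F1, ?F2, ?F3, ?F4, ?K1, ?K2, ?K3, ?K4; ring. }
assert (D11 : dot T1 T1 = 1) by (unfold T1, dot, in_first, x1, x2, x3, x4;
  cbn [fst snd]; rewrite F1, F2; lra).
assert (D22 : dot T2 T2 = 1) by (unfold T2, dot, in_second, x1, x2, x3, x4;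
  cbn [fst snd]; rewrite K1, K2; lra).
assert (D12 : dot T1 T2 = 0) by (unfold T1, T2, dot, in_first, in_second,
  x1, x2, x3, x4; cbn [fst snd]; lra).
assert (D1 : dot T1 (field p q s1 t1) = / r)
  by (rewrite EG, dot_add_r, !dot_scal_r, D11, D12; ring).
assert (D2 : dot T2 (field p q s1 t1) = r)
  by (rewrite EG, dot_add_r, !dot_scal_r, D22, (dot_sym T2), D12; ring).
assert (DG : dot (field p q s1 t1) (field p q s1 t1) = r * r + / r * / r).
{ rewrite EG at 1; rewrite dot_add_l, !dot_scal_l, D1, D2; ring. }
assert (WT : wedge e e' T1 T2 = 0).
{ rewrite <- Ropp_0, <- W4; unfold frame1, frame2, reflect.
  fold T1 T2; rewrite D1, D2, DG, EG; unfold wedge.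
  rewrite !dot_sub_l, !dot_scal_l, !dot_add_l, !dot_scal_l.
  assert (0 < r * r * (r * r)) by (repeat apply Rmult_lt_0_compat; easy).
  field; split; lra. }
unfold T1, T2, in_first, in_second in WT; rewrite wedge_in_planes in WT.
rewrite F1, F2, K1, K2 in WT.
assert (W13 : x1 e * x3 e' - x1 e' * x3 e = 0) by (unfold x1, x3; lra).
rewrite W13 in WT; apply (Rmult_eq_reg_l C); [nra | easy].
Qed.

(** For both planes of a splitting, the tangent planes at the four special points
make the Pluecker coordinates 12, 13 and 34 vanish and tie the coordinate 24 to
the difference of 14 and 23.  By the Pluecker relation one of 14 and 23 vanishes;
as the two bivectors have unit length and are orthogonal, this contradicts
[S <> 0]. *)
Lemma ribaucour_not_product p q s0 s1 t0 t1 r S C :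
  profile_axioms p -> profile_axioms q ->
  (forall s t, lame1 p q s t <> 0) -> (forall s t, lame2 p q s t <> 0) ->
  special_points p q s0 s1 t0 t1 r S C ->
  ~ product_of_curves (ribaucour p q).
Proof.
intros Hp Hq H1 H2 Hs Hprod.
destruct (product_wedge _ _ _ _ _ _ _ (ribaucour_smooth p q Hp Hq)
  (ribaucour_adapted p q Hp Hq H1 H2) Hprod) as [e1 [e2 [e3 [e4 [Ho Hw]]]]].
destruct (special_wedge p q s0 s1 t0 t1 r S C e1 e2 Hp Hq Hs
  (fun s t => proj1 (Hw s t))) as [A12 [A13 [A34 A24]]].
destruct (special_wedge p q s0 s1 t0 t1 r S C e3 e4 Hp Hq Hs
  (fun s t => proj2 (Hw s t))) as [B12 [B13 [B34 B24]]].
assert (HS := special_S _ _ _ _ _ _ _ _ _ Hs).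
assert (HC := special_C _ _ _ _ _ _ _ _ _ Hs).
destruct Ho as [[O11 [O22 [O33 O44]]] [O12 [O13 [O14 [O23 [O24 O34]]]]]].
set (w := fun (a b : R4 -> R) e e' => a e * b e' - a e' * b e).
assert (Pl : forall e e', w x1 x2 e e' * w x3 x4 e e' - w x1 x3 e e' * w x2 x4 e e'
  + w x1 x4 e e' * w x2 x3 e e' = 0) by (intros; unfold w; ring).
assert (Cb : forall a b c d, w x1 x2 a b * w x1 x2 c d + w x1 x3 a b * w x1 x3 c d
  + w x1 x4 a b * w x1 x4 c d + w x2 x3 a b * w x2 x3 c d
  + w x2 x4 a b * w x2 x4 c d + w x3 x4 a b * w x3 x4 c d =
  dot a c * dot b d - dot a d * dot b c) by (intros; unfold w, dot; ring).
assert (PA := Pl e1 e2); assert (PB := Pl e3 e4).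
assert (NA := Cb e1 e2 e1 e2); assert (NB := Cb e3 e4 e3 e4).
assert (NC := Cb e1 e2 e3 e4).
rewrite O11, O22, (dot_sym e2 e1), O12 in NA.
rewrite O33, O44, (dot_sym e4 e3), O34 in NB.
rewrite O13, O24, O14, O23 in NC.
fold (w x1 x2 e1 e2) in A12; fold (w x1 x3 e1 e2) in A13.
fold (w x3 x4 e1 e2) in A34; fold (w x2 x4 e1 e2) (w x1 x4 e1 e2) (w x2 x3 e1 e2) in A24.
fold (w x1 x2 e3 e4) in B12; fold (w x1 x3 e3 e4) in B13.
fold (w x3 x4 e3 e4) in B34; fold (w x2 x4 e3 e4) (w x1 x4 e3 e4) (w x2 x3 e3 e4) in B24.
rewrite A12, A13, A34 in PA, NA, NC; rewrite B12, B13, B34 in PB, NB, NC.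
clear - HS HC A24 B24 PA PB NA NB NC.
set (a := w x1 x4 e1 e2) in *; set (b := w x2 x3 e1 e2) in *.
set (c := w x2 x4 e1 e2) in *; set (a' := w x1 x4 e3 e4) in *.
set (b' := w x2 x3 e3 e4) in *; set (c' := w x2 x4 e3 e4) in *.
clearbody a b c a' b' c'.
assert (Ec : c = S / C * (a - b)).
{ apply (Rmult_eq_reg_l C); [rewrite A24; field|]; easy. }
assert (Ec' : c' = S / C * (a' - b')).
{ apply (Rmult_eq_reg_l C); [rewrite B24; field|]; easy. }
set (k := S / C) in *.
assert (Hk : 0 < k * k).
{ assert (k <> 0) by (apply Rmult_integral_contrapositive;
    split; [easy | now apply Rinv_neq_0_compat]). nra. }
subst c c'.
assert (Hab : a * b = 0) by lra; assert (Hab' : a' * b' = 0) by lra.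
destruct (Rmult_integral _ _ Hab) as [-> | ->];
  destruct (Rmult_integral _ _ Hab') as [-> | ->].
- assert (E : b * b' * (1 + k * k) = 0) by lra.
  apply Rmult_integral in E; destruct E as [E|E]; [|lra].
  apply Rmult_integral in E; destruct E as [-> | ->]; lra.
- assert (E : b * a' * (k * k) = 0) by lra.
  apply Rmult_integral in E; destruct E as [E|E]; [|lra].
  apply Rmult_integral in E; destruct E as [-> | ->]; lra.
- assert (E : a * b' * (k * k) = 0) by lra.
  apply Rmult_integral in E; destruct E as [E|E]; [|lra].
  apply Rmult_integral in E; destruct E as [-> | ->]; lra.
- assert (E : a * a' * (1 + k * k) = 0) by lra.
  apply Rmult_integral in E; destruct E as [E|E]; [|lra].
  apply Rmult_integral in E; destruct E as [-> | ->]; lra.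
Qed.

(** * Thin surfaces *)

(** Squared volume of the parallelepiped spanned by three vectors. *)
Definition gram (u v w : R4) : R :=
  dot u u * (dot v v * dot w w - dot v w * dot v w)
  - dot u v * (dot u v * dot w w - dot v w * dot u w)
  + dot u w * (dot u v * dot v w - dot v v * dot u w).

Definition minor (a b c : R4 -> R) (u v w : R4) : R :=
  a u * (b v * c w - c v * b w) - b u * (a v * c w - c v * a w)
  + c u * (a v * b w - b v * a w).

Lemma gram_minors u v w : gram u v w =
  minor x1 x2 x3 u v w ^ 2 + minor x1 x2 x4 u v w ^ 2 +
  minor x1 x3 x4 u v w ^ 2 + minor x2 x3 x4 u v w ^ 2.
Proof. unfold gram, minor, dot; ring. Qed.

Definition cross (v w : R4) : R4 :=
  (x3 v * x4 w - x4 v * x3 w, 0, x4 v * x1 w - x1 v * x4 w,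
   x1 v * x3 w - x3 v * x1 w).

Lemma minor_cross u v w : minor x1 x3 x4 u v w = dot u (cross v w).
Proof. unfold minor, cross, dot; cbn [x1 x2 x3 x4 fst snd].
unfold x1, x2, x3, x4; cbn [fst snd]; ring. Qed.

Lemma cross_cyclic u v w : dot u (cross v w) = dot v (cross w u).
Proof. rewrite <- !minor_cross; unfold minor; ring. Qed.

(** If all the volumes vanished, differentiating them would show that all tangent
planes are parallel to one plane. *)
Lemma special_not_planar p q s0 s1 t0 t1 r S C :
  profile_axioms p -> profile_axioms q ->
  (forall s t, lame1 p q s t <> 0) -> (forall s t, lame2 p q s t <> 0) ->
  special_points p q s0 s1 t0 t1 r S C ->
  exists a b c d, image (ribaucour p q) a /\ image (ribaucour p q) b /\
    image (ribaucour p q) c /\ image (ribaucour p q) d /\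
    0 < gram (sub4 b a) (sub4 c a) (sub4 d a).
Proof.
intros Hp Hq H1 H2 Hs; set (f := ribaucour p q).
assert (Sf := ribaucour_smooth p q Hp Hq); fold f in Sf.
apply NNPP; intros Hno.
assert (Z : forall s t s' t' s'' t'', dot (sub4 (f s t) (f 0 0))
  (cross (sub4 (f s' t') (f 0 0)) (sub4 (f s'' t'') (f 0 0))) = 0).
{ intros s t s' t' s'' t''; rewrite <- minor_cross.
  destruct (Req_dec (minor x1 x3 x4 (sub4 (f s t) (f 0 0))
    (sub4 (f s' t') (f 0 0)) (sub4 (f s'' t'') (f 0 0))) 0) as [E|E]; [easy|].
  exfalso; apply Hno; exists (f 0 0), (f s t), (f s' t'), (f s'' t'').
  repeat split; try (eexists; eexists; reflexivity).
  rewrite gram_minors; set (m := minor x1 x3 x4 _ _ _) in *.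
  assert (0 < m ^ 2) by (apply pow2_gt_0, E).
  assert (G1 := pow2_ge_0 (minor x1 x2 x3 (sub4 (f s t) (f 0 0))
    (sub4 (f s' t') (f 0 0)) (sub4 (f s'' t'') (f 0 0)))).
  assert (G2 := pow2_ge_0 (minor x1 x2 x4 (sub4 (f s t) (f 0 0))
    (sub4 (f s' t') (f 0 0)) (sub4 (f s'' t'') (f 0 0)))).
  assert (G3 := pow2_ge_0 (minor x2 x3 x4 (sub4 (f s t) (f 0 0))
    (sub4 (f s' t') (f 0 0)) (sub4 (f s'' t'') (f 0 0)))).
  lra. }
assert (D : forall e, (forall s t, dot (sub4 (f s t) (f 0 0)) e = 0) ->
  forall i s t, dot (pd4 i f s t) e = 0).
{ intros e He i s t; rewrite <- (pd_dot_const i f e s t Sf).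
  replace (fun a b => dot (f a b) e) with (fun _ _ : R => dot (f 0 0) e).
  - destruct i; [exact (Derive_const _ s) | exact (Derive_const _ t)].
  - do 2 (apply functional_extensionality; intros ?).
    apply Rminus_diag_uniq; rewrite <- dot_sub_l.
    match goal with |- dot (sub4 _ (f ?x ?y)) e = 0 =>
      assert (H := He x y); rewrite dot_sub_l in H; rewrite dot_sub_l; lra end. }
destruct (special_frames p q s0 s1 t0 t1 r S C Hp Hq Hs)
  as [A1 [A2 [B1 _]]].
assert (E1 := proj1 (ribaucour_derive p q s0 t0 Hp Hq)); rewrite A1 in E1.
assert (E2 := proj2 (ribaucour_derive p q s0 t0 Hp Hq)); rewrite A2 in E2.
assert (E3 := proj1 (ribaucour_derive p q s1 t0 Hp Hq)); rewrite B1 in E3.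
fold f in E1, E2, E3.
assert (W : dot (pd4 i1 f s0 t0) (cross (pd4 i2 f s0 t0) (pd4 i1 f s1 t0)) = 0).
{ assert (S1 : forall s' t' s'' t'', dot (pd4 i1 f s0 t0)
    (cross (sub4 (f s' t') (f 0 0)) (sub4 (f s'' t'') (f 0 0))) = 0).
  { intros s' t' s'' t''; apply D; intros s t; apply Z. }
  assert (S2 : forall s'' t'', dot (pd4 i2 f s0 t0)
    (cross (sub4 (f s'' t'') (f 0 0)) (pd4 i1 f s0 t0)) = 0).
  { intros s'' t''; apply D; intros s' t'; rewrite <- cross_cyclic; apply S1. }
  rewrite cross_cyclic, cross_cyclic; apply D; intros s'' t''.
  rewrite <- cross_cyclic; apply S2. }
rewrite E1, E2, E3 in W; unfold cross, dot in W.
repeat (progress rewrite ?x1_scal, ?x2_scal, ?x3_scal, ?x4_scal in W).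
unfold x1, x2, x3, x4 in W; cbn [fst snd] in W.
apply (Rmult_integral_contrapositive (lame1 p q s0 t0)
  (lame2 p q s0 t0 * lame1 p q s1 t0)).
- split; [easy | now apply Rmult_integral_contrapositive].
- lra.
Qed.

Lemma enorm_sqr v : enorm v * enorm v = dot v v.
Proof. apply sqrt_sqrt; unfold dot; nra. Qed.

Lemma dot_distances a b c : dot (sub4 b a) (sub4 c a) =
  / 2 * (dot (sub4 b a) (sub4 b a) + dot (sub4 c a) (sub4 c a)
         - dot (sub4 b c) (sub4 b c)).
Proof. unfold dot; coords; field. Qed.

(** A symmetric substitute for similarity: a similarity in either direction
induces such a correspondence. *)
Definition scaled_sets (A B : R4 -> Prop) (mu : R) : Prop :=
  exists rel : R4 -> R4 -> Prop,
    (forall p, A p -> exists q, B q /\ rel p q) /\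
    (forall q, B q -> exists p, A p /\ rel p q) /\
    (forall p q p' q', rel p q -> rel p' q' ->
       dot (sub4 q q') (sub4 q q') = mu * dot (sub4 p p') (sub4 p p')).

Lemma similar_scaled f g : similar_surfaces f g \/ similar_surfaces g f ->
  exists mu, 0 < mu /\ scaled_sets (image f) (image g) mu.
Proof.
assert (Sq : forall phi l, 0 < l ->
  (forall p q, enorm (sub4 (phi p) (phi q)) = l * enorm (sub4 p q)) ->
  forall p q, dot (sub4 (phi p) (phi q)) (sub4 (phi p) (phi q)) =
    l * l * dot (sub4 p q) (sub4 p q)).
{ intros phi l Hl H p q; rewrite <- !enorm_sqr, H; ring. }
intros [[phi [[l [Hl Hphi]] Him]]|[phi [[l [Hl Hphi]] Him]]].
- exists (l * l); split; [now apply Rmult_lt_0_compat|].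
  exists (fun p q => q = phi p); repeat split.
  + intros p Hp; exists (phi p); split; [apply Him; now exists p | easy].
  + intros q Hq; apply Him in Hq; exact Hq.
  + intros p q p' q' -> ->; now apply Sq.
- exists (/ (l * l)); split; [now apply Rinv_0_lt_compat, Rmult_lt_0_compat|].
  exists (fun p q => p = phi q); repeat split.
  + intros p Hp; apply Him in Hp; exact Hp.
  + intros q Hq; exists (phi q); split; [apply Him; now exists q | easy].
  + intros p q p' q' -> ->; rewrite (Sq phi l Hl Hphi); field; lra.
Qed.

(** A correspondence multiplies [gram] by [mu ^ 3]; it cannot enlarge a set
containing a nondegenerate quadruple to a long set all of whose quadruples are
nearly degenerate. *)
Lemma thin_not_scaled (A B : R4 -> Prop) mu a b c d q q' D V : 0 < mu ->
  A a -> A b -> A c -> A d ->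
  (forall p p', A p -> A p' -> dot (sub4 p p') (sub4 p p') <= D) ->
  (forall u v w z, B u -> B v -> B w -> B z ->
     gram (sub4 v u) (sub4 w u) (sub4 z u) <= V) ->
  B q -> B q' ->
  V * D ^ 3 < gram (sub4 b a) (sub4 c a) (sub4 d a)
                * dot (sub4 q q') (sub4 q q') ^ 3 ->
  0 < gram (sub4 b a) (sub4 c a) (sub4 d a) ->
  ~ scaled_sets A B mu.
Proof.
intros Hmu Ha Hb Hc Hd HD HV Hq Hq' Hlt Hg [rel [R1 [R2 R3]]].
destruct (R1 a Ha) as [a' [Ba Ra]]; destruct (R1 b Hb) as [b' [Bb Rb]].
destruct (R1 c Hc) as [c' [Bc Rc]]; destruct (R1 d Hd) as [d' [Bd Rd]].
destruct (R2 q Hq) as [p [Ap Rp]]; destruct (R2 q' Hq') as [p' [Ap' Rp']].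
assert (Sc : forall x y x' y', rel x x' -> rel y y' ->
  dot (sub4 x' a') (sub4 y' a') = mu * dot (sub4 x a) (sub4 y a)).
{ intros x y x' y' Rx Ry.
  rewrite (dot_distances a' x' y'), (dot_distances a x y).
  rewrite (R3 _ _ _ _ Rx Ra), (R3 _ _ _ _ Ry Ra), (R3 _ _ _ _ Rx Ry); ring. }
assert (G : gram (sub4 b' a') (sub4 c' a') (sub4 d' a') =
  mu ^ 3 * gram (sub4 b a) (sub4 c a) (sub4 d a)).
{ unfold gram; rewrite (Sc b b b' b' Rb Rb), (Sc c c c' c' Rc Rc),
    (Sc d d d' d' Rd Rd), (Sc b c b' c' Rb Rc), (Sc b d b' d' Rb Rd),
    (Sc c d c' d' Rc Rd); ring. }
assert (HV' := HV a' b' c' d' Ba Bb Bc Bd); rewrite G in HV'.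
set (g := gram (sub4 b a) (sub4 c a) (sub4 d a)) in *.
assert (E := R3 _ _ _ _ Rp Rp').
set (L := dot (sub4 q q') (sub4 q q')) in *.
assert (HL : L <= mu * D).
{ rewrite E; apply Rmult_le_compat_l; [lra | now apply HD]. }
assert (HL0 : 0 <= L) by (unfold L, dot; nra).
assert (HD0 : 0 <= D).
{ apply Rle_trans with (2 := HD a a Ha Ha); unfold dot; nra. }
assert (HL3 : L ^ 3 <= (mu * D) ^ 3) by (apply pow_incr; lra).
assert (HD3 : 0 <= D ^ 3) by now apply pow_le.
apply (Rlt_irrefl (V * D ^ 3)).
apply Rlt_le_trans with (1 := Hlt).
apply Rle_trans with (g * (mu * D) ^ 3); [apply Rmult_le_compat_l; lra|].
replace (g * (mu * D) ^ 3) with (mu ^ 3 * g * D ^ 3) by ring.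
now apply Rmult_le_compat_r.
Qed.

Lemma Rabs_mult3_le a b c A B C : Rabs a <= A -> Rabs b <= B -> Rabs c <= C ->
  Rabs (a * b * c) <= A * B * C.
Proof.
intros; rewrite !Rabs_mult.
repeat apply Rmult_le_compat; auto using Rabs_pos, Rmult_le_pos.
Qed.

Lemma minor_bound (a b c : R4 -> R) u v w A B C :
  (forall z, z = u \/ z = v \/ z = w ->
     Rabs (a z) <= A /\ Rabs (b z) <= B /\ Rabs (c z) <= C) ->
  Rabs (minor a b c u v w) <= 6 * (A * B * C).
Proof.
intros H.
destruct (H u) as [Au [Bu Cu]]; [tauto|]; destruct (H v) as [Av [Bv Cv]]; [tauto|].
destruct (H w) as [Aw [Bw Cw]]; [tauto|].
replace (minor a b c u v w) with
  (a u * b v * c w + - (a u * b w * c v) + - (a v * b u * c w)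
   + a w * b u * c v + a v * b w * c u + - (a w * b v * c u))
  by (unfold minor; ring).
repeat match goal with |- Rabs (_ + _) <= _ =>
  eapply Rle_trans; [apply Rabs_triang|] end.
assert (P1 := Rabs_mult3_le _ _ _ _ _ _ Au Bv Cw).
assert (P2 := Rabs_mult3_le _ _ _ _ _ _ Au Bw Cv).
assert (P3 := Rabs_mult3_le _ _ _ _ _ _ Av Bu Cw).
assert (P4 := Rabs_mult3_le _ _ _ _ _ _ Aw Bu Cv).
assert (P5 := Rabs_mult3_le _ _ _ _ _ _ Av Bw Cu).
assert (P6 := Rabs_mult3_le _ _ _ _ _ _ Aw Bv Cu).
assert (T : forall x y, Rabs (x + y) <= Rabs x + Rabs y) by apply Rabs_triang.
pose proof (T (a u * b v * c w + - (a u * b w * c v) + - (a v * b u * c w)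
   + a w * b u * c v) (a v * b w * c u)).
pose proof (T (a u * b v * c w + - (a u * b w * c v) + - (a v * b u * c w))
   (a w * b u * c v)).
pose proof (T (a u * b v * c w + - (a u * b w * c v)) (- (a v * b u * c w))).
pose proof (T (a u * b v * c w) (- (a u * b w * c v))).
rewrite ?Rabs_Ropp in *; lra.
Qed.

(** Every minor of order three involves one of the two short directions. *)
Lemma gram_bound u v w M N : 0 <= M <= N ->
  (forall z, z = u \/ z = v \/ z = w ->
     Rabs (x1 z) <= M /\ Rabs (x2 z) <= N /\ Rabs (x3 z) <= N /\
     Rabs (x4 z) <= M) ->
  gram u v w <= 144 * (M * N * N) ^ 2.
Proof.
intros HMN H; rewrite gram_minors.
assert (Sq : forall m K, Rabs m <= 6 * K -> m ^ 2 <= 36 * K ^ 2).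
{ intros m K Hm; rewrite <- (pow2_abs m).
  assert (P := Rabs_pos m); nra. }
assert (0 <= M * N * N) by (repeat apply Rmult_le_pos; lra).
assert (B1 : minor x1 x2 x3 u v w ^ 2 <= 36 * (M * N * N) ^ 2).
{ apply Sq, minor_bound; intros z Hz; destruct (H z Hz) as [? [? [? ?]]]; auto. }
assert (B4 : minor x2 x3 x4 u v w ^ 2 <= 36 * (M * N * N) ^ 2).
{ replace (M * N * N) with (N * N * M) by ring.
  apply Sq, minor_bound; intros z Hz; destruct (H z Hz) as [? [? [? ?]]]; auto. }
assert (B2 : minor x1 x2 x4 u v w ^ 2 <= 36 * (M * N * N) ^ 2).
{ apply Sq; apply Rle_trans with (6 * (M * N * M)).
  - apply minor_bound; intros z Hz; destruct (H z Hz) as [? [? [? ?]]]; auto.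
  - assert (M * N * M <= M * N * N); [|lra].
    apply Rmult_le_compat_l; [apply Rmult_le_pos|]; lra. }
assert (B3 : minor x1 x3 x4 u v w ^ 2 <= 36 * (M * N * N) ^ 2).
{ apply Sq; apply Rle_trans with (6 * (M * N * M)).
  - apply minor_bound; intros z Hz; destruct (H z Hz) as [? [? [? ?]]]; auto.
  - assert (M * N * M <= M * N * N); [|lra].
    apply Rmult_le_compat_l; [apply Rmult_le_pos|]; lra. }
lra.
Qed.

(** * The profiles *)

Lemma smooth1_comp g u : smooth1 g -> smooth1 u -> smooth1 (fun x => g (u x)).
Proof.
intros Hg Hu; destruct (smooth1_derive u Hu) as [u' [Du Su']].
induction Hg as [c | | g h _ IHg _ IHh | g h _ IHg _ IHh | g _ IHg Hn
  | g _ IHg Hp | g _ IHg | g _ IHg | g h Dg _ IHh].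
- constructor.
- easy.
- now apply smooth1_plus.
- now apply smooth1_mult.
- now apply (smooth1_inv (fun x => g (u x))).
- now apply (smooth1_sqrt (fun x => g (u x))).
- now apply smooth1_sin.
- now apply smooth1_cos.
- apply (smooth1_primitive _ (fun x => u' x * h (u x)));
    [|now apply smooth1_mult].
  intros x; apply (is_derive_comp g u); [apply Dg | apply Du].
Qed.

Definition primitive (g : R -> R) (x : R) : R := RInt g 0 x.

Lemma primitive_derive g : smooth1 g ->
  forall x, is_derive (primitive g) x (g x).
Proof.
intros Hg x; apply (is_derive_RInt g (primitive g) 0 x).
- apply filter_forall; intros y; apply (@RInt_correct R_CompleteNormedModule).
  apply (@ex_RInt_continuous R_CompleteNormedModule).
  intros z _; now apply smooth1_continuous.
- now apply smooth1_continuous.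
Qed.

Lemma primitive_0 g : primitive g 0 = 0.
Proof. apply (@RInt_point R_CompleteNormedModule). Qed.

Lemma primitive_smooth g : smooth1 g -> smooth1 (primitive g).
Proof.
intros Hg; apply (smooth1_primitive _ g); [now apply primitive_derive | easy].
Qed.

Lemma derive_mean_value (f f' : R -> R) a b :
  (forall x, is_derive f x (f' x)) ->
  exists c, Rmin a b <= c <= Rmax a b /\ f b - f a = f' c * (b - a).
Proof.
intros D; apply (MVT_gen f a b f').
- intros x _; apply D.
- intros x _; apply continuity_pt_filterlim, (@ex_derive_continuous R_AbsRing).
  exists (f' x); apply D.
Qed.

Lemma derive_lipschitz (f f' : R -> R) M a b :
  (forall x, is_derive f x (f' x)) -> (forall x, Rabs (f' x) <= M) ->
  Rabs (f b - f a) <= M * Rabs (b - a).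
Proof.
intros D HM; destruct (derive_mean_value f f' a b D) as [c [_ ->]].
rewrite Rabs_mult; apply Rmult_le_compat_r; [apply Rabs_pos | apply HM].
Qed.

Lemma derive_zero_constant (f : R -> R) a b :
  (forall x, is_derive f x 0) -> f a = f b.
Proof.
intros D; destruct (derive_mean_value f (fun _ => 0) b a D) as [c [_ E]]; lra.
Qed.

Lemma primitive_shift g : smooth1 g -> (forall x, g (x + 1) = g x) ->
  forall x y, primitive g (x + 1) - primitive g x =
              primitive g (y + 1) - primitive g y.
Proof.
intros Hg Hp x y.
apply (derive_zero_constant (fun x => primitive g (x + 1) - primitive g x)).
intros z; evar_last.
- apply (is_derive_minus (fun x => primitive g (x + 1)) (primitive g));
    [|now apply primitive_derive].
  apply (is_derive_comp (primitive g) (fun x => x + 1));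
    [now apply primitive_derive | auto_derive; auto].
- rewrite Hp; unfold minus, plus, opp, scal; simpl; unfold mult; simpl; ring.
Qed.

Lemma primitive_periodic g : smooth1 g -> (forall x, g (x + 1) = g x) ->
  primitive g 1 = 0 -> forall x, primitive g (x + 1) = primitive g x.
Proof.
intros Hg Hp H1 x; assert (E := primitive_shift g Hg Hp x 0).
rewrite Rplus_0_l, H1, primitive_0 in E; lra.
Qed.

(** The integral over a period equals the one over the symmetric period. *)
Lemma primitive_periodic_odd g : smooth1 g -> (forall x, g (x + 1) = g x) ->
  (forall x, g (- x) = - g x) -> forall x, primitive g (x + 1) = primitive g x.
Proof.
intros Hg Hp Ho x; assert (E := primitive_shift g Hg Hp x (- (1 / 2))).
assert (Ev : primitive g (- (1 / 2)) - primitive g (- - (1 / 2)) =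
  primitive g 0 - primitive g (- 0)).
{ apply (derive_zero_constant (fun x => primitive g x - primitive g (- x))).
  intros z; evar_last.
  - apply (is_derive_minus (primitive g) (fun x => primitive g (- x)));
      [now apply primitive_derive|].
    apply (is_derive_comp (primitive g) (fun x => - x));
      [now apply primitive_derive | auto_derive; auto].
  - rewrite Ho; unfold minus, plus, opp, scal; simpl; unfold mult; simpl; ring. }
replace (- (1 / 2) + 1) with (- - (1 / 2)) in E by field.
rewrite Ropp_0 in Ev; lra.
Qed.

Lemma primitive_bound g M x : smooth1 g -> (forall x, Rabs (g x) <= M) ->
  Rabs (primitive g x) <= M * Rabs x.
Proof.
intros Hg HM.
assert (H := derive_lipschitz _ g M 0 x (primitive_derive g Hg) HM).
now rewrite primitive_0, !Rminus_0_r in H.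
Qed.

Lemma periodic_bound (g : R -> R) M : (forall x, g (x + 1) = g x) ->
  (forall x, 0 <= x <= 1 -> Rabs (g x) <= M) -> forall x, Rabs (g x) <= M.
Proof.
intros Hp HM x.
destruct (periodic_representative g g 1 x Rlt_0_1 (fun t => conj (Hp t) (Hp t)))
  as [v [Hv [<- _]]].
now apply HM.
Qed.

Lemma sin_lipschitz a b : Rabs (sin b - sin a) <= Rabs (b - a).
Proof.
rewrite <- Rmult_1_l; apply (derive_lipschitz sin cos).
- apply is_derive_sin.
- intros x; apply Rabs_le; apply COS_bound.
Qed.

Lemma cos_lipschitz a b : Rabs (cos b - cos a) <= Rabs (b - a).
Proof.
rewrite <- Rmult_1_l; apply (derive_lipschitz cos (fun x => - sin x)).
- apply is_derive_cos.
- intros x; rewrite Rabs_Ropp; apply Rabs_le; apply SIN_bound.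
Qed.

(** With [sinh eta = e * cos (2 a)], the complex field
[i * exp (eta / 2 + i * bend a)] has derivative a real multiple of
[exp (i * (a + bend a))]; below [cosh_eta], [modulus] and [bend] stand for
[cosh eta], [exp (eta / 2)] and the primitive of [2 e cos^2 a / cosh eta]. *)
Definition sinh_eta (e a : R) : R := e * (1 - 2 * (sin a * sin a)).
Definition cosh_eta (e a : R) : R := sqrt (1 + sinh_eta e a * sinh_eta e a).
Definition modulus (e a : R) : R := sqrt (sinh_eta e a + cosh_eta e a).
Definition bend_rate (e a : R) : R := 2 * e * (cos a * cos a) * / cosh_eta e a.
Definition bend (e : R) : R -> R := primitive (bend_rate e).

Lemma cosh_eta_sqr e a :
  cosh_eta e a * cosh_eta e a = 1 + sinh_eta e a * sinh_eta e a.
Proof. apply sqrt_sqrt; nra. Qed.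

Lemma cosh_eta_ge1 e a : 1 <= cosh_eta e a.
Proof. rewrite <- sqrt_1; apply sqrt_le_1_alt; nra. Qed.

Lemma modulus_arg_pos e a : 0 < sinh_eta e a + cosh_eta e a.
Proof.
assert (H1 := cosh_eta_sqr e a); assert (H2 := cosh_eta_ge1 e a); nra.
Qed.

Lemma modulus_sqr e a :
  modulus e a * modulus e a = sinh_eta e a + cosh_eta e a.
Proof. apply sqrt_sqrt, Rlt_le, modulus_arg_pos. Qed.

Lemma modulus_pos e a : 0 < modulus e a.
Proof. apply sqrt_lt_R0, modulus_arg_pos. Qed.

Lemma sinh_eta_opp e a : sinh_eta (- e) a = - sinh_eta e a.
Proof. unfold sinh_eta; ring. Qed.

Lemma cosh_eta_opp e a : cosh_eta (- e) a = cosh_eta e a.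
Proof. unfold cosh_eta; rewrite sinh_eta_opp; f_equal; ring. Qed.

Lemma modulus_opp e a : modulus (- e) a = / modulus e a.
Proof.
assert (P := modulus_pos e a); assert (P' := modulus_pos (- e) a).
assert (E := modulus_sqr e a); assert (E' := modulus_sqr (- e) a).
rewrite sinh_eta_opp, cosh_eta_opp in E'; assert (C := cosh_eta_sqr e a).
apply (Rmult_eq_reg_r (modulus e a)); [|lra].
rewrite Rinv_l by lra.
assert (Q : (modulus (- e) a * modulus e a) * (modulus (- e) a * modulus e a) = 1).
{ transitivity ((modulus (- e) a * modulus (- e) a)
    * (modulus e a * modulus e a)); [ring|].
  rewrite E, E'; nra. }
assert (0 < modulus (- e) a * modulus e a) by now apply Rmult_lt_0_compat.
nra.
Qed.

Lemma sinh_eta_smooth e : smooth1 (sinh_eta e).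
Proof.
apply (smooth1_mult (fun _ => e)); [constructor|].
apply (smooth1_plus (fun _ => 1)); [constructor|].
apply smooth1_opp; repeat constructor.
Qed.

Lemma cosh_eta_smooth e : smooth1 (cosh_eta e).
Proof.
apply smooth1_sqrt; [|intros x; nra].
apply smooth1_plus; [constructor|].
apply smooth1_mult; apply sinh_eta_smooth.
Qed.

Lemma modulus_smooth e : smooth1 (modulus e).
Proof.
apply smooth1_sqrt; [|apply modulus_arg_pos].
apply smooth1_plus; [apply sinh_eta_smooth | apply cosh_eta_smooth].
Qed.

Lemma inv_cosh_smooth e : smooth1 (fun a => / cosh_eta e a).
Proof.
apply (smooth1_inv (cosh_eta e)); [apply cosh_eta_smooth|].
intros a; assert (H := cosh_eta_ge1 e a); lra.
Qed.

Lemma bend_rate_smooth e : smooth1 (bend_rate e).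
Proof.
apply (smooth1_mult (fun a => 2 * e * (cos a * cos a))); [|apply inv_cosh_smooth].
repeat constructor.
Qed.

Lemma bend_derive e a : is_derive (bend e) a (bend_rate e a).
Proof. apply primitive_derive, bend_rate_smooth. Qed.

Lemma bend_smooth e : smooth1 (bend e).
Proof. apply primitive_smooth, bend_rate_smooth. Qed.

Lemma modulus_derive e a : is_derive (modulus e) a
  (- (2 * e * sin a * cos a * modulus e a * / cosh_eta e a)).
Proof.
assert (Hc := cosh_eta_ge1 e a); assert (Hm := modulus_pos e a).
assert (D1 : is_derive (sinh_eta e) a (- (4 * e * sin a * cos a))).
{ unfold sinh_eta; auto_derive; auto; ring. }
assert (D2 : is_derive (cosh_eta e) a
  (- (4 * e * sin a * cos a) * sinh_eta e a * / cosh_eta e a)).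
{ evar_last.
  - apply (is_derive_sqrt (fun a => 1 + sinh_eta e a * sinh_eta e a)); [|nra].
    apply (is_derive_plus (fun _ => 1) (fun a => sinh_eta e a * sinh_eta e a)).
    + apply (@is_derive_const R_AbsRing).
    + apply (Derive.is_derive_mult (sinh_eta e) (sinh_eta e)); exact D1.
  - fold (cosh_eta e a); unfold plus, zero; simpl; field; lra. }
evar_last.
- apply (is_derive_sqrt (fun a => sinh_eta e a + cosh_eta e a));
    [|apply modulus_arg_pos].
  apply (is_derive_plus (sinh_eta e) (cosh_eta e)); [exact D1 | exact D2].
- fold (modulus e a); unfold plus; simpl.
  assert (E := modulus_sqr e a).
  apply (Rmult_eq_reg_r (2 * modulus e a * cosh_eta e a)).
  + transitivity (- (4 * e * sin a * cos a) * (sinh_eta e a + cosh_eta e a));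
      [field; lra | rewrite <- E; field; lra].
  + apply Rmult_integral_contrapositive; split; lra.
Qed.

Lemma bend_bound e a : Rabs (bend e a) <= 2 * Rabs e * Rabs a.
Proof.
apply primitive_bound; [apply bend_rate_smooth|]; intros x.
assert (Hc := cosh_eta_ge1 e x); unfold bend_rate.
assert (Hi : 0 < / cosh_eta e x <= 1).
{ split; [apply Rinv_0_lt_compat; lra|].
  rewrite <- Rinv_1; apply Rinv_le_contravar; lra. }
rewrite !Rabs_mult, (Rabs_pos_eq 2), (Rabs_pos_eq (/ _)) by lra.
rewrite <- Rabs_mult, (Rabs_pos_eq (cos x * cos x)) by nra.
assert (cos x * cos x <= 1) by (assert (Hsc := sin2_cos2 x); unfold Rsqr in Hsc; nra).
assert (P := Rabs_pos e).
assert (0 <= cos x * cos x * / cosh_eta e x <= 1) by nra.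
nra.
Qed.

Lemma bend_opp e a : bend (- e) a = - bend e a.
Proof.
apply Rplus_opp_r_uniq.
rewrite <- (Rplus_0_r 0), <- (primitive_0 (bend_rate e)) at 1.
rewrite <- (primitive_0 (bend_rate (- e))) at 2.
apply (derive_zero_constant (fun a => bend e a + bend (- e) a)).
intros x; evar_last.
- apply (is_derive_plus (bend e) (bend (- e))); apply bend_derive.
- unfold plus, bend_rate; simpl; rewrite cosh_eta_opp; ring.
Qed.

Lemma bend_odd e a : bend e (- a) = - bend e a.
Proof.
apply Rplus_opp_r_uniq.
transitivity (bend e 0 + bend e (- 0)).
- apply (derive_zero_constant (fun a => bend e a + bend e (- a))).
  intros x; evar_last.
  + apply (is_derive_plus (bend e) (fun a => bend e (- a))); [apply bend_derive|].
    apply (is_derive_comp (bend e) (fun a => - a));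
      [apply bend_derive | auto_derive; auto].
  + unfold plus, scal, bend_rate, cosh_eta, sinh_eta; simpl; unfold mult; simpl.
    rewrite cos_neg, sin_neg; replace (- sin x * - sin x) with (sin x * sin x) by ring.
    ring.
- rewrite Ropp_0; unfold bend; rewrite primitive_0; ring.
Qed.

Lemma bend_right_angle e : 0 < e < 1 / 4 -> 0 < bend e (PI / 2) < PI / 2.
Proof.
intros He; assert (HPI := PI_RGT_0); assert (H2 := PI2_1).
split.
- destruct (derive_mean_value (bend e) _ 0 1 (bend_derive e)) as [c [Hc E1]].
  destruct (derive_mean_value (bend e) _ 1 (PI / 2) (bend_derive e)) as [d [_ E2]].
  rewrite Rmin_left, Rmax_right in Hc by lra.
  assert (Z : bend e 0 = 0) by apply primitive_0.
  assert (Pc : 0 < bend_rate e c).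
  { assert (0 < cos c) by (apply cos_gt_0; lra).
    apply Rmult_lt_0_compat; [|apply Rinv_0_lt_compat;
      assert (Hch := cosh_eta_ge1 e c); lra].
    repeat apply Rmult_lt_0_compat; lra. }
  assert (Pd : 0 <= bend_rate e d).
  { apply Rmult_le_pos; [nra | apply Rlt_le, Rinv_0_lt_compat];
      assert (Hch := cosh_eta_ge1 e d); lra. }
  assert (0 <= bend_rate e d * (PI / 2 - 1)) by (apply Rmult_le_pos; lra).
  lra.
- assert (H := bend_bound e (PI / 2)).
  rewrite (Rabs_pos_eq e), (Rabs_pos_eq (PI / 2)) in H by lra.
  assert (H3 := Rle_abs (bend e (PI / 2))); nra.
Qed.

Lemma modulus_near_1 e a : Rabs e <= 1 / 100 ->
  Rabs (modulus e a - 1) <= 2 * Rabs e /\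
  Rabs (modulus e a * modulus e a - 1) <= 2 * Rabs e.
Proof.
intros He; assert (P := Rabs_pos e).
assert (Hs : Rabs (sinh_eta e a) <= Rabs e).
{ unfold sinh_eta; rewrite Rabs_mult.
  rewrite <- (Rmult_1_r (Rabs e)) at 2; apply Rmult_le_compat_l; [easy|].
  assert (H := SIN_bound a); apply Rabs_le; nra. }
assert (Hc := cosh_eta_sqr e a); assert (Hc1 := cosh_eta_ge1 e a).
assert (Hq : Rabs (modulus e a * modulus e a - 1) <= 2 * Rabs e).
{ rewrite modulus_sqr.
    assert (S1 := Rle_abs (sinh_eta e a)); assert (S2 := Rle_abs (- sinh_eta e a)).
  rewrite Rabs_Ropp in S2.
  assert (cosh_eta e a <= 1 + Rabs e) by nra.
  apply Rabs_le; lra. }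
split; [|easy].
assert (Hm := modulus_pos e a).
apply Rle_trans with (2 := Hq).
replace (modulus e a * modulus e a - 1)
  with ((modulus e a - 1) * (modulus e a + 1)) by ring.
rewrite Rabs_mult, (Rabs_pos_eq (modulus e a + 1)) by lra.
assert (H := Rabs_pos (modulus e a - 1)); nra.
Qed.

(** A closed curve whose tangent direction is [exp (i * angle)], with
[angle = 2 atan (sqrt 2 * sin)], is obtained by integrating the square of
[1 + i * sqrt 2 * sin], whose mean is zero. *)
Definition wave (x : R) : R := sin (2 * PI * x).
Definition angle (x : R) : R := 2 * atan (sqrt 2 * wave x).
Definition base_speed (x : R) : R := 1 + 2 * (wave x * wave x).
Definition wave2 (x : R) : R := 1 - 2 * (wave x * wave x).
Definition angle_rate (x : R) : R :=
  2 * (sqrt 2 * (2 * PI * cos (2 * PI * x))) * / base_speed x.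

Lemma wave_period x : wave (x + 1) = wave x.
Proof.
unfold wave; replace (2 * PI * (x + 1)) with (2 * PI * x + 2 * INR 1 * PI)
  by (simpl; ring).
apply sin_period.
Qed.

Lemma wave_odd x : wave (- x) = - wave x.
Proof.
unfold wave; replace (2 * PI * - x) with (- (2 * PI * x)) by ring; apply sin_neg.
Qed.

Lemma wave_derive x : is_derive wave x (2 * PI * cos (2 * PI * x)).
Proof. unfold wave; auto_derive; auto; ring. Qed.

Lemma wave_smooth : smooth1 wave.
Proof.
apply smooth1_sin, (smooth1_mult (fun _ => 2 * PI)); constructor.
Qed.

Lemma wave_bound x : -1 <= wave x <= 1.
Proof. apply SIN_bound. Qed.

Lemma base_speed_bound x : 1 <= base_speed x <= 3.
Proof. unfold base_speed; assert (H := wave_bound x); nra. Qed.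

Lemma base_speed_smooth : smooth1 base_speed.
Proof.
assert (S := wave_smooth).
apply smooth1_plus; [constructor|].
apply (smooth1_mult (fun _ => 2)); [constructor | now apply smooth1_mult].
Qed.

Lemma wave2_bound x : -1 <= wave2 x <= 1.
Proof. unfold wave2; assert (H := wave_bound x); nra. Qed.

Lemma wave2_smooth : smooth1 wave2.
Proof.
assert (S := wave_smooth).
apply (smooth1_plus (fun _ => 1) (fun x => - (2 * (wave x * wave x))));
  [constructor|].
apply smooth1_opp, (smooth1_mult (fun _ => 2)); [constructor|].
now apply smooth1_mult.
Qed.

Lemma sqrt2_sqr : sqrt 2 * sqrt 2 = 2.
Proof. apply sqrt_sqrt; lra. Qed.

Lemma angle_derive x : is_derive angle x (angle_rate x).
Proof.
assert (Hb := base_speed_bound x).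
assert (E : 1 + (sqrt 2 * wave x) ^ 2 = base_speed x).
{ unfold base_speed; replace ((sqrt 2 * wave x) ^ 2) with
    (sqrt 2 * sqrt 2 * (wave x * wave x)) by ring; rewrite sqrt2_sqr; ring. }
evar_last.
- apply is_derive_scal.
  apply (is_derive_comp atan (fun x => sqrt 2 * wave x));
    [apply is_derive_atan | apply is_derive_scal, wave_derive].
- unfold angle_rate, scal; simpl; unfold mult; simpl; unfold Rsqr.
  rewrite <- E; field; rewrite E; lra.
Qed.

Lemma angle_smooth : smooth1 angle.
Proof.
apply (smooth1_mult (fun _ => 2)); [constructor|].
apply smooth1_atan, (smooth1_mult (fun _ => sqrt 2));
  [constructor | apply wave_smooth].
Qed.

Lemma angle_rate_smooth : smooth1 angle_rate.
Proof.
apply smooth1_mult.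
- apply (smooth1_mult (fun _ => 2)); [constructor|].
  apply (smooth1_mult (fun _ => sqrt 2)); [constructor|].
  apply (smooth1_mult (fun _ => 2 * PI)); [constructor|].
  apply smooth1_cos, (smooth1_mult (fun _ => 2 * PI)); constructor.
- apply (smooth1_inv base_speed); [apply base_speed_smooth|].
  intros x; assert (H := base_speed_bound x); lra.
Qed.

Lemma angle_period x : angle (x + 1) = angle x.
Proof. unfold angle; now rewrite wave_period. Qed.

Lemma angle_odd x : angle (- x) = - angle x.
Proof.
unfold angle; rewrite wave_odd, Ropp_mult_distr_r_reverse, atan_opp; ring.
Qed.

Lemma angle_bound x : Rabs (angle x) <= 4.
Proof.
assert (H := atan_bound (sqrt 2 * wave x)); assert (H4 := PI_4).
unfold angle; apply Rabs_le; lra.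
Qed.

Lemma angle_sin_cos x :
  sin (angle x) = 2 * sqrt 2 * wave x / base_speed x /\
  cos (angle x) = wave2 x / base_speed x.
Proof.
unfold angle; rewrite sin_2a, cos_2a, cos_atan, sin_atan.
set (y := sqrt 2 * wave x).
assert (E : 1 + y² = base_speed x).
{ unfold y, base_speed, Rsqr; replace (sqrt 2 * wave x * (sqrt 2 * wave x)) with
    (sqrt 2 * sqrt 2 * (wave x * wave x)) by ring; rewrite sqrt2_sqr; ring. }
rewrite E; assert (Hb := base_speed_bound x).
assert (Hs : sqrt (base_speed x) * sqrt (base_speed x) = base_speed x)
  by (apply sqrt_sqrt; lra).
assert (Hp : 0 < sqrt (base_speed x)) by (apply sqrt_lt_R0; lra).
split.
- rewrite <- Hs at 3; unfold y; field; lra.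
- rewrite <- Hs at 5.
  replace (wave2 x) with (1 - y * y).
  + field; lra.
  + unfold wave2; rewrite <- E in *; unfold Rsqr, base_speed in *; lra.
Qed.

Lemma angle_rate_bound x : Rabs (angle_rate x) <= 24.
Proof.
assert (Hb := base_speed_bound x); assert (H4 := PI_4); assert (HP := PI_RGT_0).
assert (Hc := COS_bound (2 * PI * x)); assert (Hs := sqrt2_sqr).
assert (Hs1 : 0 < sqrt 2) by (apply sqrt_lt_R0; lra).
assert (Hs2 : sqrt 2 <= 3 / 2) by nra.
unfold angle_rate; rewrite !Rabs_mult, (Rabs_pos_eq 2), (Rabs_pos_eq (sqrt 2)),
  (Rabs_pos_eq PI), (Rabs_pos_eq (/ _)) by
  (try apply Rlt_le; try apply Rinv_0_lt_compat; lra).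
assert (Hi : / base_speed x <= 1)
  by (rewrite <- Rinv_1; apply Rinv_le_contravar; lra).
assert (Hi0 : 0 < / base_speed x) by (apply Rinv_0_lt_compat; lra).
assert (Hca : Rabs (cos (2 * PI * x)) <= 1) by (apply Rabs_le; lra).
assert (Hc0 := Rabs_pos (cos (2 * PI * x))).
assert (T1 : 2 * PI * Rabs (cos (2 * PI * x)) <= 8 * 1)
  by (apply Rmult_le_compat; lra).
assert (T2 : sqrt 2 * (2 * PI * Rabs (cos (2 * PI * x))) <= 3 / 2 * 8).
{ apply Rmult_le_compat; try lra; apply Rmult_le_pos; lra. }
apply Rle_trans with (24 * 1); [|lra].
apply Rmult_le_compat; try lra.
apply Rmult_le_pos; [lra|]; apply Rmult_le_pos; [lra|].
apply Rmult_le_pos; lra.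
Qed.

Definition direction (e x : R) : R := angle x + bend e (angle x).

Lemma direction_smooth e : smooth1 (direction e).
Proof.
apply smooth1_plus; [apply angle_smooth|].
apply (smooth1_comp (bend e)); [apply bend_smooth | apply angle_smooth].
Qed.

Lemma direction_derive e x :
  is_derive (direction e) x ((1 + bend_rate e (angle x)) * angle_rate x).
Proof.
evar_last.
- apply (is_derive_plus angle (fun x => bend e (angle x))); [apply angle_derive|].
  apply (is_derive_comp (bend e) angle); [apply bend_derive | apply angle_derive].
- unfold plus, scal; simpl; unfold mult; simpl; ring.
Qed.

Lemma direction_period e x : direction e (x + 1) = direction e x.
Proof. unfold direction; now rewrite angle_period. Qed.

Lemma direction_odd e x : direction e (- x) = - direction e x.
Proof. unfold direction; rewrite angle_odd, bend_odd; ring. Qed.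

Lemma bend_angle_bound e x : Rabs (bend e (angle x)) <= 8 * Rabs e.
Proof.
apply Rle_trans with (1 := bend_bound e (angle x)).
assert (H := angle_bound x); assert (P := Rabs_pos e); nra.
Qed.

(** The factor [1 + closing e * wave2] corrects the speed so that the curve still
closes up for [e <> 0]. *)
Definition closing (e : R) : R :=
  - primitive (fun x => base_speed x * cos (direction e x)) 1 /
    primitive (fun x => base_speed x * cos (direction e x) * wave2 x) 1.
Definition speed_of (e x : R) : R := base_speed x * (1 + closing e * wave2 x).

Lemma cos_direction_smooth e : smooth1 (fun x => cos (direction e x)).
Proof. apply smooth1_cos, direction_smooth. Qed.

Lemma speed_of_smooth e : smooth1 (speed_of e).
Proof.
apply smooth1_mult; [apply base_speed_smooth|].
apply (smooth1_plus (fun _ => 1)); [constructor|].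
apply (smooth1_mult (fun _ => closing e)); [constructor | apply wave2_smooth].
Qed.

Lemma wave2_primitive x :
  primitive wave2 x = sin (4 * PI * x) / (4 * PI).
Proof.
assert (HP := PI_RGT_0).
assert (E : primitive wave2 x - sin (4 * PI * x) / (4 * PI) =
  primitive wave2 0 - sin (4 * PI * 0) / (4 * PI)).
{ apply (derive_zero_constant
    (fun x => primitive wave2 x - sin (4 * PI * x) / (4 * PI))).
  intros z; evar_last.
  - apply (is_derive_minus (primitive wave2)
      (fun x => sin (4 * PI * x) / (4 * PI)) z (wave2 z) (cos (4 * PI * z)));
      [apply primitive_derive, wave2_smooth | auto_derive; auto; field; lra].
  - unfold minus, plus, opp, wave2, wave; simpl.
    replace (4 * PI * z) with (2 * (2 * PI * z)) by ring.
    rewrite cos_2a_sin; ring. }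
rewrite primitive_0, Rmult_0_r, sin_0 in E; lra.
Qed.

Lemma wave2_mean : primitive wave2 1 = 0.
Proof.
rewrite wave2_primitive.
replace (4 * PI * 1) with (0 + 2 * INR 2 * PI) by (simpl; ring).
rewrite sin_period, sin_0; unfold Rdiv; ring.
Qed.

Lemma wave2_sqr_mean : primitive (fun x => wave2 x * wave2 x) 1 = 1 / 2.
Proof.
assert (HP := PI_RGT_0).
assert (S : smooth1 (fun x => wave2 x * wave2 x))
  by (apply smooth1_mult; apply wave2_smooth).
set (F := fun x => primitive (fun x => wave2 x * wave2 x) x
  - (x / 2 + sin (8 * PI * x) / (16 * PI))).
assert (E : F 1 = F 0).
{ apply derive_zero_constant; intros z; evar_last.
  - apply (is_derive_minus (primitive (fun x => wave2 x * wave2 x))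
      (fun x => x / 2 + sin (8 * PI * x) / (16 * PI)) z
      (wave2 z * wave2 z) (1 / 2 + cos (8 * PI * z) / 2));
      [now apply (primitive_derive (fun x => wave2 x * wave2 x)) |
       auto_derive; auto; field; lra].
  - unfold minus, plus, opp; simpl.
    assert (E2 : wave2 z = cos (4 * PI * z)).
    { unfold wave2, wave; replace (4 * PI * z) with (2 * (2 * PI * z)) by ring.
      rewrite cos_2a_sin; ring. }
    rewrite E2; replace (8 * PI * z) with (2 * (4 * PI * z)) by ring.
    rewrite cos_2a_cos; field. }
unfold F in E; rewrite primitive_0 in E.
replace (8 * PI * 1) with (0 + 2 * INR 4 * PI) in E by (simpl; ring).
rewrite sin_period, Rmult_0_r, sin_0 in E.
unfold Rdiv in *; rewrite !Rmult_0_l in E; lra.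
Qed.

Lemma primitive_close g h M : smooth1 g -> smooth1 h ->
  (forall x, Rabs (g x - h x) <= M) -> 
  forall x, Rabs (primitive g x - primitive h x) <= M * Rabs x.
Proof.
intros Sg Sh HM x.
assert (H := derive_lipschitz (fun x => primitive g x - primitive h x)
  (fun x => g x - h x) M 0 x).
cbv beta in H; rewrite !primitive_0, !Rminus_0_r in H; apply H; [|easy].
intros z; apply (is_derive_minus (primitive g) (primitive h));
  now apply primitive_derive.
Qed.

Lemma base_cos_direction_close e x :
  Rabs (base_speed x * cos (direction e x) - wave2 x) <= 24 * Rabs e.
Proof.
assert (Hb := base_speed_bound x).
replace (base_speed x * cos (direction e x) - wave2 x) with
  (base_speed x * (cos (direction e x) - cos (angle x))).
- assert (H := cos_lipschitz (angle x) (direction e x)).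
  unfold direction in H at 2.
  replace (angle x + bend e (angle x) - angle x) with (bend e (angle x)) in H by ring.
  assert (H' := bend_angle_bound e x).
  rewrite Rabs_mult, (Rabs_pos_eq (base_speed x)) by lra.
  assert (P := Rabs_pos (cos (direction e x) - cos (angle x))); nra.
- destruct (angle_sin_cos x) as [_ ->]; field; lra.
Qed.

Lemma closing_bound e : Rabs e <= 1 / 1000 ->
  primitive (fun x => base_speed x * cos (direction e x) * wave2 x) 1 <> 0 /\
  Rabs (closing e) <= 1 / 2.
Proof.
intros He; assert (P := Rabs_pos e).
assert (S1 : smooth1 (fun x => base_speed x * cos (direction e x))).
{ apply smooth1_mult; [apply base_speed_smooth | apply cos_direction_smooth]. }
assert (S2 : smooth1 (fun x => base_speed x * cos (direction e x) * wave2 x)).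
{ apply smooth1_mult; [easy | apply wave2_smooth]. }
assert (B1 := primitive_close _ _ _ S1 wave2_smooth (base_cos_direction_close e) 1).
rewrite wave2_mean, Rminus_0_r, Rabs_R1, Rmult_1_r in B1.
assert (B2 : Rabs (primitive (fun x => base_speed x * cos (direction e x) * wave2 x) 1
  - primitive (fun x => wave2 x * wave2 x) 1) <= 24 * Rabs e * Rabs 1).
{ apply primitive_close; auto using smooth1_mult, wave2_smooth.
  intros x; rewrite <- Rmult_minus_distr_r, Rabs_mult.
  rewrite <- (Rmult_1_r (24 * Rabs e)); apply Rmult_le_compat;
    auto using Rabs_pos, base_cos_direction_close.
  apply Rabs_le, wave2_bound. }
rewrite wave2_sqr_mean, Rabs_R1, Rmult_1_r in B2.
unfold closing; set (n := primitive _ 1) in *.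
set (d := primitive (fun x => base_speed x * cos (direction e x) * wave2 x) 1) in *.
assert (Hd : 9 / 20 <= d).
{ assert (H := Rle_abs (- (d - 1 / 2))); rewrite Rabs_Ropp in H; lra. }
split; [lra|].
unfold Rdiv; rewrite Rabs_mult, Rabs_Ropp, (Rabs_pos_eq (/ d))
  by (apply Rlt_le, Rinv_0_lt_compat; lra).
apply (Rmult_le_reg_r d); [lra|].
rewrite Rmult_assoc, Rinv_l by lra; lra.
Qed.

Lemma speed_of_bound e x : Rabs e <= 1 / 1000 -> 1 / 2 <= speed_of e x <= 9 / 2.
Proof.
intros He; destruct (closing_bound e He) as [_ Hc].
assert (Hb := base_speed_bound x); assert (Hw := wave2_bound x).
assert (H : Rabs (closing e * wave2 x) <= 1 / 2).
{ rewrite Rabs_mult; replace (1 / 2) with (1 / 2 * 1) by ring.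
  apply Rmult_le_compat; auto using Rabs_pos; now apply Rabs_le. }
assert (H1 := Rle_abs (closing e * wave2 x)).
assert (H2 := Rle_abs (- (closing e * wave2 x))); rewrite Rabs_Ropp in H2.
unfold speed_of; nra.
Qed.

Lemma speed_of_period e x : speed_of e (x + 1) = speed_of e x.
Proof. unfold speed_of, base_speed, wave2; now rewrite wave_period. Qed.

Lemma speed_of_even e x : speed_of e (- x) = speed_of e x.
Proof.
unfold speed_of, base_speed, wave2; rewrite wave_odd.
now replace (- wave x * - wave x) with (wave x * wave x) by ring.
Qed.

Lemma curve_closes e : Rabs e <= 1 / 1000 ->
  primitive (fun x => speed_of e x * cos (direction e x)) 1 = 0.
Proof.
intros He; destruct (closing_bound e He) as [Hn _].
assert (S1 : smooth1 (fun x => base_speed x * cos (direction e x))).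
{ apply smooth1_mult; [apply base_speed_smooth | apply cos_direction_smooth]. }
assert (S2 : smooth1 (fun x => base_speed x * cos (direction e x) * wave2 x)).
{ apply smooth1_mult; [easy | apply wave2_smooth]. }
assert (S3 : smooth1 (fun x => speed_of e x * cos (direction e x))).
{ apply smooth1_mult; [apply speed_of_smooth | apply cos_direction_smooth]. }
set (F := fun x => primitive (fun x => speed_of e x * cos (direction e x)) x
  - (primitive (fun x => base_speed x * cos (direction e x)) x + closing e *
     primitive (fun x => base_speed x * cos (direction e x) * wave2 x) x)).
assert (E : F 1 = F 0).
{ apply derive_zero_constant; intros z; evar_last.
  - apply (is_derive_minus
      (primitive (fun x => speed_of e x * cos (direction e x)))
      (fun x => primitive (fun x => base_speed x * cos (direction e x)) x
        + closing e *
        primitive (fun x => base_speed x * cos (direction e x) * wave2 x) x));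
      [now apply primitive_derive|].
    apply (is_derive_plus
      (primitive (fun x => base_speed x * cos (direction e x)))
      (fun x => closing e *
        primitive (fun x => base_speed x * cos (direction e x) * wave2 x) x));
      [|apply is_derive_scal]; now apply primitive_derive.
  - unfold minus, plus, opp, speed_of; simpl; ring. }
unfold F in E; rewrite !primitive_0 in E.
unfold closing in E at 1; unfold Rdiv in E.
rewrite Rmult_assoc, Rinv_l in E by easy; lra.
Qed.

Definition figure (e L : R) : profile := {|
  cx := fun x => L * primitive (fun x => speed_of e x * cos (direction e x)) x;
  cy := fun x => L * primitive (fun x => speed_of e x * sin (direction e x)) x;
  height := fun x => L * primitive (fun x =>
    speed_of e x * (modulus e (angle x) * sin (angle x))) x;
  gx := fun x => - (modulus e (angle x) * sin (bend e (angle x)));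
  gy := fun x => modulus e (angle x) * cos (bend e (angle x));
  tx := fun x => cos (direction e x);
  ty := fun x => sin (direction e x);
  speed := fun x => L * speed_of e x;
  rate := fun x => -2 * e * cos (angle x) * modulus e (angle x) *
    / cosh_eta e (angle x) * angle_rate x;
  turn := fun x => (1 + bend_rate e (angle x)) * angle_rate x |}.

Lemma figure_tangential e L x :
  tangential (figure e L) x = modulus e (angle x) * sin (angle x).
Proof.
unfold tangential; simpl; unfold direction; rewrite sin_plus, cos_plus.
set (a := angle x); set (b := bend e a); set (m := modulus e a).
transitivity (m * sin a * ((sin b)² + (cos b)²)); [unfold Rsqr; ring|].
rewrite sin2_cos2; ring.
Qed.

Lemma figure_normal e L x :
  normal (figure e L) x = modulus e (angle x) * cos (angle x).
Proof.
unfold normal; simpl; unfold direction; rewrite sin_plus, cos_plus.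
set (a := angle x); set (b := bend e a); set (m := modulus e a).
transitivity (m * cos a * ((sin b)² + (cos b)²)); [unfold Rsqr; ring|].
rewrite sin2_cos2; ring.
Qed.

Lemma height_rate_smooth e :
  smooth1 (fun x => speed_of e x * (modulus e (angle x) * sin (angle x))).
Proof.
apply smooth1_mult; [apply speed_of_smooth|].
apply (smooth1_mult (fun x => modulus e (angle x))).
- apply (smooth1_comp (modulus e)); [apply modulus_smooth | apply angle_smooth].
- apply smooth1_sin, angle_smooth.
Qed.

Lemma cx_rate_smooth e : smooth1 (fun x => speed_of e x * cos (direction e x)).
Proof.
apply smooth1_mult; [apply speed_of_smooth | apply cos_direction_smooth].
Qed.

Lemma cy_rate_smooth e : smooth1 (fun x => speed_of e x * sin (direction e x)).
Proof.
apply smooth1_mult; [apply speed_of_smooth|].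
apply smooth1_sin, direction_smooth.
Qed.

Lemma figure_axioms e L : profile_axioms (figure e L).
Proof.
assert (DM : forall x, is_derive (fun x => modulus e (angle x)) x
  (angle_rate x * - (2 * e * sin (angle x) * cos (angle x)
     * modulus e (angle x) * / cosh_eta e (angle x)))).
{ intros x; apply (is_derive_comp (modulus e) angle);
    [apply modulus_derive | apply angle_derive]. }
assert (DB : forall x, is_derive (fun x => bend e (angle x)) x
  (angle_rate x * bend_rate e (angle x))).
{ intros x; apply (is_derive_comp (bend e) angle);
    [apply bend_derive | apply angle_derive]. }
split.
- intros x; simpl; rewrite Rmult_assoc.
  apply is_derive_scal, (primitive_derive _ (cx_rate_smooth e)).
- intros x; simpl; rewrite Rmult_assoc.
  apply is_derive_scal, (primitive_derive _ (cy_rate_smooth e)).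
- intros x; rewrite figure_tangential; simpl; rewrite Rmult_assoc.
  apply is_derive_scal, (primitive_derive _ (height_rate_smooth e)).
- intros x; simpl; evar_last.
  + apply (is_derive_opp (fun x => modulus e (angle x) * sin (bend e (angle x)))).
    apply (Derive.is_derive_mult (fun x => modulus e (angle x))
      (fun x => sin (bend e (angle x)))); [apply DM|].
    apply (is_derive_comp sin (fun x => bend e (angle x)));
      [apply is_derive_sin | apply DB].
  + unfold opp, scal; simpl; unfold mult; simpl; unfold direction, bend_rate.
    rewrite cos_plus; ring.
- intros x; simpl; evar_last.
  + apply (Derive.is_derive_mult (fun x => modulus e (angle x))
      (fun x => cos (bend e (angle x)))); [apply DM|].
    apply (is_derive_comp cos (fun x => bend e (angle x)));
      [apply is_derive_cos | apply DB].
  + unfold scal; simpl; unfold mult; simpl; unfold direction, bend_rate.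
    rewrite sin_plus; ring.
- intros x; simpl; evar_last.
  + apply (is_derive_comp cos (direction e));
      [apply is_derive_cos | apply direction_derive].
  + unfold scal; simpl; unfold mult; simpl; ring.
- intros x; simpl; apply (is_derive_comp sin (direction e));
    [apply is_derive_sin | apply direction_derive].
- intros x; simpl; rewrite Rplus_comm; apply sin2_cos2.
- intros x; simpl; assert (H := modulus_pos e (angle x)).
  assert (E := sin2_cos2 (bend e (angle x))); unfold Rsqr in E.
  set (m := modulus e (angle x)) in *.
  replace (_ + _) with (m * m * (sin (bend e (angle x)) * sin (bend e (angle x))
    + cos (bend e (angle x)) * cos (bend e (angle x)))) by ring.
  rewrite E; nra.
- apply cos_direction_smooth.
- apply smooth1_sin, direction_smooth.
- apply (smooth1_mult (fun _ => L)); [constructor | apply speed_of_smooth].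
- apply (smooth1_mult (fun x => -2 * e * cos (angle x) * modulus e (angle x)
    * / cosh_eta e (angle x))); [|apply angle_rate_smooth].
  apply (smooth1_comp (fun a => -2 * e * cos a * modulus e a * / cosh_eta e a));
    [|apply angle_smooth].
  apply (smooth1_mult (fun a => -2 * e * cos a * modulus e a));
    [|apply inv_cosh_smooth].
  apply (smooth1_mult (fun a => -2 * e * cos a)); [|apply modulus_smooth].
  apply (smooth1_mult (fun a => -2 * e)); repeat constructor.
Qed.

Lemma figure_period e L : Rabs e <= 1 / 1000 -> forall x,
  cx (figure e L) (x + 1) = cx (figure e L) x /\
  cy (figure e L) (x + 1) = cy (figure e L) x /\
  height (figure e L) (x + 1) = height (figure e L) x /\
  gx (figure e L) (x + 1) = gx (figure e L) x /\
  gy (figure e L) (x + 1) = gy (figure e L) x.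
Proof.
intros He x; simpl; rewrite !angle_period; repeat split; f_equal.
- apply primitive_periodic; [apply cx_rate_smooth | |now apply curve_closes].
  intros y; now rewrite speed_of_period, direction_period.
- apply primitive_periodic_odd; [apply cy_rate_smooth | |]; intros y.
  + now rewrite speed_of_period, direction_period.
  + rewrite speed_of_even, direction_odd, sin_neg; ring.
- apply primitive_periodic_odd; [apply height_rate_smooth | |]; intros y.
  + now rewrite speed_of_period, angle_period.
  + rewrite speed_of_even, angle_odd, sin_neg.
    replace (modulus e (- angle y)) with (modulus e (angle y)); [ring|].
    unfold modulus, cosh_eta, sinh_eta; rewrite sin_neg.
    now replace (- sin (angle y) * - sin (angle y))
      with (sin (angle y) * sin (angle y)) by ring.
Qed.

(** After division by the common factors, the flatness equation is the difference
of the identities [cosh^2 = 1 + sinh^2] for the two profiles; the opposite signs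
of their parameters make the terms linear in [e] cancel. *)
Lemma figure_flatness e L x y :
  let p := figure e 1 in let q := figure (- e) L in
  norm2 p q x y *
     (rate p x * (rate q y + turn q y * normal q y) +
      rate q y * (rate p x + turn p x * normal p x)) =
     2 * rate p x * rate q y * (tangential p x ^ 2 + tangential q y ^ 2).
Proof.
intros p q.
assert (EN : norm2 p q x y = modulus e (angle x) * modulus e (angle x)
  + modulus (- e) (angle y) * modulus (- e) (angle y)).
{ unfold norm2, dot, field, x1, x2, x3, x4, p, q; simpl.
  set (m := modulus e (angle x)); set (n := modulus (- e) (angle y)).
  transitivity (m * m * ((sin (bend e (angle x)))² + (cos (bend e (angle x)))²)
    + n * n * ((sin (bend (- e) (angle y)))² + (cos (bend (- e) (angle y)))²));
    [unfold Rsqr; ring | rewrite !sin2_cos2; ring]. }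
unfold p, q in *; rewrite EN, !figure_tangential, !figure_normal; simpl.
unfold bend_rate.
set (a := angle x); set (b := angle y).
assert (M1 := modulus_sqr e a); assert (M2 := modulus_sqr (- e) b).
assert (C1 := cosh_eta_sqr e a); assert (C2 := cosh_eta_sqr (- e) b).
assert (P1 := cosh_eta_ge1 e a); assert (P2 := cosh_eta_ge1 (- e) b).
assert (T1 := sin2_cos2 a); assert (T2 := sin2_cos2 b); unfold Rsqr in T1, T2.
set (m := modulus e a) in *; set (n := modulus (- e) b) in *.
set (c := cosh_eta e a) in *; set (d := cosh_eta (- e) b) in *.
set (s := sinh_eta e a) in *; set (t := sinh_eta (- e) b) in *.
assert (S1 : 2 * e * (sin a * sin a) = e - s) by (unfold s, sinh_eta; ring).
assert (S2 : 2 * e * (sin b * sin b) = e + t) by (unfold t, sinh_eta; ring).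
assert (K1 : 2 * e * (cos a * cos a) = e + s).
{ replace (cos a * cos a) with (1 - sin a * sin a) by lra; lra. }
assert (K2 : 2 * - e * (cos b * cos b) = t - e).
{ replace (cos b * cos b) with (1 - sin b * sin b) by lra; lra. }
rewrite K1, K2.
replace (m * sin a * (m * sin a * 1) + n * sin b * (n * sin b * 1)) with
  (m * m * (sin a * sin a) + n * n * (sin b * sin b)) by ring.
rewrite M1, M2.
assert (Main : (s + c + (t + d)) * (d + t - c - s + 2 * e) =
  2 * ((s + c) * (e - s) + (t + d) * (e + t))).
{ apply Rminus_diag_uniq.
  transitivity ((d * d - 1 - t * t) - (c * c - 1 - s * s)); [ring|].
  rewrite C1, C2; ring. }
set (U := angle_rate x); set (V := angle_rate y).
transitivity (-2 * e * cos a * m * / c * U * (cos b * n * / d * V)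
  * ((s + c + (t + d)) * (d + t - c - s + 2 * e))); [field; lra|].
rewrite Main, <- S1, <- S2; field; lra.
Qed.

Lemma Rabs_le_bounds a M : Rabs a <= M -> - M <= a <= M.
Proof.
intros H; assert (H1 := Rle_abs a); assert (H2 := Rle_abs (- a)).
rewrite Rabs_Ropp in H2; lra.
Qed.

Lemma Rabs_mult_le a b A B : Rabs a <= A -> Rabs b <= B -> Rabs (a * b) <= A * B.
Proof. intros; rewrite Rabs_mult; apply Rmult_le_compat; auto using Rabs_pos. Qed.

Lemma Rabs_sin a : Rabs (sin a) <= 1.
Proof. apply Rabs_le, SIN_bound. Qed.

Lemma Rabs_cos a : Rabs (cos a) <= 1.
Proof. apply Rabs_le, COS_bound. Qed.

Lemma sin_direction_close e x :
  Rabs (sin (direction e x) - sin (angle x)) <= 8 * Rabs e.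
Proof.
apply Rle_trans with (2 := bend_angle_bound e x).
replace (bend e (angle x)) with (direction e x - angle x)
  by (unfold direction; ring).
apply sin_lipschitz.
Qed.

Lemma periodic_primitive_bound g M L : smooth1 g -> 0 <= L ->
  (forall x, L * primitive g (x + 1) = L * primitive g x) ->
  (forall x, Rabs (g x) <= M) -> forall x, Rabs (L * primitive g x) <= M * L.
Proof.
intros Sg HL Hp HM; apply periodic_bound; [exact Hp|]; intros x Hx.
assert (M0 : 0 <= M) by (apply Rle_trans with (2 := HM 0), Rabs_pos).
rewrite (Rmult_comm M); apply Rabs_mult_le; [rewrite Rabs_pos_eq; lra|].
apply Rle_trans with (1 := primitive_bound g M x Sg HM).
rewrite Rabs_pos_eq by lra; nra.
Qed.

Lemma figure_bounds e L : Rabs e <= 1 / 1000 -> 0 <= L -> forall x,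
  Rabs (cx (figure e L) x) <= 9 / 2 * L /\
  Rabs (cy (figure e L) x) <= 9 / 2 * L /\
  Rabs (height (figure e L) x) <= 9 * L /\
  Rabs (cy (figure e L) x - height (figure e L) x) <= 45 * Rabs e * L /\
  Rabs (gx (figure e L) x) <= 16 * Rabs e /\
  Rabs (gy (figure e L) x - 1) <= 10 * Rabs e /\
  Rabs (rate (figure e L) x) <= 96 * Rabs e /\
  L / 2 <= speed (figure e L) x /\
  Rabs (gx (figure e L) x * gx (figure e L) x
        + gy (figure e L) x * gy (figure e L) x - 1) <= 2 * Rabs e.
Proof.
intros He HL.
assert (Per := figure_period e L He); simpl in Per |- *.
assert (P := Rabs_pos e).
assert (Hsp := fun x => speed_of_bound e x He).
assert (Hm : forall x, Rabs (modulus e (angle x) - 1) <= 2 * Rabs e /\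
  Rabs (modulus e (angle x) * modulus e (angle x) - 1) <= 2 * Rabs e)
  by (intros y; apply modulus_near_1; lra).
assert (Hm2 : forall x, Rabs (modulus e (angle x)) <= 2).
{ intros y; destruct (Hm y) as [H _]; apply Rabs_le_bounds in H.
  apply Rabs_le; lra. }
assert (Hsa : forall x, Rabs (speed_of e x) <= 9 / 2)
  by (intros y; specialize (Hsp y); apply Rabs_le; lra).
assert (Hcy : forall x, Rabs (speed_of e x * sin (direction e x)
    - speed_of e x * (modulus e (angle x) * sin (angle x))) <= 45 * Rabs e).
{ intros y.
  replace (_ - _) with (speed_of e y * ((sin (direction e y) - sin (angle y))
    + - ((modulus e (angle y) - 1) * sin (angle y)))) by ring.
  replace (45 * Rabs e) with (9 / 2 * (8 * Rabs e + 2 * Rabs e * 1)) by field.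
  apply Rabs_mult_le; [apply Hsa|].
  eapply Rle_trans; [apply Rabs_triang|]; rewrite Rabs_Ropp.
  apply Rplus_le_compat; [apply sin_direction_close|].
  apply Rabs_mult_le; [apply Hm | apply Rabs_sin]. }
intros x; repeat split.
- apply (periodic_primitive_bound _ _ L (cx_rate_smooth e)); auto.
  + intros y; apply Per.
  + intros y; replace (9 / 2) with (9 / 2 * 1) by ring.
    apply Rabs_mult_le; [apply Hsa | apply Rabs_cos].
- apply (periodic_primitive_bound _ _ L (cy_rate_smooth e)); auto.
  + intros y; apply Per.
  + intros y; replace (9 / 2) with (9 / 2 * 1) by ring.
    apply Rabs_mult_le; [apply Hsa | apply Rabs_sin].
- apply (periodic_primitive_bound _ _ L (height_rate_smooth e)); auto.
  + intros y; apply Per.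
  + intros y; replace 9 with (9 / 2 * (2 * 1)) by field.
    apply Rabs_mult_le; [apply Hsa|].
    apply Rabs_mult_le; [apply Hm2 | apply Rabs_sin].
- revert x; apply periodic_bound.
  + intros y; now destruct (Per y) as [_ [-> [-> _]]].
  + intros y Hy; rewrite <- Rmult_minus_distr_l, (Rmult_comm (45 * Rabs e)).
    apply Rabs_mult_le; [rewrite Rabs_pos_eq; lra|].
    eapply Rle_trans;
      [apply (primitive_close _ _ _ (cy_rate_smooth e) (height_rate_smooth e) Hcy)|].
    rewrite (Rabs_pos_eq y) by lra; nra.
- rewrite Rabs_Ropp; replace (16 * Rabs e) with (2 * (8 * Rabs e)) by ring.
  apply Rabs_mult_le; [apply Hm2|].
  rewrite <- (Rminus_0_r (sin _)), <- sin_0.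
  eapply Rle_trans; [apply sin_lipschitz|].
  rewrite Rminus_0_r; apply bend_angle_bound.
- replace (_ - 1) with ((modulus e (angle x) - 1) * cos (bend e (angle x))
    + (cos (bend e (angle x)) - cos 0)) by (rewrite cos_0; ring).
  eapply Rle_trans; [apply Rabs_triang|].
  replace (10 * Rabs e) with (2 * Rabs e * 1 + 8 * Rabs e) by ring.
  apply Rplus_le_compat.
  + apply Rabs_mult_le; [apply Hm | apply Rabs_cos].
  + eapply Rle_trans; [apply cos_lipschitz|].
    rewrite Rminus_0_r; apply bend_angle_bound.
- replace (96 * Rabs e) with (2 * Rabs e * 1 * 2 * 1 * 24) by ring.
  apply Rabs_mult_le; [|apply angle_rate_bound].
  repeat apply Rabs_mult_le; auto using Rabs_cos.
  + apply Rabs_le; lra.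
  + lra.
  + assert (Hc := cosh_eta_ge1 e (angle x)).
    rewrite Rabs_pos_eq by (apply Rlt_le, Rinv_0_lt_compat; lra).
    rewrite <- Rinv_1; apply Rinv_le_contravar; lra.
- specialize (Hsp x).
  apply Rle_trans with (L * (1 / 2)); [lra | apply Rmult_le_compat_l; lra].
- set (m := modulus e (angle x)); set (b := bend e (angle x)).
  replace (_ - 1) with (m * m * ((sin b)² + (cos b)²) - 1) by (unfold Rsqr; ring).
  rewrite sin2_cos2, Rmult_1_r; apply Hm.
Qed.

(** * The family of tori *)

(** The heights grow with [L], and so does the deviation caused by [e]; order
[1 / L] keeps both the Lame coefficients positive and the short directions
bounded. *)
Definition smallness (L : R) : R := / (10000 * (1 + L)).
Definition torus (L : R) : R -> R -> R4 :=
  ribaucour (figure (smallness L) 1) (figure (- smallness L) L).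

Lemma smallness_bounds L : 1 <= L ->
  0 < smallness L <= 1 / 20000 /\ smallness L * (1 + L) = 1 / 10000.
Proof.
intros HL; unfold smallness.
assert (0 < / (10000 * (1 + L))) by (apply Rinv_0_lt_compat; lra).
split; [split; [easy|]|field; lra].
replace (1 / 20000) with (/ 20000) by field; apply Rinv_le_contravar; lra.
Qed.

Lemma torus_estimates L : 1 <= L -> forall s t,
  let p := figure (smallness L) 1 in let q := figure (- smallness L) L in
  Rabs (norm2 p q s t - 2) <= 4 * smallness L /\ 1 <= norm2 p q s t /\
  Rabs (total_height p q s t) <= 9 * (1 + L).
Proof.
intros HL s t p q; destruct (smallness_bounds L HL) as [[E1 E2] _].
assert (A : Rabs (smallness L) = smallness L) by (apply Rabs_pos_eq; lra).
destruct (figure_bounds (smallness L) 1) with (x := s)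
  as [_ [_ [H1 [_ [_ [_ [_ [_ N1]]]]]]]]; [lra | lra |].
destruct (figure_bounds (- smallness L) L) with (x := t)
  as [_ [_ [H2 [_ [_ [_ [_ [_ N2]]]]]]]]; [rewrite Rabs_Ropp; lra | lra |].
rewrite Rabs_Ropp in N2; rewrite A in N1, N2.
assert (EN : norm2 p q s t = (gx p s * gx p s + gy p s * gy p s)
  + (gx q t * gx q t + gy q t * gy q t))
  by (unfold norm2, dot, field, x1, x2, x3, x4; cbn [fst snd]; ring).
fold p in H1, N1; fold q in H2, N2; rewrite EN.
apply Rabs_le_bounds in N1; apply Rabs_le_bounds in N2.
split; [apply Rabs_le; lra|]; split; [lra|].
unfold total_height; eapply Rle_trans; [apply Rabs_triang|]; lra.
Qed.

Lemma quotient_bound a n M : Rabs a <= M -> 1 <= n -> Rabs (a / n) <= M.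
Proof.
intros Ha Hn; unfold Rdiv; rewrite <- (Rmult_1_r M); apply Rabs_mult_le; [easy|].
rewrite Rabs_pos_eq by (apply Rlt_le, Rinv_0_lt_compat; lra).
rewrite <- Rinv_1; apply Rinv_le_contravar; lra.
Qed.

Lemma torus_lame L : 1 <= L -> forall s t,
  let p := figure (smallness L) 1 in let q := figure (- smallness L) L in
  0 < lame1 p q s t /\ 0 < lame2 p q s t.
Proof.
intros HL s t p q; destruct (smallness_bounds L HL) as [[E1 E2] E3].
assert (A : Rabs (smallness L) = smallness L) by (apply Rabs_pos_eq; lra).
destruct (torus_estimates L HL s t) as [_ [N1 H]]; fold p q in N1, H.
destruct (figure_bounds (smallness L) 1) with (x := s)
  as [_ [_ [_ [_ [_ [_ [R1 [S1 _]]]]]]]]; [lra | lra |].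
destruct (figure_bounds (- smallness L) L) with (x := t)
  as [_ [_ [_ [_ [_ [_ [R2 [S2 _]]]]]]]]; [rewrite Rabs_Ropp; lra | lra |].
rewrite Rabs_Ropp in R2; rewrite A in R1, R2.
fold p in R1, S1; fold q in R2, S2.
assert (B : forall r, Rabs r <= 96 * smallness L ->
  Rabs (2 * total_height p q s t * r / norm2 p q s t) <= 1728 / 10000).
{ intros r Hr; apply quotient_bound; [|easy].
  replace (1728 / 10000) with (2 * (9 * (1 + L)) * (96 * smallness L))
    by (transitivity (1728 * (smallness L * (1 + L))); [ring | rewrite E3; field]).
  repeat apply Rabs_mult_le; auto; apply Rabs_le; lra. }
assert (B1 := Rabs_le_bounds _ _ (B _ R1)).
assert (B2 := Rabs_le_bounds _ _ (B _ R2)).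
unfold lame1, lame2; lra.
Qed.

Lemma torus_periodic L : 1 <= L ->
  forall s t, torus L (s + 1) t = torus L s t /\ torus L s (t + 1) = torus L s t.
Proof.
intros HL s t; destruct (smallness_bounds L HL) as [[E1 E2] E3].
assert (He : Rabs (smallness L) <= 1 / 1000) by (rewrite Rabs_pos_eq; lra).
assert (He' : Rabs (- smallness L) <= 1 / 1000) by (rewrite Rabs_Ropp; lra).
unfold torus, ribaucour, deflect, product_map, total_height, field.
destruct (figure_period _ 1 He s) as [-> [-> [-> [-> ->]]]].
destruct (figure_period _ L He' t) as [-> [-> [-> [-> ->]]]]; easy.
Qed.

Lemma wave_eighth : wave (1 / 8) = / sqrt 2.
Proof.
unfold wave; replace (2 * PI * (1 / 8)) with (PI / 4) by field.
rewrite sin_PI4; field; assert (0 < sqrt 2) by (apply sqrt_lt_R0; lra); lra.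
Qed.

Lemma angle_eighth : angle (1 / 8) = PI / 2.
Proof.
assert (0 < sqrt 2) by (apply sqrt_lt_R0; lra).
unfold angle; rewrite wave_eighth, Rinv_r, atan_1 by lra; field.
Qed.

Lemma angle_0 : angle 0 = 0.
Proof. unfold angle, wave; rewrite !Rmult_0_r, sin_0, Rmult_0_r, atan_0; ring. Qed.

Lemma bend_0 e : bend e 0 = 0.
Proof. apply primitive_0. Qed.

Lemma modulus_right_angle e : modulus e (PI / 2) = / modulus e 0.
Proof.
rewrite <- modulus_opp; unfold modulus, cosh_eta, sinh_eta.
rewrite sin_PI2, sin_0.
replace (e * (1 - 2 * (1 * 1))) with (- e * (1 - 2 * (0 * 0))) by ring; easy.
Qed.

Lemma figure_special e L : 0 < e < 1 / 4 ->
  special_points (figure e 1) (figure (- e) L) 0 (1 / 8) 0 (1 / 8)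
    (modulus e 0) (sin (bend e (PI / 2))) (cos (bend e (PI / 2))).
Proof.
intros He; assert (HPI := PI_RGT_0).
assert (Hb := bend_right_angle e He).
assert (Hm := modulus_pos e 0).
assert (Mr := modulus_right_angle e).
assert (Mr' : modulus (- e) (PI / 2) = modulus e 0)
  by (rewrite modulus_opp, Mr; apply Rinv_inv).
assert (Br := bend_opp e (PI / 2)).
assert (C2 := cos_PI2); assert (S2 := sin_PI2).
split; cbn [tx ty gx gy figure]; unfold direction;
  rewrite ?angle_0, ?angle_eighth, ?bend_0, ?Rplus_0_r, ?sin_0, ?cos_0.
- exact Hm.
- assert (0 < sin (bend e (PI / 2))) by (apply sin_gt_0; lra); lra.
- assert (0 < cos (bend e (PI / 2))) by (apply cos_gt_0; lra); lra.
- apply sin2_cos2.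
- easy.
- easy.
- ring.
- ring.
- rewrite cos_plus, C2, S2; ring.
- rewrite sin_plus, C2, S2; ring.
- rewrite Mr; ring.
- rewrite Mr; ring.
- easy.
- easy.
- ring.
- rewrite modulus_opp; ring.
- rewrite Br, cos_plus, C2, S2, cos_neg, sin_neg; ring.
- rewrite Br, sin_plus, C2, S2, cos_neg, sin_neg; ring.
- rewrite Mr', Br, sin_neg; ring.
- rewrite Mr', Br, cos_neg; ring.
Qed.

Lemma torus_properties L : 1 <= L ->
  torus_map (torus L) /\ immersion (torus L) /\
  flat_induced_metric (torus L) /\ flat_normal_bundle (torus L) /\
  ~ product_of_curves (torus L) /\ ~ in_affine_3sphere (torus L).
Proof.
intros HL; unfold torus.
set (e := smallness L).
assert (Hp := figure_axioms e 1); assert (Hq := figure_axioms (- e) L).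
assert (H1 : forall s t, lame1 (figure e 1) (figure (- e) L) s t <> 0).
{ intros s t; destruct (torus_lame L HL s t) as [H _]; fold e in H; lra. }
assert (H2 : forall s t, lame2 (figure e 1) (figure (- e) L) s t <> 0).
{ intros s t; destruct (torus_lame L HL s t) as [_ H]; fold e in H; lra. }
assert (He : 0 < e < 1 / 4).
{ destruct (smallness_bounds L HL) as [[E1 E2] _]; fold e in E1, E2; lra. }
assert (Hs := figure_special e L He).
split; [|split; [|split; [|split; [|split]]]].
- split; [now apply ribaucour_smooth | now apply torus_periodic].
- exact (adapted_immersion _ _ _ _ _ _ _ (ribaucour_adapted _ _ Hp Hq H1 H2)).
- apply ribaucour_flat; auto; intros s t; apply figure_flatness.
- now apply ribaucour_flat_normal_bundle.
- exact (ribaucour_not_product _ _ _ _ _ _ _ _ _ Hp Hq H1 H2 Hs).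
- (* At a quarter of the period the tangent angle is extremal. *)
  assert (Z : angle_rate (1 / 4) = 0).
  { unfold angle_rate; replace (2 * PI * (1 / 4)) with (PI / 2) by field.
    rewrite cos_PI2; ring. }
  apply (ribaucour_not_in_sphere _ _ (1 / 4) Hp Hq H1); simpl; rewrite Z; ring.
Qed.

(** For long tori the field is nearly constant, equal to [(0, 1, 0, 1)], and the
transform is nearly the reflection exchanging [x2] and [- x4]; the second curve
of size [L] then fills the directions [x2] and [x3]. *)
Lemma torus_box L v : 1 <= L -> image (torus L) v ->
  Rabs (x1 v) <= 40 /\ Rabs (x2 v) <= 100 * L /\ Rabs (x3 v) <= 100 * L /\
  Rabs (x4 v) <= 40.
Proof.
intros HL [s [t ->]]; destruct (smallness_bounds L HL) as [[E1 E2] E3].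
assert (A : Rabs (smallness L) = smallness L) by (apply Rabs_pos_eq; lra).
destruct (torus_estimates L HL s t) as [N2 [N1 H]].
destruct (figure_bounds (smallness L) 1) with (x := s)
  as [X1 [Y1 [H1 [_ [G1 [K1 _]]]]]]; [lra | lra |].
destruct (figure_bounds (- smallness L) L) with (x := t)
  as [X2 [Y2 [H2 [D2 [G2 [K2 _]]]]]]; [rewrite Rabs_Ropp; lra | lra |].
rewrite Rabs_Ropp in D2, G2, K2; rewrite A in D2, G1, G2, K1, K2.
unfold torus.
set (p := figure (smallness L) 1) in *; set (q := figure (- smallness L) L) in *.
assert (Small : forall g, Rabs g <= 16 * smallness L ->
  Rabs (2 * total_height p q s t / norm2 p q s t * g) <= 1).
{ intros g Hg.
  apply Rle_trans with (2 * (9 * (1 + L)) * (16 * smallness L)).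
  - apply Rabs_mult_le; [apply quotient_bound; [|easy]|easy].
    apply Rabs_mult_le; [apply Rabs_le; lra | easy].
  - replace (2 * (9 * (1 + L)) * (16 * smallness L)) with
      (288 * (smallness L * (1 + L))) by ring; lra. }
assert (Coord : forall c g, Rabs (c - 2 * total_height p q s t / norm2 p q s t * g)
  <= Rabs c + Rabs (2 * total_height p q s t / norm2 p q s t * g)).
{ intros c g; unfold Rminus; eapply Rle_trans; [apply Rabs_triang|].
  rewrite Rabs_Ropp; apply Rle_refl. }
assert (Big : forall g, Rabs (g - 1) <= 10 * smallness L -> Rabs g <= 2).
{ intros g Hg; apply Rabs_le_bounds in Hg; apply Rabs_le; lra. }
repeat split.
- change (Rabs (cx p s - 2 * total_height p q s t / norm2 p q s t * gx p s) <= 40).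
  eapply Rle_trans; [apply Coord|]; assert (S := Small _ G1); lra.
- change (Rabs (cy p s - 2 * total_height p q s t / norm2 p q s t * gy p s)
    <= 100 * L).
  eapply Rle_trans; [apply Coord|].
  assert (B : Rabs (2 * total_height p q s t / norm2 p q s t * gy p s)
    <= 2 * (9 * (1 + L)) * 2).
  { apply Rabs_mult_le; [|now apply Big].
    apply quotient_bound; [|easy]; apply Rabs_mult_le; [apply Rabs_le; lra|easy]. }
  lra.
- change (Rabs (cx q t - 2 * total_height p q s t / norm2 p q s t * gx q t)
    <= 100 * L).
  eapply Rle_trans; [apply Coord|]; assert (S := Small _ G2); lra.
- change (Rabs (cy q t - 2 * total_height p q s t / norm2 p q s t * gy q t) <= 40).
  replace (cy q t - 2 * total_height p q s t / norm2 p q s t * gy q t) with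
    ((cy q t - height q t)
     + height q t * ((norm2 p q s t - 2 + - 2 * (gy q t - 1)) / norm2 p q s t)
     + - (2 * height p s * gy q t / norm2 p q s t))
    by (unfold total_height; field; lra).
  eapply Rle_trans; [apply Rabs_triang|]; rewrite Rabs_Ropp.
  assert (B1 : Rabs ((cy q t - height q t) + height q t *
    ((norm2 p q s t - 2 + - 2 * (gy q t - 1)) / norm2 p q s t)) <= 1).
  { eapply Rle_trans; [apply Rabs_triang|].
    apply Rle_trans with (45 * smallness L * L + 9 * L * (24 * smallness L)).
    - apply Rplus_le_compat; [exact D2|]; apply Rabs_mult_le; [exact H2|].
      apply quotient_bound; [|easy].
      apply Rabs_le_bounds in N2; apply Rabs_le_bounds in K2; apply Rabs_le; lra.
    - nra. }
  assert (B2 : Rabs (2 * height p s * gy q t / norm2 p q s t) <= 2 * (9 * 1) * 2).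
  { apply quotient_bound; [|easy]; apply Rabs_mult_le; [|now apply Big].
    apply Rabs_mult_le; [apply Rabs_le; lra | exact H1]. }
  lra.
Qed.

Lemma torus_differences L u v : 1 <= L -> image (torus L) u -> image (torus L) v ->
  Rabs (x1 (sub4 u v)) <= 80 /\ Rabs (x2 (sub4 u v)) <= 200 * L /\
  Rabs (x3 (sub4 u v)) <= 200 * L /\ Rabs (x4 (sub4 u v)) <= 80.
Proof.
intros HL Hu Hv; coords.
destruct (torus_box L u HL Hu) as [A1 [A2 [A3 A4]]].
destruct (torus_box L v HL Hv) as [B1 [B2 [B3 B4]]].
repeat split; (eapply Rle_trans; [apply Rabs_triang|]); rewrite Rabs_Ropp; lra.
Qed.

Lemma torus_diameter L u v : 1 <= L -> image (torus L) u -> image (torus L) v ->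
  dot (sub4 u v) (sub4 u v) <= 160000 * L ^ 2.
Proof.
intros HL Hu Hv.
destruct (torus_differences L u v HL Hu Hv) as [A1 [A2 [A3 A4]]].
assert (Sq : forall a M, Rabs a <= M -> a * a <= M * M).
{ intros a M Ha; apply Rabs_le_bounds in Ha; nra. }
apply Sq in A1; apply Sq in A2; apply Sq in A3; apply Sq in A4.
unfold dot; nra.
Qed.

Lemma torus_thin L a b c d : 1 <= L ->
  image (torus L) a -> image (torus L) b -> image (torus L) c ->
  image (torus L) d ->
  gram (sub4 b a) (sub4 c a) (sub4 d a) <=
  144 * (80 * (200 * L) * (200 * L)) ^ 2.
Proof.
intros HL Ha Hb Hc Hd; apply gram_bound; [lra|].
intros z [-> | [-> | ->]]; now apply torus_differences.
Qed.

Lemma height_lower_bound e L : Rabs e <= 1 / 1000 -> 0 <= L ->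
  L / 8 <= height (figure e L) (1 / 2).
Proof.
intros He HL; simpl; assert (HP := PI_RGT_0); assert (HP4 := PI_4).
set (g := fun x => speed_of e x * (modulus e (angle x) * sin (angle x))).
assert (Hg : forall x, 0 <= x <= 1 / 2 -> wave x / 2 <= g x).
{ intros x Hx; unfold g; destruct (angle_sin_cos x) as [-> _].
  destruct (modulus_near_1 e (angle x)) as [Hm _]; [lra|].
  apply Rabs_le_bounds in Hm.
  assert (Hb := base_speed_bound x).
  assert (Hw : 0 <= wave x) by (apply sin_ge_0; nra).
  assert (Hs2 : 1 <= sqrt 2) by (rewrite <- sqrt_1; apply sqrt_le_1_alt; lra).
  destruct (closing_bound e He) as [_ Hc].
  assert (Hcw : Rabs (closing e * wave2 x) <= 1 / 2 * 1).
  { apply Rabs_mult_le; [easy | apply Rabs_le, wave2_bound]. }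
  apply Rabs_le_bounds in Hcw; unfold speed_of.
  replace (base_speed x * (1 + closing e * wave2 x) *
    (modulus e (angle x) * (2 * sqrt 2 * wave x / base_speed x))) with
    (2 * (1 + closing e * wave2 x) * modulus e (angle x) * sqrt 2 * wave x)
    by (field; lra).
  unfold Rdiv; rewrite Rmult_comm; apply Rmult_le_compat_r; [easy|].
  replace (/ 2) with (2 * (1 / 2) * (1 / 2) * 1) by field.
  repeat apply Rmult_le_compat; try lra; rewrite Rabs_pos_eq in *; try lra. }
assert (H : 1 / 8 <= primitive g (1 / 2)); [|nra].
destruct (derive_mean_value
  (fun x => primitive g x - (1 - cos (2 * PI * x)) / (4 * PI))
  (fun x => g x - wave x / 2) 0 (1 / 2)) as [c [Hc E]].
- intros x; apply (is_derive_minus (primitive g)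
    (fun x => (1 - cos (2 * PI * x)) / (4 * PI))).
  + apply (primitive_derive g), height_rate_smooth.
  + unfold wave; auto_derive; auto; field; lra.
- rewrite Rmin_left, Rmax_right in Hc by lra; specialize (Hg c Hc).
  rewrite primitive_0, Rmult_0_r, cos_0 in E.
  replace (2 * PI * (1 / 2)) with PI in E by field; rewrite cos_PI in E.
  assert (1 / 8 <= (1 - -1) / (4 * PI)).
  { apply (Rmult_le_reg_r (4 * PI)); [lra|].
    unfold Rdiv; rewrite (Rmult_assoc (1 - -1)), Rinv_l by lra; lra. }
  replace (1 / 2 - 0) with (1 / 2) in E by ring.
  assert (0 <= (g c - wave c / 2) * (1 / 2)) by (apply Rmult_le_pos; lra).
  replace ((1 - 1) / (4 * PI)) with 0 in E by (field; lra); lra.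
Qed.

Lemma torus_long L : 1 <= L ->
  L ^ 2 / 1024 <= dot (sub4 (torus L 0 (1 / 2)) (torus L 0 0))
                      (sub4 (torus L 0 (1 / 2)) (torus L 0 0)).
Proof.
intros HL; destruct (smallness_bounds L HL) as [[E1 E2] E3].
destruct (torus_estimates L HL 0 (1 / 2)) as [N2 [N1 _]].
set (u := sub4 _ _).
assert (B : L / 32 <= - x2 u).
{ unfold u; coords; unfold torus.
  set (p := figure (smallness L) 1) in *; set (q := figure (- smallness L) L) in *.
  change (L / 32 <=
    - ((cy p 0 - 2 * total_height p q 0 (1 / 2) / norm2 p q 0 (1 / 2) * gy p 0)
     - (cy p 0 - 2 * total_height p q 0 0 / norm2 p q 0 0 * gy p 0))).
  assert (Z1 : height p 0 = 0) by (simpl; rewrite primitive_0; ring).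
  assert (Z2 : height q 0 = 0) by (simpl; rewrite primitive_0; ring).
  unfold total_height; rewrite Z1, Z2.
  assert (Hh : L / 8 <= height q (1 / 2))
    by (apply height_lower_bound; [rewrite Rabs_Ropp, Rabs_pos_eq|]; lra).
  destruct (figure_bounds (smallness L) 1) with (x := 0)
    as [_ [_ [_ [_ [_ [K _]]]]]]; [rewrite Rabs_pos_eq; lra | lra |].
  rewrite (Rabs_pos_eq (smallness L)) in K by lra; apply Rabs_le_bounds in K; fold p in K.
  apply Rabs_le_bounds in N2.
  set (n := norm2 p q 0 (1 / 2)) in *.
  replace (- _) with (height q (1 / 2) * (2 * gy p 0 * / n))
    by (unfold Rdiv; ring).
  assert (/ 4 <= / n) by (apply Rinv_le_contravar; lra).
  assert (1 / 4 <= 2 * gy p 0 * / n).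
  { replace (1 / 4) with (1 * / 4) by field; apply Rmult_le_compat; lra. }
  replace (L / 32) with (L / 8 * (1 / 4)) by field.
  apply Rmult_le_compat; lra. }
unfold dot; nra.
Qed.

Lemma tori_not_similar L : 1 <= L -> exists T, forall L', T <= L' -> 1 <= L' ->
  ~ similar_surfaces (torus L) (torus L') /\
  ~ similar_surfaces (torus L') (torus L).
Proof.
intros HL; destruct (smallness_bounds L HL) as [[E1 E2] _].
assert (Hp := figure_axioms (smallness L) 1).
assert (Hq := figure_axioms (- smallness L) L).
destruct (special_not_planar _ _ _ _ _ _ _ _ _ Hp Hq
  (fun s t => Rgt_not_eq _ _ (proj1 (torus_lame L HL s t)))
  (fun s t => Rgt_not_eq _ _ (proj2 (torus_lame L HL s t)))
  (figure_special (smallness L) L ltac:(lra)))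
  as [a [b [c [d [Ha [Hb [Hc [Hd Hg]]]]]]]].
set (g := gram (sub4 b a) (sub4 c a) (sub4 d a)) in *.
set (D := 160000 * L ^ 2).
set (W := 144 * (80 * 200 * 200) ^ 2 * D ^ 3 * 1024 ^ 3).
exists (W / g + 1); intros L' HT HL'.
assert (HD : 0 <= D ^ 3) by (apply pow_le; unfold D; nra).
assert (HW : W < g * L').
{ assert (Q : W / g * g = W) by (field; lra); nra. }
assert (No : ~ (similar_surfaces (torus L) (torus L') \/
                similar_surfaces (torus L') (torus L))).
{ intros Hsim; destruct (similar_scaled _ _ Hsim) as [mu [Hmu Hsc]].
  revert Hsc.
  apply (thin_not_scaled _ _ mu a b c d (torus L' 0 (1 / 2)) (torus L' 0 0) D
    (144 * (80 * (200 * L') * (200 * L')) ^ 2)); auto.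
  - intros; now apply torus_diameter.
  - intros; now apply torus_thin.
  - now exists 0, (1 / 2).
  - now exists 0, 0.
  - fold g; assert (Hl := torus_long L' HL').
    set (l := dot _ _) in *.
    assert (Hl3 : (L' ^ 2 / 1024) ^ 3 <= l ^ 3).
    { apply pow_incr; split; [|easy].
      apply Rmult_le_pos; [apply pow2_ge_0 | lra]. }
    apply Rlt_le_trans with (g * (L' ^ 2 / 1024) ^ 3);
      [|apply Rmult_le_compat_l; lra].
    apply (Rmult_lt_reg_r (1024 ^ 3)); [lra|].
    replace (144 * (80 * (200 * L') * (200 * L')) ^ 2 * D ^ 3 * 1024 ^ 3)
      with (W * L' ^ 4) by (unfold W; ring).
    replace (g * (L' ^ 2 / 1024) ^ 3 * 1024 ^ 3) with (g * L' * L' * L' ^ 4)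
      by field.
    apply Rmult_lt_compat_r; [apply pow_lt; lra|].
    assert (0 < g * L') by (apply Rmult_lt_0_compat; lra); nra. }
split; intros H; apply No; auto.
Qed.

Lemma sparse_sequence (T : R -> R) : exists l : nat -> R,
  (forall n, 1 <= l n) /\ (forall m n, (m < n)%nat -> T (l m) <= l n).
Proof.
set (l := fix l n := match n with
  | O => 1 | S n => Rmax (l n) (T (l n)) end).
assert (Mono : forall m n, (m <= n)%nat -> l m <= l n).
{ intros m n H; induction H as [|n H IH]; [apply Rle_refl|].
  apply Rle_trans with (1 := IH), Rmax_l. }
exists l; split.
- intros n; apply (Mono 0%nat); lia.
- intros m n H; apply Rle_trans with (2 := Mono (S m) n H), Rmax_r.
Qed.

Theorem theorem17 :
  exists f : nat -> R -> R -> R4,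
    (forall n : nat,
        torus_map (f n) /\
        immersion (f n) /\
        flat_induced_metric (f n) /\
        flat_normal_bundle (f n) /\
        ~ product_of_curves (f n) /\
        ~ in_affine_3sphere (f n)) /\
    (forall m n : nat, m <> n -> ~ similar_surfaces (f m) (f n)).
Proof.
assert (HT : forall L, exists T, 1 <= L -> forall L', T <= L' -> 1 <= L' ->
  ~ similar_surfaces (torus L) (torus L') /\
  ~ similar_surfaces (torus L') (torus L)).
{ intros L; destruct (Rle_dec 1 L) as [HL|HL].
  - destruct (tori_not_similar L HL) as [T H]; now exists T.
  - now exists 0. }
apply functional_choice in HT; destruct HT as [T HT].
destruct (sparse_sequence T) as [l [H1 Hl]].
exists (fun n => torus (l n)); split.
- intros n; apply torus_properties, H1.
- intros m n Hmn; destruct (Nat.lt_gt_cases m n) as [C _].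
  destruct (C Hmn) as [H|H].
  + apply (HT (l m) (H1 m) (l n)); auto.
  + apply (HT (l n) (H1 n) (l m)); auto.
Qed.
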